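(* Let $\widetilde\Sigma$ be the stellar subdivision of a $d$-dimensional simplicial fan $\Sigma$ at a two-dimensional cone $\sigma$, let $\rho$ be the ray that subdivides $\sigma$, and set $\widetilde\Delta=\mathrm{st}_{\widetilde\Sigma}(\rho)$ and $\Delta=\mathrm{st}_{\Sigma}(\sigma)$. The fan $\Delta$ is Lefschetz if and only if the fan $\widetilde\Delta$ is Lefschetz.
   Context: Fans are rational simplicial in $\mathrm N=\mathbb R\otimes\mathrm N_{\mathbb Z}$. The stellar subdivision of $\Sigma$ at $\sigma$ adds the ray $\rho$ spanned by the sum of the primitive generators of the rays of $\sigma$, removes all cones containing $\sigma$, and adds the cones $\rho+\tau+\lambda$ for $\tau$ a proper face of $\sigma$ and $\lambda$ a cone of the link of $\sigma$. For a cone $\tau$, $\mathrm{st}_\Sigma(\tau)$ is the fan in $\mathrm N/\mathrm{span}(\tau)$ of images of cones of $\Sigma$ containing $\tau$. Lefschetz: a $d$-dimensional simplicial fan whose $d$-dimensional Minkowski weights are spanned by a positive weight (giving $\deg:A^d\cong\mathbb R$), satisfying Poincaré duality on its Chow ring $A$, the hard Lefschetz property and Hodge–Riemann relations for every strictly convex class $\ell\in\mathscr K$ (classes whose restriction to every star has a representative positive on the nonzero support), and such that the star of every nonzero cone is again Lefschetz. *)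

(* Defs.v *)
From HB Require Import structures.
From mathcomp Require Import all_boot all_order all_algebra.
From mathcomp Require Import zify.
From mathcomp Require Import reals.
From mathcomp Require Import mpoly.
Set Implicit Arguments.
Unset Strict Implicit.
Unset Printing Implicit Defensive.
Import Order.TTheory GRing.Theory Num.Theory.
Local Open Scope ring_scope.

Definition content n (v : 'rV[int]_n) : nat :=
  \big[gcdn/0%N]_(j < n) absz (v 0 j).

(* The primitive generator of the ray spanned by v, for v != 0. *)
Definition primv n (v : 'rV[int]_n) : 'rV[int]_n :=
  \row_j divz (v 0 j) (content v)%:Z.

Lemma int_diag_form m n (M : 'M[int]_(m, n)) :
  {r : nat & (r <= m)%N /\ (r <= n)%N &
  {A : 'M[int]_m & (map_mx (intr : int -> rat) A) \in unitmx &
  {R : 'M[int]_n | R \in unitmx & M = A *m pid_mx r *m R}}}.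
Proof.
have [L Lu [R Ru [d d_sorted defM]]] := int_Smith_normal_form M.
have Pex : exists i, d`_i == 0 by exists (size d); rewrite nth_default.
pose r0 := ex_minn Pex.
have d_eq0 i : (d`_i == 0) = (r0 <= i)%N.
  rewrite /r0; case: ex_minnP => r dr0 rmin.
  apply/idP/idP => [/rmin //|le_ri].
  have [lt_i|ge_i] := ltnP i (size d); last by rewrite nth_default.
  have := sorted_leq_nth dvdz_trans (fun x => dvdzz x) 0 d_sorted.
  move=> /(_ r i); rewrite !inE (leq_ltn_trans le_ri lt_i) lt_i le_ri.
  by move=> /(_ isT isT isT); rewrite (eqP dr0) dvd0z.
pose r := minn r0 (minn m n).
exists r; first by split; rewrite /r; lia.
pose e : 'rV[int]_m := \row_(i < m) (if (i < r)%N then d`_i else 1).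
exists (L *m diag_mx e).
  rewrite map_mxM unitmx_mul; apply/andP; split.
    by rewrite unitmxE det_map_mx; apply: rmorph_unit; rewrite -unitmxE.
  rewrite map_diag_mx unitmxE det_diag unitfE prodf_seq_neq0.
  apply/allP => i _ /=; rewrite !mxE; case: ifP => [lt_ir|_]; last by rewrite oner_eq0.
  by rewrite intr_eq0 d_eq0 -ltnNge (leq_trans lt_ir) // /r geq_minl.
exists R => //; rewrite {1}defM -(mulmxA L (diag_mx e)); congr (_ *m _ *m _).
apply/matrixP => i j; rewrite mul_diag_mx !mxE.
case: (eqVneq (i : nat) j) => [eq_ij|]; last by rewrite mulr0n mulr0.
rewrite mulr1n /=; case: ltnP => [_|le_ri]; first by rewrite mulr1.
rewrite mulr0; apply/eqP; rewrite d_eq0.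
have := ltn_ord i; have := ltn_ord j; rewrite -eq_ij; move: le_ri; rewrite /r; lia.
Qed.

Lemma lattice_quotient m n (M : 'M[int]_(m, n)) :
  {Q : 'M[int]_(n, n - \rank (map_mx (intr : int -> rat) M)) |
    (exists P, P *m Q = 1%:M) &
    forall v : 'rV[int]_n, v *m Q = 0 <->
      (map_mx (intr : int -> rat) v <= map_mx (intr : int -> rat) M)%MS}.
Proof.
have [r [le_rm le_rn] [A Au [R Ru defM]]] := int_diag_form M.
have RuQ : map_mx (intr : int -> rat) R \in unitmx.
  by rewrite unitmxE det_map_mx; apply: rmorph_unit; rewrite -unitmxE.
have eqM : (map_mx intr M :=: (pid_mx r : 'M[rat]_(m, n)) *m map_mx intr R)%MS.
  rewrite defM !map_mxM map_pid_mx -mulmxA.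
  by apply: eqmxMfull; rewrite row_full_unit.
have -> : \rank (map_mx (intr : int -> rat) M) = r.
  by rewrite eqM mxrankMfree ?row_free_unit ?rank_pid_mx.
pose S : 'M[int]_(n, n - r) := \matrix_(i, j) (i == r + j :> nat)%N%:R.
have ltS (j : 'I_(n - r)) : (r + j < n)%N by have := ltn_ord j; lia.
have mulS k (B : 'M[int]_(k, n)) i j : (B *m S) i j = B i (Ordinal (ltS j)).
  rewrite mxE (bigD1 (Ordinal (ltS j))) //= mxE eqxx mulr1 big1 ?addr0 // => l.
  by rewrite mxE -val_eqE /= => /negPf->; rewrite mulr0.
exists (invmx R *m S).
  exists (S^T *m R); rewrite mulmxA -(mulmxA S^T) mulmxV // mulmx1.
  apply/matrixP => i j; rewrite mulS !mxE /= eqn_add2l eq_sym.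
  by congr (_%:R); rewrite eq_sym.
move=> v; rewrite eqM mulmxA; set u := v *m invmx R.
have defv : map_mx intr v = map_mx intr u *m map_mx (intr : int -> rat) R.
  by rewrite -map_mxM /u mulmxKV.
rewrite defv submxMfree ?row_free_unit //.
split=> [uS0|/submxP[w defu]].
  suff -> : map_mx intr u = map_mx intr u *m (pid_mx r : 'M[rat]_(n, m))
                              *m (pid_mx r : 'M[rat]_(m, n)) by exact: submxMl.
  rewrite -mulmxA mul_pid_mx minnn (minn_idPr le_rm).
  apply/rowP => j; rewrite mxE [RHS]mxE (bigD1 j) //= big1 => [|i ne_ij]; last first.
    by rewrite !mxE val_eqE (negPf ne_ij) mulr0.
  rewrite !mxE eqxx addr0 /=; case: ltnP => [_|le_rj]; first by rewrite mulr1.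
  have lt_j : (j - r < n - r)%N by have := ltn_ord j; lia.
  have := congr1 (fun B : 'rV[int]_(n - r) => B 0 (Ordinal lt_j)) uS0.
  rewrite mulS [RHS]mxE mulr0 => uj0.
  transitivity ((u 0 (Ordinal (ltS (Ordinal lt_j))))%:~R : rat); last by rewrite uj0.
  by rewrite !mxE; have -> : Ordinal (ltS (Ordinal lt_j)) = j by apply: val_inj; rewrite /= subnKC.
apply/rowP => j; rewrite mulS [RHS]mxE; apply/eqP; rewrite -(intr_eq0 rat); apply/eqP.
have := congr1 (fun B : 'rV[rat]_n => B 0 (Ordinal (ltS j))) defu.
rewrite mxE => ->; rewrite mxE big1 // => i _.
by rewrite !mxE /=; case: eqP => [->|] /=; rewrite ?ltnNge ?leq_addr ?mulr0.
Qed.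

(* A simplicial fan in R ⊗ Z^lrank, given by vectors gen i of Z^lrank and by
   the sets of rays of its cones: A \in cones stands for the cone spanned by
   the gen i with i in A.  The rays are the indices i with [set i] \in cones;
   the other indices (which appear when passing to a star) play no role. *)
Record fan := Fan {
  lrank : nat;
  nrays : nat;
  gen : 'I_nrays -> 'rV[int]_lrank;
  cones : {set {set 'I_nrays}} }.

Section FanGeometry.
Variable R : realType.

Definition rgen (S : fan) (i : 'I_(nrays S)) : 'rV[R]_(lrank S) :=
  map_mx intr (gen i).

Definition in_cone (S : fan) (A : {set 'I_(nrays S)}) (v : 'rV[R]_(lrank S)) :=
  exists2 a : 'I_(nrays S) -> R,
    forall i, 0 <= a i & v = \sum_(i in A) a i *: rgen i.

Definition simplicial_fan (S : fan) : Prop :=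
  [/\ set0 \in cones S,
      forall A B : {set 'I_(nrays S)},
        A \in cones S -> B \subset A -> B \in cones S,
      forall i : 'I_(nrays S), [set i] \in cones S -> content (gen i) = 1%N,
      forall (A : {set 'I_(nrays S)}) (a : 'I_(nrays S) -> R), A \in cones S ->
        \sum_(i in A) a i *: rgen i = 0 -> forall i, i \in A -> a i = 0 &
      forall (A B : {set 'I_(nrays S)}) (v : 'rV[R]_(lrank S)),
        A \in cones S -> B \in cones S ->
        in_cone A v -> in_cone B v -> in_cone (A :&: B) v].

End FanGeometry.

Definition fdim (S : fan) : nat := \max_(A in cones S) #|A|.

Definition cone_mx (S : fan) (A : {set 'I_(nrays S)}) : 'M[int]_(#|A|, lrank S) :=
  \matrix_(i < #|A|) gen (enum_val i).

(* N / span A, whose lattice is the image of that of N, is identified with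
   R ⊗ Z^(qrank A); by [lattice_quotient] the matrix qmap A is surjective on
   lattices and its kernel is the set of lattice points of span A. *)
Definition qrank (S : fan) (A : {set 'I_(nrays S)}) : nat :=
  (lrank S - \rank (map_mx (intr : int -> rat) (cone_mx A)))%N.

Definition qmap (S : fan) (A : {set 'I_(nrays S)}) : 'M[int]_(lrank S, qrank A) :=
  s2val (lattice_quotient (cone_mx A)).

(* The image of gen i in N / span A is qmult A i times the primitive generator
   of the image ray. *)
Definition qmult (S : fan) (A : {set 'I_(nrays S)}) (i : 'I_(nrays S)) : nat :=
  content (gen i *m qmap A).

(* The rays of the image of a cone B containing A are the images of the rays of
   B not in A. *)
Definition star (S : fan) (A : {set 'I_(nrays S)}) : fan :=
  Fan (fun i => primv (gen i *m qmap A))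
      [set B :\: A | B in cones S & A \subset B].

Definition link (S : fan) (A : {set 'I_(nrays S)}) : {set {set 'I_(nrays S)}} :=
  [set B in cones S | [disjoint A & B] & A :|: B \in cones S].

(* The new ray is ord_max, and an old ray i becomes lift ord_max i. *)
Definition stellar (S : fan) (A : {set 'I_(nrays S)}) : fan :=
  let up (B : {set 'I_(nrays S)}) : {set 'I_(nrays S).+1} :=
    [set lift ord_max i | i in B] in
  Fan (fun i : 'I_(nrays S).+1 =>
         if unlift ord_max i is Some j then gen j
         else primv (\sum_(j in A) gen j))
      ([set up B | B in cones S & ~~ (A \subset B)] :|:
       [set ord_max |: up (T :|: L) | T in [set T : {set 'I_(nrays S)} | T \proper A],
                                  L in link A]).

Definition new_ray (S : fan) (A : {set 'I_(nrays S)}) :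
  {set 'I_(nrays (stellar A))} := [set (ord_max : 'I_(nrays S).+1)].

Section Lefschetz.
Variable R : realType.

Section OneFan.
Variable S : fan.
Local Notation ray := ('I_(nrays S)).
Local Notation poly := {mpoly R[nrays S]}.

Definition xmon (A : {set ray}) : poly := \prod_(i in A) 'X_i.

(* The piecewise linear function with value c i on gen i. *)
Definition pl_form (c : ray -> R) : poly :=
  \sum_(i : ray | [set i] \in cones S) c i *: 'X_i.

Definition chow_relation (g : poly) : Prop :=
  (exists2 A : {set ray}, A \notin cones S & g = xmon A) \/
  (exists m : 'cV[R]_(lrank S), g = pl_form (fun i => (rgen R i *m m) 0 0)).

(* The Chow ring A is the quotient of poly by this ideal, and A^k consists of
   the classes of the polynomials in k.-homog. *)
Definition chow_ideal (p : poly) : Prop :=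
  exists2 s : seq (poly * poly),
    forall fg, fg \in s -> chow_relation fg.2 & p = \sum_(fg <- s) fg.1 * fg.2.

(* Here gen (star S T) i is the primitive generator of the image in N / span T
   of the cone spanned by T and the ray i. *)
Definition minkowski_weight (k : nat) (w : {set ray} -> R) : Prop :=
  forall T : {set ray}, T \in cones S -> #|T|.+1 = k ->
    \sum_(i : ray | (i \notin T) && (i |: T \in cones S))
      w (i |: T) *: rgen R (i : 'I_(nrays (star T))) = 0.

Definition positive_weight (k : nat) (w : {set ray} -> R) : Prop :=
  forall A, A \in cones S -> #|A| = k -> 0 < w A.

(* The space of k-dimensional Minkowski weights is the line spanned by w; only
   the values on k-dimensional cones matter. *)
Definition spans_weights (k : nat) (w : {set ray} -> R) : Prop :=
  minkowski_weight k w /\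
  forall v, minkowski_weight k v ->
    exists c : R, forall A, A \in cones S -> #|A| = k -> v A = c * w A.

(* The index in N_Z ∩ span A of the sublattice spanned by the gen i, i in A,
   as the gcd of the maximal minors. *)
Definition mult (A : {set ray}) : nat :=
  \big[gcdn/0%N]_(f : {ffun 'I_#|A| -> 'I_(lrank S)})
    absz (\det (colsub f (cone_mx A))).

(* The isomorphism A^d = R induced by w.  As balancing is expressed with
   lattice generators, the monomial of a d-dimensional cone A has degree
   w A / mult A. *)
Definition degree_map (d : nat) (w : {set ray} -> R) (deg : {scalar poly}) : Prop :=
  [/\ forall p, p \is d.-homog -> (deg p = 0 <-> chow_ideal p),
      forall x : R, exists2 p, p \is d.-homog & deg p = x &
      forall A, A \in cones S -> #|A| = d -> deg (xmon A) * (mult A)%:R = w A].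

Definition poincare_duality (d : nat) (deg : {scalar poly}) : Prop :=
  forall k (p : poly), (k <= d)%N -> p \is k.-homog ->
    (forall q : poly, q \is (d - k).-homog -> deg (p * q) = 0) ->
    chow_ideal p.

Definition hard_lefschetz (d : nat) (l : poly) : Prop :=
  forall k, (k.*2 <= d)%N ->
    (forall p : poly, p \is k.-homog ->
       chow_ideal (l ^+ (d - k.*2) * p) -> chow_ideal p) /\
    (forall q : poly, q \is (d - k).-homog ->
       exists2 p : poly, p \is k.-homog & chow_ideal (q - l ^+ (d - k.*2) * p)).

Definition hodge_riemann (d : nat) (deg : {scalar poly}) (l : poly) : Prop :=
  forall k (p : poly), (k.*2 <= d)%N -> p \is k.-homog ->
    chow_ideal (l ^+ (d - k.*2).+1 * p) -> ~ chow_ideal p ->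
    0 < (-1) ^+ k * deg (l ^+ (d - k.*2) * p * p).

(* Positivity, on the nonzero part of the support, of the piecewise linear
   function with value c i on gen i. *)
Definition pl_positive (c : ray -> R) : Prop :=
  forall (A : {set ray}) (a : ray -> R), A \in cones S -> (forall i, 0 <= a i) ->
    \sum_(i in A) a i *: rgen R i != 0 -> 0 < \sum_(i in A) a i * c i.

End OneFan.

(* c' is a representative of the restriction to star T of the class of c: for
   some linear form m equal to c on T, the function c - m descends to c'. *)
Definition restricts_to (S : fan) (T : {set 'I_(nrays S)})
    (c : 'I_(nrays S) -> R) (c' : 'I_(nrays (star T)) -> R) : Prop :=
  exists2 m : 'cV[R]_(lrank S),
    forall i, i \in T -> (rgen R i *m m) 0 0 = c i &
    forall i : 'I_(nrays S), [set i] \in cones (star T) ->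
      c i - (rgen R i *m m) 0 0 = (qmult T i)%:R * c' i.

Definition strictly_convex (S : fan) (c : 'I_(nrays S) -> R) : Prop :=
  forall T : {set 'I_(nrays S)}, T \in cones S ->
    exists2 c' : 'I_(nrays (star T)) -> R, restricts_to c c' & pl_positive c'.

Definition lefschetz_conditions (S : fan) : Prop :=
  let d := fdim S in
  exists (w : {set 'I_(nrays S)} -> R) (deg : {scalar {mpoly R[nrays S]}}),
    [/\ positive_weight d w, spans_weights d w, degree_map d w deg,
        poincare_duality d deg &
        forall c : 'I_(nrays S) -> R, strictly_convex c ->
          hard_lefschetz d (pl_form c) /\ hodge_riemann d deg (pl_form c)].

Inductive lefschetz (S : fan) : Prop :=
  Lefschetz of lefschetz_conditions S
    & (forall T : {set 'I_(nrays S)},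
         T \in cones S -> T != set0 -> lefschetz (star T)).

End Lefschetz.

(* Main.v *)
(* Let a, b be the rays of sigma.  The fan tDelta is a projective line bundle
   over Delta: besides the rays of Delta it has two opposite rays a and b, its
   cones are L, a + L and b + L for L in Delta, and its star at a is Delta.
   Since stars of stars are stars, one implication is immediate.

   For the other one, A(tDelta) = A(Delta)[x] / (x (x + c)) with c in A^1(Delta),
   which gives Poincare duality.  The stars of the bundle are stars of Delta, or
   bundles over them, hence by induction satisfy the Hodge-Riemann relations;
   for the rays these imply hard Lefschetz for the bundle.  The argument applies
   to an arbitrary class c, in particular to s c for all s in [0, 1], where a
   convex class of tDelta stays convex.  For s = 0 the Hodge-Riemann relations
   follow from those of Delta by splitting primitive classes explicitly, and
   hard Lefschetz for all s carries them over to s = 1. *)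
Require Import Defs.
From HB Require Import structures.
From mathcomp Require Import all_boot all_order all_algebra.
From mathcomp Require Import reals.
From mathcomp Require Import perm boolp mpoly ring lra zify polyrcf.

Set Implicit Arguments.
Unset Strict Implicit.
Unset Printing Implicit Defensive.
Import Order.TTheory GRing.Theory Num.Theory.
Local Open Scope ring_scope.

(** * Ideals and substitutions in polynomial rings *)

Section Generated.
Variables (R : realType) (n : nat).
Local Notation P := {mpoly R[n]}.
Implicit Types (rel : P -> Prop) (p q : P).

(** The twist c is a linear form with value 1 at a and -1 at b; it vanishes at the new ray, which is
    spanned by the sum of the two generators. In the star over a cone T of Delta it becomes c - m,
    with m linear and equal to c on T, so all statements about bundles quantify over c.

    Along the path s c the ring, the degree and the space of primitive classes all vary. One family
    of monomials is a basis for every s and the degree is polynomial in s, so the forms become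
    matrices over R[s]. The primitive classes of degree k are the kernel of the pairing with l
    A^(k-1); instead of a basis of this moving kernel, a correction is added to the form, which
    makes it definite exactly when the form is definite on the kernel. Hard Lefschetz in degrees k
    and k - 1 makes the corrected form invertible, and an invertible form cannot lose definiteness
    along a path.

    Convexity survives because a class f, normalized by f b = 0, is convex on the bundle iff f a > 0
    and both f and f - f a c are convex on Delta, and f - s f a c lies on the segment between these
    two. *)

Definition generated rel p : Prop :=
  exists2 s : seq (P * P),
    forall fg, fg \in s -> rel fg.2 & p = \sum_(fg <- s) fg.1 * fg.2.

Lemma generated0 rel : generated rel 0.
Proof. by exists [::]; rewrite ?big_nil. Qed.

Lemma generatedD rel p q : generated rel p -> generated rel q -> generated rel (p + q).
Proof.
move=> [s Hs ->] [t Ht ->]; exists (s ++ t); rewrite ?big_cat //.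
by move=> fg; rewrite mem_cat => /orP[/Hs|/Ht].
Qed.

Lemma generatedM rel p q : generated rel q -> generated rel (p * q).
Proof.
move=> [s Hs ->]; exists [seq (p * fg.1, fg.2) | fg <- s].
  by move=> _ /mapP[fg /Hs ? ->].
by rewrite big_map mulr_sumr; apply: eq_bigr => fg _; rewrite mulrA.
Qed.

Lemma generatedMr rel p q : generated rel q -> generated rel (q * p).
Proof. by rewrite mulrC; apply: generatedM. Qed.

Lemma generatedZ rel c p : generated rel p -> generated rel (c *: p).
Proof. by rewrite -mul_mpolyC; apply: generatedM. Qed.

Lemma generatedN rel p : generated rel p -> generated rel (- p).
Proof. by rewrite -scaleN1r; apply: generatedZ. Qed.

Lemma generatedB rel p q : generated rel p -> generated rel q -> generated rel (p - q).
Proof. by move=> Hp Hq; apply: generatedD => //; apply: generatedN. Qed.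

Lemma generated_sum rel (I : Type) (r : seq I) (Q : pred I) (F : I -> P) :
  (forall i, Q i -> generated rel (F i)) -> generated rel (\sum_(i <- r | Q i) F i).
Proof.
by move=> HF; apply: big_ind => //; [exact: generated0|exact: generatedD].
Qed.

Lemma generated_rel rel p : rel p -> generated rel p.
Proof.
move=> Hp; exists [:: (1, p)]; last by rewrite big_seq1 mul1r.
by move=> fg; rewrite inE => /eqP->.
Qed.

Lemma generated_ind rel (Q : P -> Prop) :
  Q 0 -> (forall p q, Q p -> Q q -> Q (p + q)) ->
  (forall f g, rel g -> Q (f * g)) ->
  forall p, generated rel p -> Q p.
Proof.
move=> Q0 QD QM p [s Hs ->]; rewrite big_seq; apply: big_ind => // fg /Hs.
exact: QM.
Qed.

Lemma generated_subl rel p q :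
  generated rel (p - q) -> generated rel q -> generated rel p.
Proof. by move=> Hpq Hq; rewrite -(subrK q p); apply: generatedD. Qed.

Lemma generated_subr rel p q :
  generated rel (p - q) -> generated rel p -> generated rel q.
Proof. by move=> Hpq Hp; rewrite -[q](subKr p); apply: generatedB. Qed.

Lemma generated_congrM rel p p' q q' :
  generated rel (p - p') -> generated rel (q - q') -> generated rel (p * q - p' * q').
Proof.
move=> Hp Hq; have -> : p * q - p' * q' = p * (q - q') + q' * (p - p') by ring.
by apply: generatedD; apply: generatedM.
Qed.

Lemma generated_congrX rel p q k :
  generated rel (p - q) -> generated rel (p ^+ k - q ^+ k).
Proof.
move=> Hpq; elim: k => [|k IH]; first by rewrite subrr; apply: generated0.
by rewrite !exprS; apply: generated_congrM.
Qed.

End Generated.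

Lemma generated_map (R : realType) n m (rel : {mpoly R[n]} -> Prop)
    (rel' : {mpoly R[m]} -> Prop) (phi : {rmorphism {mpoly R[n]} -> {mpoly R[m]}}) p :
  (forall g, rel g -> generated rel' (phi g)) ->
  generated rel p -> generated rel' (phi p).
Proof.
move=> H; move: p; apply: generated_ind => [|p q|f g /H].
- by rewrite rmorph0; apply: generated0.
- by rewrite rmorphD; apply: generatedD.
- by rewrite rmorphM; apply: generatedM.
Qed.

(** * Induction principles and homogeneity in polynomial rings *)

Section Mpoly.
Variables (R : realType) (n : nat).
Local Notation P := {mpoly R[n]}.

Lemma mpoly_ring_ind (Q : P -> Prop) :
  (forall c, Q c%:MP) -> (forall i, Q 'X_i) ->
  (forall p q, Q p -> Q q -> Q (p + q)) ->
  (forall p q, Q p -> Q q -> Q (p * q)) -> forall p, Q p.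
Proof.
move=> QC QX QD QM p; elim/mpolyind: p => [|c m p _ _ Hp]; first by rewrite -mpolyC0.
apply: (QD) Hp; rewrite -mul_mpolyC; apply: (QM) => //; rewrite mpolyXE_id.
apply: (big_ind Q) => [|p1 q|i _]; [by rewrite -mpolyC1 | exact: (QM) |].
by elim: (m i) => [|k IH]; rewrite ?expr0 -?mpolyC1 // exprS; apply: (QM).
Qed.

Lemma dhomogXU (i : 'I_n) : ('X_i : P) \is 1.-homog.
Proof. by rewrite dhomogX /= mdeg1. Qed.

Lemma dhomogMe d1 d2 d (p q : P) : p \is d1.-homog -> q \is d2.-homog ->
  (d1 + d2)%N = d -> p * q \is d.-homog.
Proof. by move=> Hp Hq <-; apply: dhomogM. Qed.

Lemma dhomogXe k d (p : P) : p \is 1.-homog -> k = d -> p ^+ k \is d.-homog.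
Proof. by move=> Hp <-; have := dhomogMn k Hp; rewrite mul1n. Qed.

Lemma dhomogB d (p q : P) : p \is d.-homog -> q \is d.-homog -> p - q \is d.-homog.
Proof. by move=> Hp Hq; rewrite dhomogD // dhomogN. Qed.

Lemma dhomog_sum d (I : Type) (r : seq I) (Q : pred I) (F : I -> P) :
  (forall i, Q i -> F i \is d.-homog) -> \sum_(i <- r | Q i) F i \is d.-homog.
Proof. exact: rpred_sum. Qed.

Lemma dhomog_ind d (Q : P -> Prop) :
  Q 0 -> (forall c p q, Q p -> Q q -> Q (c *: p + q)) ->
  (forall m, mdeg m = d -> Q 'X_[m]) -> forall p, p \is d.-homog -> Q p.
Proof.
move=> Q0 QD QX p /dhomogP Hp; rewrite (mpolyE p) big_seq.
elim/big_rec: _ => // m q /Hp; rewrite /= => Hm Hq.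
by apply: QD => //; apply: QX.
Qed.

Lemma mdegS_split (m : 'X_{1..n}) k : mdeg m = k.+1 ->
  exists i m', m = (U_(i) + m')%MM /\ mdeg m' = k.
Proof.
move=> dm; have [i mi] : exists i, m i != 0%N.
  apply/existsP; rewrite -negb_forall; apply/negP => /forallP mm0.
  by move: dm; rewrite mdegE big1 // => i _; apply/eqP/mm0.
have em : m = (U_(i) + (m - U_(i)))%MM.
  by rewrite addmC submK //; apply/mnm_lepP => j; rewrite mnm1E; case: eqP => [<-|//]; rewrite lt0n.
by exists i, (m - U_(i))%MM; split=> //; move: dm; rewrite {1}em mdegD mdeg1 add1n => -[].
Qed.

End Mpoly.

(* Locked, since unification would otherwise unfold substitutions into sums
   over monomials. *)
HB.lock Definition psub (R : realType) n m (h : 'I_n -> {mpoly R[m]})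
  (p : {mpoly R[n]}) : {mpoly R[m]} := comp_mpoly (mktuple h) p.

Section Substitution.
Variables (R : realType) (n : nat).
Local Notation P := {mpoly R[n]}.

Lemma psub_is_additive m (h : 'I_n -> {mpoly R[m]}) : additive (psub h).
Proof. by rewrite psub.unlock => p q; rewrite raddfB. Qed.
HB.instance Definition _ m (h : 'I_n -> {mpoly R[m]}) :=
  GRing.isAdditive.Build P {mpoly R[m]} (psub h) (psub_is_additive h).

Lemma psub_is_multiplicative m (h : 'I_n -> {mpoly R[m]}) : multiplicative (psub h).
Proof. by rewrite psub.unlock; split=> [p q|]; rewrite ?rmorphM ?rmorph1. Qed.
HB.instance Definition _ m (h : 'I_n -> {mpoly R[m]}) :=
  GRing.isMultiplicative.Build P {mpoly R[m]} (psub h) (psub_is_multiplicative h).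

Lemma psub_is_scalable m (h : 'I_n -> {mpoly R[m]}) : scalable (psub h).
Proof. by rewrite psub.unlock => c p; rewrite linearZ. Qed.
HB.instance Definition _ m (h : 'I_n -> {mpoly R[m]}) :=
  GRing.isScalable.Build R P {mpoly R[m]} *:%R (psub h) (psub_is_scalable h).

Lemma psubX m (h : 'I_n -> {mpoly R[m]}) i : psub h 'X_i = h i.
Proof. by rewrite psub.unlock comp_mpolyXU -tnth_nth tnth_mktuple. Qed.

Lemma psubC m (h : 'I_n -> {mpoly R[m]}) c : psub h c%:MP = c%:MP.
Proof. by rewrite psub.unlock comp_mpolyC. Qed.

Lemma dhomog_psub m (h : 'I_n -> {mpoly R[m]}) d p :
  (forall i, h i \is 1.-homog) -> p \is d.-homog -> psub h p \is d.-homog.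
Proof.
move=> Hh; move: p; apply: dhomog_ind => [|c p q Hp Hq|mm <-].
- by rewrite raddf0 dhomog0.
- by rewrite linearP dhomogD // dhomogZ.
rewrite psub.unlock comp_mpolyX mdegE; elim/big_rec2: _ => [|i p k _ Hp]; first exact: dhomog1.
by apply: (@dhomogMe _ _ (mm i) k) => //; apply: dhomogXe; rewrite ?tnth_mktuple.
Qed.

End Substitution.

(** * Fans up to rescaling *)

Section Graded.
Variables (R : realType) (n : nat).
Local Notation P := {mpoly R[n]}.
Variables (I : P -> Prop) (d : nat).

(** This property and the next two see a fan only through its ideal and its dimension, so they can
    be moved between descriptions of a fan with the same ideal. *)
Definition pd_property (deg : {scalar P}) : Prop :=
  forall k (p : P), (k <= d)%N -> p \is k.-homog ->
    (forall q : P, q \is (d - k).-homog -> deg (p * q) = 0) -> I p.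

Definition hl_property (l : P) : Prop :=
  forall k, (k.*2 <= d)%N ->
    (forall p : P, p \is k.-homog -> I (l ^+ (d - k.*2) * p) -> I p) /\
    (forall q : P, q \is (d - k).-homog ->
       exists2 p : P, p \is k.-homog & I (q - l ^+ (d - k.*2) * p)).

Definition hr_property (deg : {scalar P}) (l : P) : Prop :=
  forall k (p : P), (k.*2 <= d)%N -> p \is k.-homog ->
    I (l ^+ (d - k.*2).+1 * p) -> ~ I p ->
    0 < (-1) ^+ k * deg (l ^+ (d - k.*2) * p * p).

End Graded.

(* A fan is recorded by the set C of its cones and by the space L of the
   functions on the rays induced by linear forms; passing to the star of T
   only restricts L to the functions vanishing on T, whence no lattice and no
   normalization of the generators is needed. *)
Section FanData.
Variables (R : realType) (n : nat).
Local Notation P := {mpoly R[n]}.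
Local Notation ray := 'I_n.

Definition mono (A : {set ray}) : P := \prod_(i in A) 'X_i.

Section OneFan.
Variables (C : {set {set ray}}) (L : (ray -> R) -> Prop).

Definition plf (f : ray -> R) : P := \sum_(i : ray | [set i] \in C) f i *: 'X_i.

Definition crel (g : P) : Prop :=
  (exists2 A : {set ray}, A \notin C & g = mono A) \/
  (exists2 l, L l & g = plf l).

Definition cideal : P -> Prop := generated crel.

Definition cdim : nat := \max_(A in C) #|A|.

Definition starc (T : {set ray}) : {set {set ray}} :=
  [set B :\: T | B in C & T \subset B].

Definition starl (T : {set ray}) (l : ray -> R) : Prop :=
  L l /\ forall i, i \in T -> l i = 0.

(** The last field is linear independence of the generators of a cone, read dually: prescribed
    values on its rays are attained by a linear form. *)
Record simplicial : Prop := Simplicial {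
  face0 : set0 \in C;
  face_sub : forall A B : {set ray}, A \in C -> B \subset A -> B \in C;
  lin0 : L (fun _ => 0);
  linD : forall l m, L l -> L m -> L (fun i => l i + m i);
  linZ : forall z l, L l -> L (fun i => z * l i);
  lin_interp : forall (T : {set ray}) (u : ray -> R), T \in C ->
    exists2 l, L l & forall i, i \in T -> l i = u i }.

End OneFan.

(** The unknown is a Minkowski weight divided by the multiplicities of cones: this replaces the
    primitive generators of the quotient by the images of the old generators. The vector identity is
    tested against the linear forms of the quotient. *)
Definition balanced (C : {set {set ray}}) (L : (ray -> R) -> Prop) (k : nat) (v : {set ray} -> R) : Prop :=
  forall T : {set ray}, T \in C -> #|T|.+1 = k -> forall l, starl L T l ->
    \sum_(i : ray | (i \notin T) && (i |: T \in C)) v (i |: T) * l i = 0.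

(** Positivity is asked on the rays of the star only: a function linear on a cone and positive on
    its rays is positive away from the origin. *)
Definition convex (C : {set {set ray}}) (L : (ray -> R) -> Prop) (f : ray -> R) : Prop :=
  forall T : {set ray}, T \in C ->
    exists2 m, L m /\ (forall i, i \in T -> m i = f i)
             & forall i, i \notin T -> i |: T \in C -> 0 < f i - m i.

(** The Lefschetz conditions on the fan itself, without those on its stars. The positive weight is
    hidden in [deg]: its value on a top-dimensional cone is the degree of the monomial times the
    multiplicity. Surjectivity of [deg] follows from its positive value on one such cone. *)
Definition kahler (C : {set {set ray}}) (L : (ray -> R) -> Prop) : Prop :=
  let d := cdim C in let I := cideal C L in
  exists deg : {scalar P},
    [/\ forall p, p \is d.-homog -> (deg p = 0 <-> I p),
        forall A, A \in C -> #|A| = d -> 0 < deg (mono A),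
        forall v, balanced C L d v ->
          exists z, forall A, A \in C -> #|A| = d -> v A = z * deg (mono A),
        pd_property I d deg &
        forall f, convex C L f ->
          hl_property I d (plf C f) /\ hr_property I d deg (plf C f)].

End FanData.

(** * Stars, and cone monomials as generators of the Chow ring *)

Section FanTheory.
Variables (R : realType) (n : nat).
Local Notation P := {mpoly R[n]}.
Local Notation ray := 'I_n.
Implicit Types (C : {set {set ray}}) (L : (ray -> R) -> Prop) (A : {set ray}).

Lemma in_starc C T B : (B \in starc C T) = [disjoint B & T] && (B :|: T \in C).
Proof.
apply/imsetP/andP => [[D]|[dis BT]].
  rewrite inE => /andP[DC TD] ->; split.
    by rewrite -setI_eq0; apply/eqP/setP => i; rewrite !inE; case: (i \in T); rewrite ?andbF.
  suff -> : D :\: T :|: T = D by [].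
  apply/setP => i; rewrite !inE; case: (boolP (i \in T)) => [/(subsetP TD)->|] //=.
  by rewrite orbF.
exists (B :|: T); first by rewrite inE BT subsetUr.
apply/setP => i; rewrite !inE; case: (boolP (i \in T)) => [iT|] /=; last by rewrite orbF.
by apply/negbTE; apply: contraL iT => iB; rewrite (disjointFr dis).
Qed.

Lemma starc_starc C T U : U \in starc C T -> starc (starc C T) U = starc C (T :|: U).
Proof.
rewrite in_starc => /andP[disU UT]; apply/setP => B; rewrite !in_starc.
have -> : B :|: U :|: T = B :|: (T :|: U) by rewrite -setUA (setUC U).
rewrite andbA; congr (_ && _).
rewrite -setI_eq0 in disU.
by rewrite -!setI_eq0 setIUl setIUr !setU_eq0 disU andbT andbC.
Qed.

Lemma simplicial_star C L T :
  simplicial C L -> T \in C -> simplicial (starc C T) (starl L T).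
Proof.
move=> sC TC; split.
- by rewrite in_starc disjoints_subset sub0set set0U.
- move=> A B; rewrite !in_starc => /andP[dA AT] BA; rewrite (disjointWl BA dA) /=.
  by apply: (face_sub sC AT); apply: setSU.
- by split=> //; apply: (lin0 sC).
- move=> l m [Ll l0] [Lm m0]; split; first exact: (linD sC).
  by move=> i iT; rewrite l0 // m0 // addr0.
- move=> z l [Ll l0]; split; first exact: (linZ sC).
  by move=> i iT; rewrite l0 // mulr0.
move=> U u; rewrite in_starc => /andP[dU UT].
have [l Ll lu] := lin_interp sC (fun i => if i \in T then 0 else u i) UT.
exists l; first by split=> // i iT; rewrite lu ?iT // inE iT orbT.
by move=> i iU; rewrite lu ?inE ?iU // (disjointFr dU).
Qed.

Lemma starl_starl L T U : starl (starl L T) U = starl L (T :|: U).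
Proof.
apply/predeqP => l; split=> [[[Ll lT] lU]|[Ll lTU]].
  by split=> // i; rewrite inE => /orP[/lT|/lU].
by split=> [|i iU]; [split=> // i iT|]; apply: lTU; rewrite inE ?iT ?iU ?orbT.
Qed.

Lemma starc0 C : starc C set0 = C.
Proof. by apply/setP => B; rewrite in_starc setU0 disjoint_sym disjoints_subset sub0set. Qed.

Lemma starl0 L : starl L set0 = L.
Proof. by apply/predeqP => l; split=> [[]|Ll] //; split=> // i; rewrite inE. Qed.

Lemma linB C L l m : simplicial C L -> L l -> L m -> L (fun i => l i - m i).
Proof.
move=> sC Ll Lm; have := linD sC Ll (linZ sC (-1) Lm).
by under eq_fun do rewrite mulN1r.
Qed.

(** For [U] in the star, the linear form attached to [f] at [T :|: U], minus [m], vanishes on [T]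
    and serves for [f - m] at [U]. *)
Lemma convex_star C L f T : simplicial C L -> T \in C -> convex C L f ->
  forall m, L m -> (forall i, i \in T -> m i = f i) ->
  convex (starc C T) (starl L T) (fun i => f i - m i).
Proof.
move=> sC TC fC m Lm mf U; rewrite in_starc => /andP[dU UT].
have [k [Lk kf] kpos] := fC _ UT; exists (fun i => k i - m i).
  split; [split; first exact: (linB sC)|].
    by move=> i iT; rewrite kf ?inE ?iT ?orbT // mf // subrr.
  by move=> i iU; rewrite kf // inE iU.
move=> i niU; rewrite in_starc => /andP[dis iUT].
rewrite opprB addrA subrK; apply: kpos; last by rewrite setUA.
have niT : i \notin T by rewrite (disjointFr (B := T) dis) ?setU11.
by rewrite inE negb_or niU.
Qed.

Lemma cdim_ge C A : A \in C -> (#|A| <= cdim C)%N.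
Proof. exact: (@leq_bigmax_cond _ (mem C) (fun A : {set ray} => #|A|)). Qed.

Lemma cdim_attained C : set0 \in C -> exists2 A, A \in C & #|A| = cdim C.
Proof.
move=> C0; have: (0 < #|C|)%N by apply/card_gt0P; exists set0.
by move=> /(eq_bigmax_cond (fun A : {set ray} => #|A|))[A AC e]; exists A.
Qed.

Lemma dhomog_mono A : (mono R A : P) \is #|A|.-homog.
Proof.
rewrite /mono -sum1_card; elim/big_rec2: _ => [|i p k _ Hp]; first exact: dhomog1.
exact: (dhomogMe (dhomogXU _ _) Hp).
Qed.

Lemma dhomog_plf C (f : ray -> R) : plf C f \is 1.-homog.
Proof. by apply: dhomog_sum => i _; rewrite dhomogZ // dhomogXU. Qed.

Lemma mono1 (i : ray) : mono R [set i] = 'X_i.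
Proof. by rewrite /mono big_set1. Qed.

Lemma monoU1 (i : ray) A : i \notin A -> mono R (i |: A) = 'X_i * mono R A.
Proof. by move=> iA; rewrite /mono big_setU1. Qed.

Lemma monoU (A B : {set ray}) : [disjoint A & B] -> mono R (A :|: B) = mono R A * mono R B.
Proof.
move=> dAB; rewrite /mono -bigU //=; apply: eq_bigl => i.
by rewrite !inE.
Qed.

Lemma cideal_nonface C L A : A \notin C -> cideal C L (mono R A).
Proof. by move=> AC; apply: generated_rel; left; exists A. Qed.

Lemma cideal_lin C L l : L l -> cideal C L (plf C l).
Proof. by move=> Ll; apply: generated_rel; right; exists l. Qed.

Lemma cideal_X C L i : [set i] \notin C -> cideal C L 'X_i.
Proof. by rewrite -mono1; apply: cideal_nonface. Qed.

Definition msup (m : 'X_{1..n}) : {set ray} := [set i | m i != 0%N].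

Lemma mono_dvd (m : 'X_{1..n}) :
  'X_[R, m] = 'X_[[multinom (m i).-1 | i < n]] * mono R (msup m).
Proof.
rewrite !mpolyXE_id /mono [X in _ * X]big_mkcond -big_split /=.
apply: eq_bigr => i _; rewrite mnmE inE.
by case: (m i) => [|k] /=; rewrite ?expr0 ?mulr1 // -exprSr.
Qed.

(** A repeated variable ['X_i] is traded, by a linear form equal to 1 at [i] and 0 on the rest of
    the support, for variables outside the support. Supports grow, so in the end only squarefree
    monomials remain, and those of non-cones vanish. *)
Lemma face_span C L k p : simplicial C L -> p \is k.-homog ->
  exists g : {set ray} -> R,
    cideal C L (p - \sum_(A in C | #|A| == k) g A *: mono R A).
Proof.
move=> sC; pose Sp (q : P) := exists g : {set ray} -> R,
  cideal C L (q - \sum_(A in C | #|A| == k) g A *: mono R A).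
have SpI q : cideal C L q -> Sp q.
  by exists (fun=> 0); rewrite big1 ?subr0 // => A _; rewrite scale0r.
have SpD c q r : Sp q -> Sp r -> Sp (c *: q + r).
  move=> [g Hg] [h Hh]; exists (fun A => c * g A + h A).
  have -> : c *: q + r - \sum_(A in C | #|A| == k) (c * g A + h A) *: mono R A
    = c *: (q - \sum_(A in C | #|A| == k) g A *: mono R A)
      + (r - \sum_(A in C | #|A| == k) h A *: mono R A).
    rewrite scalerBr scaler_sumr addrACA -opprD -big_split /=; congr (_ - _).
    by apply: eq_bigr => A _; rewrite scalerDl scalerA.
  by apply: generatedD => //; apply: generatedZ.
have Spc q r : cideal C L (q - r) -> Sp r -> Sp q.
  move=> Hqr Hr; rewrite -(subrK r q) -[q - r]scale1r.
  by apply: (SpD) => //; apply: SpI.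
have Sp_sum (I : Type) (r : seq I) (Q : pred I) (F : I -> P) :
    (forall i, Q i -> Sp (F i)) -> Sp (\sum_(i <- r | Q i) F i).
  move=> HF; apply: big_ind => // [|u v Hu Hv]; first exact: SpI (generated0 _).
  by rewrite -[u]scale1r; apply: (SpD).
move: p; apply: dhomog_ind => // [|m mk]; first exact: SpI (generated0 _).
have [j] := ubnP (n - #|msup m|); elim: j => // j IHj in m mk *.
move=> lt_j; have [mC|mC] := boolP (msup m \in C); last first.
  by apply: (SpI); rewrite mono_dvd; apply: generatedM; apply: cideal_nonface.
have [le1|/forallPn[i]] := boolP [forall i, m i <= 1]%N.
  exists (fun A => (A == msup m)%:R).
  have sz : #|msup m| = k.
    rewrite -mk mdegE -sum1_card [RHS](bigID (mem (msup m))) /=.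
    rewrite [X in (_ + X)%N]big1 ?addn0 => [|i]; last by rewrite inE negbK => /eqP.
    apply: eq_bigr => i; rewrite inE; have /forallP/(_ i) := le1.
    by case: (m i) => [|[]].
  rewrite (bigD1 (msup m)) /= ?mC ?sz ?eqxx // scale1r big1 => [|A /andP[_ /negPf->]].
    rewrite addr0 mono_dvd; have -> : [multinom (m i).-1 | i < n] = 0%MM.
      apply/mnmP => i; rewrite mnmE mnm0E; have /forallP/(_ i) := le1.
      by case: (m i) => [|[]].
    by rewrite mpolyX0 mul1r subrr; apply: generated0.
  by rewrite scale0r.
rewrite -ltnNge => m2; set m' := (m - U_(i))%MM.
have im : i \in msup m by rewrite inE -lt0n; apply: leq_trans m2.
have em : m = (U_(i) + m')%MM.
  apply/mnmP => h; rewrite mnmDE mnmBE mnm1E; case: eqP => [<-|] /=; last by rewrite add0n subn0.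
  by rewrite subnKC // ltnW.
have m'sup : msup m' = msup m.
  apply/setP => h; rewrite !inE mnmBE mnm1E; case: (eqVneq i h) => [<-|_] /=; last by rewrite subn0.
  by rewrite -!lt0n subn_gt0 m2 ltnW.
have [l Ll lm] := lin_interp sC (fun h => (h == i)%:R) mC.
have iC : [set i] \in C by apply: (face_sub sC mC); rewrite sub1set.
(* The linear relation of [l], multiplied by ['X_[m']], is solved for the monomial [m]. *)
apply: (Spc _ (- \sum_(h | ([set h] \in C) && (h != i)) l h *: 'X_[U_(h) + m'])).
  rewrite opprK em mpolyXD.
  have -> : 'X_i * 'X_[m'] + \sum_(h | ([set h] \in C) && (h != i)) l h *: 'X_[U_(h) + m']
     = 'X_[m'] * plf C l.
    rewrite [plf C l](bigD1 i iC) /= mulrDr lm // eqxx scale1r mulrC mulr_sumr; congr (_ + _).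
    by apply: eq_bigr => h _; rewrite mpolyXD -scalerAr mulrC.
  by apply: generatedM; apply: cideal_lin.
rewrite -scaleN1r -[_ *: _]addr0; apply: (SpD); last exact: SpI (generated0 _).
apply: Sp_sum => h /andP[hC hi]; rewrite -[_ *: _]addr0.
(* A ray of the support other than [i] has coefficient 0. Any other ray enlarges the support, from
   which [i] does not disappear since [m i] was at least 2. *)
have [hm|hm] := boolP (h \in msup m).
  by rewrite lm // (negPf hi) scale0r addr0; apply: (SpI) (generated0 _).
apply: (SpD); last exact: SpI (generated0 _).
have eh : msup (U_(h) + m') = h |: msup m.
  rewrite -m'sup; apply/setP => x; rewrite !inE mnmDE mnm1E (eq_sym h).
  by case: (eqVneq x h) => [->|_] /=; rewrite ?add0n ?addSn.
apply: IHj.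
  by rewrite mdegD mdeg1 -mk em mdegD mdeg1.
rewrite eh cardsU1 hm; have := max_card (mem (h |: msup m)).
by rewrite cardsU1 hm card_ord; move: lt_j; lia.
Qed.

Lemma cideal_above_dim C L k p : simplicial C L -> (cdim C < k)%N -> p \is k.-homog ->
  cideal C L p.
Proof.
move=> sC lt_k /(face_span sC)[g]; rewrite big1 ?subr0 // => A /andP[/cdim_ge le_A /eqP].
by move: lt_k le_A; lia.
Qed.

End FanTheory.

(** * Hard Lefschetz from the stars of the rays *)

Lemma deg_congr (R : realType) n (rel : {mpoly R[n]} -> Prop) d (deg : {scalar {mpoly R[n]}}) p q :
  (forall p, p \is d.-homog -> deg p = 0 <-> generated rel p) ->
  p \is d.-homog -> q \is d.-homog -> generated rel (p - q) -> deg p = deg q.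
Proof.
move=> degP hp hq; rewrite -(degP _ (dhomogB hp hq)) raddfB => /eqP.
by rewrite subr_eq0 => /eqP.
Qed.

Section RayStar.
Variables (R : realType) (n : nat).
Local Notation P := {mpoly R[n]}.
Local Notation ray := 'I_n.
Variables (C : {set {set ray}}) (L : (ray -> R) -> Prop) (sC : simplicial C L).
Variables (i : ray) (iC : [set i] \in C) (m : ray -> R) (Lm : L m) (mi : m i = 1).
Local Notation I := (cideal C L).
Local Notation Ci := (starc C [set i]).
Local Notation Li := (starl L [set i]).
Local Notation Ii := (cideal Ci Li).

(** [ray_elim] is the restriction from the ring of [C] to that of the star of [i]: the linear
    relation of [m] removes ['X_i]. [ray_kill] picks representatives free of ['X_i] for the map in
    the other direction, multiplication by ['X_i]. *)
Definition ray_elim : P -> P :=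
  psub (fun j => if j == i then - \sum_(h | ([set h] \in C) && (h != i)) m h *: 'X_h
                 else 'X_j).
Definition ray_kill : P -> P := psub (fun j => if j == i then 0 else 'X_j).

HB.instance Definition _ := GRing.RMorphism.on ray_elim.
HB.instance Definition _ := GRing.Linear.on ray_elim.
HB.instance Definition _ := GRing.RMorphism.on ray_kill.
HB.instance Definition _ := GRing.Linear.on ray_kill.

Lemma ray_elimX j : ray_elim 'X_j =
  if j == i then - \sum_(h | ([set h] \in C) && (h != i)) m h *: 'X_h else 'X_j.
Proof. exact: psubX. Qed.

Lemma ray_killX j : ray_kill 'X_j = if j == i then 0 else 'X_j.
Proof. exact: psubX. Qed.

Lemma in_star_ray A : (A \in Ci) = (i \notin A) && (i |: A \in C).
Proof. by rewrite in_starc disjoint_sym disjoints1 setUC. Qed.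

Lemma star_ray_sub h : [set h] \in Ci -> [set h] \in C.
Proof. by rewrite in_star_ray => /andP[_ /(face_sub sC)]; apply; rewrite subsetUr. Qed.

Lemma plf_star f : Ii (plf C f - plf Ci f).
Proof.
rewrite /plf (bigID (fun h => [set h] \in Ci)) /=.
rewrite [X in X + _ - _](eq_bigl (fun h => [set h] \in Ci)) => [|h]; last first.
  by apply/andP/idP => [[]|] // hC; split=> //; apply: star_ray_sub.
rewrite addrAC subrr add0r; apply: generated_sum => h /andP[_ hC].
by apply: generatedZ; apply: cideal_X.
Qed.

Lemma X_plf_star f : f i = 0 -> I ('X_i * (plf C f - plf Ci f)).
Proof.
move=> fi; rewrite /plf (bigID (fun h => [set h] \in Ci)) /=.
rewrite [X in X + _ - _](eq_bigl (fun h => [set h] \in Ci)) => [|h]; last first.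
  by apply/andP/idP => [[]|] // hC; split=> //; apply: star_ray_sub.
rewrite addrAC subrr add0r mulr_sumr; apply: generated_sum => h /andP[_ hC].
have [->|hi] := eqVneq h i; first by rewrite fi scale0r mulr0; apply: generated0.
rewrite -scalerAr; apply: generatedZ; rewrite -[X in _ * X]mono1 -monoU1 ?inE 1?eq_sym //.
by apply: cideal_nonface; apply: contra hC => ihC; rewrite in_star_ray ihC inE eq_sym hi.
Qed.

(** Multiplication by ['X_i] is well defined on the ring of the star: for a set [A] without [i],
    ['X_i] times its monomial is the monomial of [i |: A], a non-cone of [C] as soon as [A] is
    outside the star. *)
Lemma ray_kill_ideal q : Ii q -> I ('X_i * ray_kill q).
Proof.
move: q; apply: generated_ind => [|p q|f g Hg].
- by rewrite raddf0 mulr0; apply: generated0.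
- by rewrite raddfD mulrDr; apply: generatedD.
rewrite rmorphM /= mulrCA; apply: generatedM.
case: Hg => [[A AC ->]|[l [Ll li] ->]].
  rewrite /mono rmorph_prod; have [iA|iA] := boolP (i \in A).
    by rewrite (bigD1 i) //= ray_killX eqxx mul0r mulr0; apply: generated0.
  rewrite (eq_bigr (fun h => 'X_h)) => [|h hA].
    by rewrite -/(mono R A) -monoU1 //; apply: cideal_nonface; apply: contra AC; rewrite in_star_ray iA.
  by rewrite /= ray_killX; case: eqP => // hi; rewrite -hi hA in iA.
have -> : ray_kill (plf Ci l) = plf Ci l.
  rewrite /plf raddf_sum /=; apply: eq_bigr => h hC; rewrite linearZ /= ray_killX.
  by case: eqP hC => // ->; rewrite in_star_ray inE eqxx.
have li0 : l i = 0 by apply: li; rewrite inE.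
apply: generated_subr (generatedM 'X_i (cideal_lin _ Ll)).
by rewrite -mulrBr; apply: X_plf_star.
Qed.

Lemma ray_elim_plf f : ray_elim (plf C f) = plf C (fun h => f h - f i * m h).
Proof.
rewrite /plf raddf_sum /= (bigD1 i) //= [RHS](bigD1 i) //= mi mulr1 subrr scale0r add0r.
rewrite linearZ /= ray_elimX eqxx scalerN scaler_sumr -sumrN -big_split /=.
apply: eq_bigr => h /andP[_ /negPf hi].
by rewrite [ray_elim _]linearZ /= ray_elimX hi scalerA addrC -scalerBl.
Qed.

(** A linear function [l] becomes [l - l i * m], which vanishes at [i] and is therefore linear on
    the star. *)
Lemma ray_elim_ideal q : I q -> Ii (ray_elim q).
Proof.
apply: generated_map => g [[A AC ->]|[l Ll ->]]; last first.
  rewrite /= ray_elim_plf; apply: generated_subl; first exact: plf_star.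
  apply: cideal_lin; split; first exact: (linB sC Ll (linZ sC _ Lm)).
  by move=> h; rewrite inE => /eqP->; rewrite mi mulr1 subrr.
have elimA (B : {set ray}) : i \notin B -> ray_elim (mono R B) = mono R B.
  move=> iB; rewrite /mono rmorph_prod; apply: eq_bigr => h hB.
  by rewrite /= ray_elimX; case: eqP => // hi; rewrite -hi hB in iB.
have [iA|iA] := boolP (i \in A).
  rewrite -(setD1K iA) monoU1 ?inE ?eqxx // rmorphM /=; apply: generatedM.
  rewrite elimA ?inE ?eqxx //; apply: cideal_nonface.
  by rewrite in_star_ray setD1K // (negPf AC) andbF.
rewrite /= elimA //; apply: cideal_nonface; apply: contra AC.
by rewrite in_star_ray => /andP[_ /(face_sub sC)]; apply; rewrite subsetUr.
Qed.

Lemma ray_elim_congr q : I (q - ray_elim q).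
Proof.
elim/mpoly_ring_ind: q => [c|h|p q Hp Hq|p q Hp Hq].
- by rewrite /ray_elim psubC subrr; apply: generated0.
- rewrite ray_elimX; case: eqP => [->|_]; last by rewrite subrr; apply: generated0.
  by rewrite opprK; have := cideal_lin C Lm; rewrite /plf (bigD1 i) //= mi scale1r.
- by rewrite raddfD opprD addrACA; apply: generatedD.
- by rewrite rmorphM; apply: generated_congrM.
Qed.

Lemma ray_kill_elim q : ray_kill (ray_elim q) = ray_elim q.
Proof.
elim/mpoly_ring_ind: q => [c|h|p q Hp Hq|p q Hp Hq].
- by rewrite /ray_elim /ray_kill !psubC.
- rewrite ray_elimX; case: (eqVneq h i) => [_|/negPf hi]; last by rewrite ray_killX hi.
  rewrite [ray_kill _]raddfN /= [ray_kill _]raddf_sum; congr (- _); apply: eq_bigr => j /andP[_ /negPf ji].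
  by rewrite /= [ray_kill _]linearZ /= ray_killX ji.
- by rewrite !raddfD /= Hp Hq.
- by rewrite !rmorphM /= Hp Hq.
Qed.

Lemma dhomog_ray_elim d q : q \is d.-homog -> ray_elim q \is d.-homog.
Proof.
apply: dhomog_psub => j; case: eqP => _; last exact: dhomogXU.
by rewrite dhomogN; apply: dhomog_sum => h _; rewrite dhomogZ // dhomogXU.
Qed.

(** Modulo the ideal of [C], [q] may be replaced by [ray_elim q], which is free of ['X_i], so
    [ray_kill_ideal] applies. *)
Lemma ray_elim_X q : Ii (ray_elim q) -> I ('X_i * q).
Proof.
move=> /ray_kill_ideal; rewrite ray_kill_elim => Hq.
by apply: generated_subl Hq; rewrite -mulrBr; apply: generatedM; apply: ray_elim_congr.
Qed.

Lemma cdim_star : (cdim Ci < cdim C)%N.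
Proof.
have [A AC <-] := cdim_attained (face0 (simplicial_star sC iC)).
move: AC; rewrite in_star_ray => /andP[iA /cdim_ge]; by rewrite cardsU1 iA.
Qed.

Variable deg : {scalar P}.
Hypothesis degP : forall p, p \is (cdim C).-homog -> deg p = 0 <-> I p.
Hypothesis deg_pos : forall A, A \in C -> #|A| = cdim C -> 0 < deg (mono R A).

(** Both sides are linear in the class of the restriction of [q], which lives in a one-dimensional
    space, so they are proportional. The factor is read off, and seen to be positive, at one
    top-dimensional cone [A] of the star. *)
Lemma deg_ray_star (degi : {scalar P}) :
  (forall p, p \is (cdim Ci).-homog -> degi p = 0 <-> Ii p) ->
  (forall A, A \in Ci -> #|A| = cdim Ci -> 0 < degi (mono R A)) ->
  (cdim Ci).+1 = cdim C ->
  exists2 z, 0 < z & forall q : P, q \is (cdim Ci).-homog ->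
    deg ('X_i * q) = z * degi (ray_elim q).
Proof.
move=> degiP degi_pos ei.
have [A AC eA] := cdim_attained (face0 (simplicial_star sC iC)).
have := AC; rewrite in_star_ray => /andP[iA iAC].
have hX (q : P) : q \is (cdim Ci).-homog -> 'X_i * q \is (cdim C).-homog.
  by move=> hq; apply: (dhomogMe (dhomogXU _ _) hq); rewrite add1n.
have degA := degi_pos _ AC eA.
have hA : (mono R A : P) \is (cdim Ci).-homog by rewrite -eA dhomog_mono.
exists (deg ('X_i * mono R A) / degi (mono R A)).
  by rewrite divr_gt0 // -monoU1 // deg_pos // cardsU1 iA add1n eA.
move=> q hq; set r := ray_elim q.
have hr : r \is (cdim Ci).-homog by apply: dhomog_ray_elim.
have -> : deg ('X_i * q) = deg ('X_i * r).
  apply: (deg_congr degP); try exact: hX.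
  by rewrite -mulrBr; apply: generatedM; apply: ray_elim_congr.
set c := degi r / degi (mono R A).
have hs : r - c *: mono R A \is (cdim Ci).-homog by rewrite dhomogB // dhomogZ.
have /(degiP _ hs)/ray_kill_ideal : degi (r - c *: mono R A) = 0.
  by rewrite raddfB /= linearZ /= /c mulfVK ?subrr // gt_eqF.
rewrite raddfB /= linearZ /= ray_kill_elim.
have -> : ray_kill (mono R A) = mono R A.
  rewrite /mono rmorph_prod; apply: eq_bigr => h hA'.
  by rewrite /= ray_killX; case: eqP => // hi; rewrite -hi hA' in iA.
rewrite mulrBr -scalerAr => Hc.
rewrite (deg_congr degP _ _ Hc) ?dhomogZ ?hX // linearZ /= /c.
by field; rewrite gt_eqF.
Qed.

Hypothesis kCi : kahler Ci Li.

(** If the star has dimension one less than [C], the assumption on [p] makes its restriction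
    primitive there. Hodge-Riemann on the star gives the sign, and a vanishing value forces the
    restriction of [p], hence ['X_i * p], to be zero. *)
Lemma ray_star_hr f k p : convex C L f -> (k.*2 < cdim C)%N -> p \is k.-homog ->
  I (plf C f ^+ (cdim C - k.*2) * p) ->
  0 <= (-1) ^+ k * deg ('X_i * (plf C f ^+ (cdim C - k.*2).-1 * p * p)) /\
  (deg ('X_i * (plf C f ^+ (cdim C - k.*2).-1 * p * p)) = 0 ->
   forall q : P, q \is (cdim C - k).-1.-homog -> deg ('X_i * p * q) = 0).
Proof.
move=> fC lt_k hp Hp; have lt_d := cdim_star.
have hpp : plf C f ^+ (cdim C - k.*2).-1 * p * p \is (cdim C).-1.-homog.
  apply: (dhomogMe (dhomogM (dhomogXe (dhomog_plf _ _) erefl) hp) hp).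
  by move: lt_k; rewrite -addnn; lia.
have hpq (q : P) : q \is (cdim C - k).-1.-homog -> p * q \is (cdim C).-1.-homog.
  by move=> hq; apply: (dhomogMe hp hq); move: lt_k; rewrite -addnn; lia.
have hX (q : P) : q \is (cdim C).-1.-homog -> 'X_i * q \is (cdim C).-homog.
  by move=> hq; apply: (dhomogMe (dhomogXU _ _) hq); rewrite add1n; lia.
(* If the star has still smaller dimension, ['X_i] annihilates everything of degree
   [(cdim C).-1]. *)
have [lt_d1|ge_d1] := ltnP (cdim Ci) (cdim C).-1.
  have deg0 (q : P) : q \is (cdim C).-1.-homog -> deg ('X_i * q) = 0.
    move=> hq; apply/degP; first exact: hX.
    apply/ray_elim_X/(cideal_above_dim (simplicial_star sC iC) lt_d1).
    exact: dhomog_ray_elim.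
  by rewrite deg0 // mulr0; split=> // _ q hq; rewrite -mulrA deg0 // hpq.
have ed : (cdim Ci).+1 = cdim C by lia.
have [degi [degiP degi_pos _ _ /(_ (fun h => f h - f i * m h))[|_ hr]]] := kCi.
  apply: (convex_star sC iC fC (linZ sC _ Lm)) => h.
  by rewrite inE => /eqP->; rewrite mi mulr1.
have [z z0 zP] := deg_ray_star degiP degi_pos ed.
have eC : (cdim C).-1 = cdim Ci by lia.
have [Ip|nIp] := pselect (Ii (ray_elim p)).
  have Xp (q : P) : q \is (cdim C - k).-1.-homog -> deg ('X_i * p * q) = 0.
    move=> hq; apply/degP; first by rewrite -mulrA hX // hpq.
    by apply: generatedMr; apply: ray_elim_X.
  split=> // ; rewrite mulrA mulrAC Xp ?mulr0 //.
  apply: (dhomogMe (dhomogXe (dhomog_plf _ _) erefl) hp).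
  by move: lt_k; rewrite -addnn; lia.
rewrite zP -?eC // !rmorphM rmorphXn /= ray_elim_plf.
set f' := fun h => _; set p' := ray_elim p; set N := (cdim C - k.*2).-1.
have eN : N = (cdim Ci - k.*2)%N by rewrite /N; lia.
have hp' : p' \is k.-homog by apply: dhomog_ray_elim.
have -> : degi (plf C f' ^+ N * p' * p') = degi (plf Ci f' ^+ N * p' * p').
  have hN g D : plf D g ^+ N * p' * p' \is (cdim Ci).-homog.
    apply: (dhomogMe (dhomogM (dhomogXe (dhomog_plf _ _) erefl) hp') hp').
    by rewrite eN; move: lt_k; rewrite -addnn; lia.
  apply: (deg_congr degiP) => //; rewrite -!mulrBl.
  by do 2!apply: generatedMr; apply: generated_congrX; apply: plf_star.
have pos : 0 < (-1) ^+ k * degi (plf Ci f' ^+ N * p' * p').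
  rewrite eN; apply: hr => //; first by lia.
  have /ray_elim_ideal := Hp; rewrite rmorphM rmorphXn /= ray_elim_plf.
  have -> : (cdim C - k.*2 = (cdim Ci - k.*2).+1)%N by lia.
  apply: generated_subr; rewrite -mulrBl; apply: generatedMr.
  by apply: generated_congrX; apply: plf_star.
split; first by rewrite mulrCA mulr_ge0 // ltW.
move=> /eqP; rewrite mulf_eq0 gt_eqF //= => /eqP e0.
by move: pos; rewrite e0 mulr0 ltxx.
Qed.

End RayStar.

(** * Injectivity of the Lefschetz maps *)

Section HardLefschetz.
Variables (R : realType) (n : nat).
Local Notation P := {mpoly R[n]}.
Local Notation ray := 'I_n.
Variables (C : {set {set ray}}) (L : (ray -> R) -> Prop) (sC : simplicial C L).
Local Notation I := (cideal C L).
Local Notation d := (cdim C).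
Variable deg : {scalar P}.
Hypothesis degP : forall p, p \is d.-homog -> deg p = 0 <-> I p.
Hypothesis deg_pos : forall A, A \in C -> #|A| = d -> 0 < deg (mono R A).
Hypothesis pdC : pd_property I d deg.
Hypothesis kC : forall i, [set i] \in C -> kahler (starc C [set i]) (starl L [set i]).

(* Writing the class as a positive combination of rays turns
   [deg (l ^+ (d - 2k) p^2) = 0] into a sum of terms of constant sign. *)
Lemma hl_injective f k (p : P) : convex C L f -> (k.*2 <= d)%N -> p \is k.-homog ->
  I (plf C f ^+ (d - k.*2) * p) -> I p.
Proof.
move=> fC; rewrite leq_eqVlt => /predU1P[->|lt_k] hp Hp.
  by move: Hp; rewrite subnn mul1r.
(* Convexity at the cone [set0]: subtracting a linear form makes [f] positive on every ray. *)
have [m [Lm _] mpos] := fC _ (face0 sC).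
have eX i : exists m, [set i] \in C -> L m /\ m i = 1.
  have [iC|] := boolP ([set i] \in C); last by exists (fun=> 0).
  by have [l Ll li] := lin_interp sC (fun=> 1) iC; exists l; rewrite li ?inE.
pose T i := deg ('X_i * (plf C f ^+ (d - k.*2).-1 * p * p)).
have rayP i : [set i] \in C -> 0 <= (-1) ^+ k * T i /\
  (T i = 0 -> forall q : P, q \is (d - k).-1.-homog -> deg ('X_i * p * q) = 0).
  move=> iC; have [mi /(_ iC)[Lmi mi1]] := eX i.
  exact: (ray_star_hr sC iC Lmi mi1 degP deg_pos (kC iC) fC lt_k hp Hp).
pose c i := f i - m i.
have hpp : plf C f ^+ (d - k.*2).-1 * p * p \is d.-1.-homog.
  apply: (dhomogMe (dhomogM (dhomogXe (dhomog_plf _ _) erefl) hp) hp).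
  by move: lt_k; rewrite -addnn; lia.
have sum0 : \sum_(i | [set i] \in C) c i * ((-1) ^+ k * T i) = 0.
  transitivity ((-1) ^+ k * deg (plf C c * (plf C f ^+ (d - k.*2).-1 * p * p))).
    rewrite mulr_suml raddf_sum mulr_sumr /=; apply: eq_bigr => i _.
    by rewrite -scalerAl linearZ /= mulrCA.
  have hd g : plf C g * (plf C f ^+ (d - k.*2).-1 * p * p) \is d.-homog.
    by apply: (dhomogMe (dhomog_plf _ _) hpp); move: lt_k; rewrite add1n; lia.
  rewrite [X in _ * X](deg_congr degP _ (hd f)) //; last first.
    rewrite -mulrBl; apply: generatedMr.
    have -> : plf C c - plf C f = - plf C m.
      rewrite /plf -!sumrN -big_split /=; apply: eq_bigr => i _.
      by rewrite -!scaleNr -scalerDl /c; congr (_ *: _); ring.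
    by apply: generatedN; apply: cideal_lin.
  rewrite [X in _ * X](_ : _ = 0) ?mulr0 //; apply/degP; first exact: hd.
  have -> : plf C f * (plf C f ^+ (d - k.*2).-1 * p * p) = p * (plf C f ^+ (d - k.*2) * p).
    rewrite -{2}(prednK (_ : 0 < d - k.*2)%N) ?subn_gt0 // exprS.
    by move: (plf C f) (plf C f ^+ _) => a b; ring.
  exact: generatedM.
have T0 i : [set i] \in C -> T i = 0.
  have cpos j : [set j] \in C -> 0 < c j by move=> jC; apply: mpos; rewrite ?inE // setU0.
  move=> iC; have/psumr_eq0P := sum0.
  move=> /(_ (fun j jC => mulr_ge0 (ltW (cpos j jC)) (proj1 (rayP j jC))))/(_ i iC)/eqP.
  by rewrite mulf_eq0 gt_eqF ?cpos //= mulf_eq0 signr_eq0 => /eqP.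
(* The degree [d - k] is positive, so a test polynomial is a combination of multiples of variables.
   Those of rays are covered by [rayP], the others lie in the ideal. *)
apply: (pdC _ hp) => [|q]; first by move: lt_k; rewrite -addnn; lia.
have -> : (d - k = (d - k).-1.+1)%N by move: lt_k; rewrite -addnn; lia.
set e := (d - k).-1 => hq; move: q hq; apply: dhomog_ind => [|z q r Hq Hr|mm emm].
- by rewrite mulr0 raddf0.
- by rewrite mulrDr raddfD /= -scalerAr linearZ /= Hq Hr mulr0 addr0.
have [i [m' [-> hm]]] := mdegS_split emm.
rewrite mpolyXD mulrA [p * _]mulrC.
have [iC|iC] := boolP ([set i] \in C).
  by apply: (proj2 (rayP i iC)); rewrite ?T0 // dhomogX /= hm.
apply/degP; last by do 2!apply: generatedMr; apply: cideal_X.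
apply: (dhomogMe (dhomogM (dhomogXU _ _) hp)); first by rewrite dhomogX.
by rewrite /= hm /e; move: lt_k; rewrite -addnn; lia.
Qed.

End HardLefschetz.

(** * Positive definite forms along a path *)

Section PositiveDefinite.
Variable R : realType.

Definition qform N (M : 'M[R]_N) (v : 'rV[R]_N) : R := (v *m M *m v^T) 0 0.
Definition posdef N (M : 'M[R]_N) : Prop := forall v, v != 0 -> 0 < qform M v.
Definition evalmx s a b (M : 'M[{poly R}]_(a, b)) : 'M[R]_(a, b) :=
  map_mx (horner_eval s) M.

Lemma evalmxE s a b (M : 'M[{poly R}]_(a, b)) i j : evalmx s M i j = (M i j).[s].
Proof. by rewrite mxE. Qed.

Lemma poly_pos_near (p : {poly R}) s : 0 < p.[s] ->
  exists2 e, 0 < e & forall u, `|u - s| < e -> 0 < p.[u].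
Proof.
move=> ps; have [e e0 He] := poly_cont s p ps; exists e => // u /He.
by rewrite ltr_norml => /andP[]; lra.
Qed.

Lemma normsq_ge0 N (v : 'rV[R]_N) : 0 <= (v *m v^T) 0 0.
Proof. by rewrite mxE; apply: sumr_ge0 => i _; rewrite mxE -expr2 sqr_ge0. Qed.

Lemma normsq_gt0 N (v : 'rV[R]_N) : v != 0 -> 0 < (v *m v^T) 0 0.
Proof.
move=> v0; rewrite lt_neqAle normsq_ge0 andbT; apply: contraNneq v0 => /esym/eqP.
rewrite mxE psumr_eq0 => [/allP H|i _]; last by rewrite mxE -expr2 sqr_ge0.
apply/eqP/rowP => i; rewrite mxE; apply/eqP.
by have := H i (mem_index_enum _); rewrite mxE mulf_eq0 orbb.
Qed.

(* Completing the square with respect to the first coordinate. *)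
Lemma qform_block N (a : 'M[R]_1) (b : 'rV[R]_N) (D : 'M[R]_N)
    (x : 'M[R]_1) (y : 'rV[R]_N) :
  a 0 0 * qform (block_mx a b b^T D) (row_mx x y) =
  (a 0 0 * x 0 0 + (b *m y^T) 0 0) ^+ 2 + qform (a 0 0 *: D - b^T *m b) y.
Proof.
rewrite /qform mul_row_block tr_row_mx mul_row_col !mulmxDl mulmxBr mulmxBl -scalemxAr -scalemxAl.
rewrite -[y *m (b^T *m b) *m _]mulmxA -(mulmxA b^T) mulmxA.
have -> : y *m b^T = (b *m y^T)^T by rewrite trmx_mul trmxK.
set t := b *m y^T; set S := y *m D *m y^T.
have -> : x *m b *m y^T = x *m t by rewrite mulmxA.
have e1 (A B : 'M[R]_1) : (A *m B) 0 0 = A 0 0 * B 0 0 by rewrite mxE big_ord1.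
have e2 (A : 'M[R]_1) : A^T = A by apply/matrixP => i j; rewrite mxE !ord1.
by rewrite !e2 !mxE !big_ord1 !mxE !big_ord1; ring.
Qed.

(** Induction on the size: a form is definite iff its corner entry [a] and its Schur complement are
    positive definite. The complement is multiplied by [a], so that its entries remain
    polynomials. *)
Lemma posdef_near N (M : 'M[{poly R}]_N) s : M^T = M -> posdef (evalmx s M) ->
  exists2 e, 0 < e & forall u, `|u - s| < e -> posdef (evalmx u M).
Proof.
elim: N => [|N IHN] in M *; first by exists 1 => // u _ v; rewrite thinmx0 eqxx.
rewrite -[N.+1]/(1 + N)%N in M * => symM.
rewrite -(submxK M); set a := ulsubmx M; set b := ursubmx M; set D := drsubmx M.
have -> : dlsubmx M = b^T by rewrite /b trmx_ursub symM.
have ev u : evalmx u (block_mx a b b^T D) =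
    block_mx (evalmx u a) (evalmx u b) (evalmx u b)^T (evalmx u D).
  by rewrite /evalmx map_block_mx map_trmx.
pose S := a 0 0 *: D - b^T *m b.
have evS u : evalmx u S = (evalmx u a) 0 0 *: evalmx u D - (evalmx u b)^T *m evalmx u b.
  by rewrite /evalmx map_mxB map_mxZ map_mxM map_trmx -/(evalmx u a) evalmxE.
rewrite ev => pos; have a0 : 0 < (evalmx s a) 0 0.
  have := pos (row_mx 1 0) _; rewrite /qform mul_row_block tr_row_mx mul_row_col.
  rewrite !mul0mx !mul1mx trmx0 mulmx0 !addr0 trmx1 mulmx1; apply.
  apply/eqP => /(congr1 (fun v : 'rV_(1 + N) => v 0 (lshift N 0))).
  by rewrite row_mxEl !mxE; apply/eqP/oner_neq0.
have symD : D^T = D by rewrite /D trmx_drsub symM.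
have [||e e0 He] := IHN S.
- by rewrite /S raddfB /= linearZ /= symD trmx_mul trmxK.
- move=> y y0; rewrite evS.
  (* The first coordinate is chosen to annihilate the square in [qform_block]. *)
  have := pos (row_mx (- ((evalmx s a) 0 0)^-1 *: (evalmx s b *m y^T)) y).
  have -> : row_mx (- ((evalmx s a) 0 0)^-1 *: (evalmx s b *m y^T)) y != 0.
    by apply: contra y0 => /eqP/(congr1 rsubmx); rewrite row_mxKr raddf0 => ->.
  move=> /(_ isT); rewrite -(pmulr_rgt0 _ a0) qform_block.
  have -> : forall c (A : 'M[R]_1), (c *: A) 0 0 = c * A 0 0 by move=> c A; rewrite mxE.
  by rewrite mulrA mulrN mulfV ?gt_eqF // mulN1r addNr expr0n add0r.
have [e' e'0 He'] : exists2 e, 0 < e & forall u, `|u - s| < e -> 0 < (evalmx u a) 0 0.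
  have [|e1 ? He1] := @poly_pos_near (a 0 0) s; first by rewrite evalmxE in a0.
  by exists e1 => // u /He1; rewrite evalmxE.
exists (Num.min e e'); first by rewrite lt_min e0.
move=> u; rewrite lt_min => /andP[/He uS /He' ua] v v0.
rewrite ev -(pmulr_rgt0 _ ua) -[v]hsubmxK qform_block -evS.
have [y0|y0] := eqVneq (rsubmx v) 0; last first.
  by apply: ltr_wpDl; [exact: sqr_ge0|exact: uS].
have z00 : (0 : 'M[R]_1) 0 0 = 0 by rewrite mxE.
rewrite y0 /qform trmx0 !mulmx0 z00 !addr0.
rewrite exprn_even_gt0 //=; apply: mulf_neq0; first by rewrite gt_eqF.
apply: contra v0 => /eqP x0.
rewrite -[v]hsubmxK y0 (_ : lsubmx v = 0) ?row_mx0 //.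
by apply/matrixP => i j; rewrite !ord1 x0 mxE.
Qed.

Lemma quad_ge0_eq0 (q c : R) :
  0 <= q -> (forall t, 0 <= t * (c *+ 2 + t * q)) -> c = 0.
Proof.
(* The minimum is at [- c / q]; the denominator [q + 1] stays positive when [q] is 0 and still gives
   a negative value unless [c] is 0. *)
move=> q0 Hb; have := Hb (- c / (q + 1)).
have -> : - c / (q + 1) * (c *+ 2 + - c / (q + 1) * q) = - (c ^+ 2 * ((q + 2) / (q + 1) ^+ 2)).
  by field; lra.
have pos : 0 < (q + 2) / (q + 1) ^+ 2 by rewrite divr_gt0 // ?exprn_gt0 //; lra.
rewrite oppr_ge0 pmulr_lle0 // => le0.
by apply/eqP; rewrite -sqrf_eq0 eq_le sqr_ge0 andbT.
Qed.

(** At a zero [v] of a semidefinite form, nonnegativity along every line [v + t y] makes [v *m M]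
    orthogonal to every [y], hence zero. *)
Lemma possemidef_unit N (M : 'M[R]_N) : M^T = M -> M \in unitmx ->
  (forall v, 0 <= qform M v) -> posdef M.
Proof.
move=> symM uM psd v v0; rewrite lt_neqAle psd andbT; apply: contraNneq v0 => /esym qv0.
have bil y t : 0 <= t * ((v *m M *m y^T) 0 0 *+ 2 + t * qform M y).
  have := psd (v + t *: y); rewrite /qform linearD linearZ /= !mulmxDl !mulmxDr.
  rewrite -!scalemxAr -!scalemxAl.
  have -> : y *m M *m v^T = v *m M *m y^T.
    transitivity ((y *m M *m v^T)^T); last by rewrite !trmx_mul trmxK symM mulmxA.
    by apply/matrixP => i j; rewrite [RHS]mxE !ord1.
  have addE (A B : 'M[R]_1) : (A + B) 0 0 = A 0 0 + B 0 0 by rewrite mxE.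
  have scE c (A : 'M[R]_1) : (c *: A) 0 0 = c * A 0 0 by rewrite mxE.
  rewrite !(addE, scE) -/(qform M v) -/(qform M y) qv0.
  by move: (_ 0 0) (qform M y) => c q; rewrite add0r mulrDr mulr2n mulrDr !addrA.
have vM (y : 'rV_N) : (v *m M *m y^T) 0 0 = 0.
  exact: quad_ge0_eq0 (psd y) (bil y).
have v0' : v *m M = 0.
  by apply/eqP; apply: contraT => /normsq_gt0; rewrite vM ltxx.
by rewrite -[v](mulmxK uM) v0' mul0mx.
Qed.

(** Let [s] be the supremum of the times up to which the form stays definite. At [s] it is
    semidefinite by continuity, hence definite by invertibility; definiteness is an open condition,
    so [s] is 1. *)
Lemma posdef_path N (M : 'M[{poly R}]_N) : M^T = M ->
  (forall s, 0 <= s <= 1 -> evalmx s M \in unitmx) ->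
  posdef (evalmx 0 M) -> posdef (evalmx 1 M).
Proof.
move=> symM uM pos0.
have symE u : (evalmx u M)^T = evalmx u M by rewrite /evalmx map_trmx symM.
pose E : classical_sets.set R := fun u => 0 <= u <= 1 /\ forall w, 0 <= w <= u -> posdef (evalmx w M).
have E0 : E 0 by split; [rewrite lexx ler01|move=> w /le_anti <-].
have supE : classical_sets.has_sup E by split; [exists 0|exists 1 => u [/andP[]]].
set s := sup E.
have s01 : 0 <= s <= 1.
  apply/andP; split; first by have := ub_le_sup supE.2 E0.
  by apply: ge_sup; [exists 0|move=> u [/andP[]]].
have lt_s w : 0 <= w < s -> posdef (evalmx w M).
  move=> /andP[w0 ws]; have sw : 0 < s - w by lra.
  have [u [u01 Hu] lt_u] := sup_adherent sw supE.
  by apply: Hu; rewrite w0 /=; move: lt_u; rewrite -/s; lra.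
have possM : posdef (evalmx s M).
  have [->//|s0] := eqVneq s 0.
  apply: possemidef_unit (uM _ s01) _ => // v; rewrite leNgt; apply/negP => neg.
  pose g : {poly R} := - (map_mx polyC v *m M *m map_mx polyC v^T) 0 0.
  have gE u : g.[u] = - qform (evalmx u M) v.
    rewrite /g hornerN /qform /evalmx; congr (- _).
    rewrite -[LHS]evalmxE /evalmx !map_mxM -!map_mx_comp; congr ((_ *m _ *m _) 0 0);
      by apply/matrixP => i j; rewrite !mxE /= /horner_eval hornerC.
  have [|e e0 He] := @poly_pos_near g s; first by rewrite gE oppr_gt0.
  have sp : 0 < s by rewrite lt_neqAle eq_sym s0; case/andP: s01.
  (* A time in [[0, s)] within [e] of [s], where the form would still be negative at [v]. *)
  pose w := s - Num.min (e / 2) s.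
  have mn : 0 < Num.min (e / 2) s by rewrite lt_min sp andbT; lra.
  have mn1 : Num.min (e / 2) s <= e / 2 by rewrite ge_min lexx.
  have mn2 : Num.min (e / 2) s <= s by rewrite ge_min lexx orbT.
  have : 0 < g.[w].
    by apply: He; rewrite /w addrAC subrr sub0r normrN gtr0_norm //; lra.
  rewrite gE oppr_gt0; have [->|v0] := eqVneq v 0.
    by rewrite /qform !mul0mx mxE ltxx.
  have : 0 < qform (evalmx w M) v by apply: lt_s => //; rewrite /w; lra.
  by lra.
have [e e0 He] := posdef_near symM possM.
have [e1|s1] := eqVneq s 1; first by rewrite -e1.
have {}s1 : s < 1 by rewrite lt_neqAle s1; case/andP: s01.
pose u := s + Num.min (e / 2) (1 - s).
have mn : 0 < Num.min (e / 2) (1 - s) by rewrite lt_min; apply/andP; split; lra.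
have mn1 : Num.min (e / 2) (1 - s) <= e / 2 by rewrite ge_min lexx.
have mn2 : Num.min (e / 2) (1 - s) <= 1 - s by rewrite ge_min lexx orbT.
suff Eu : E u.
  by have := ub_le_sup supE.2 Eu; rewrite -/s /u; lra.
split=> [|w /andP[w0 wu]]; first by rewrite /u; case/andP: s01 => *; lra.
have [ws|ws] := ltP w s; first by apply: lt_s; rewrite w0.
by apply: He; rewrite ger0_norm; move: wu; rewrite /u; lra.
Qed.

(* If [E] spans a complement of the kernel of [W = Q E^T] then [Q] is positive
   definite on this kernel iff [Q - W K^-1 W^T + W W^T] is positive definite,
   where [K = E Q E^T]; so no basis of the varying kernel has to be chosen. *)
Lemma posdef_kernel_path N r (Q : 'M[{poly R}]_N) (W : 'M[{poly R}]_(N, r))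
    (K : 'M[{poly R}]_r) :
  Q^T = Q -> K^T = K ->
  (forall s, 0 <= s <= 1 -> [/\ evalmx s Q \in unitmx, evalmx s K \in unitmx &
     exists2 E : 'M[R]_(r, N), evalmx s W = evalmx s Q *m E^T
                             & evalmx s K = E *m evalmx s W]) ->
  (forall v, v != 0 -> v *m evalmx 0 W = 0 -> 0 < qform (evalmx 0 Q) v) ->
  (forall v, v != 0 -> v *m evalmx 1 W = 0 -> 0 < qform (evalmx 1 Q) v).
Proof.
move=> symQ symK H pos0.
(* Denominators are cleared by [D ^+ 2], with [\adj K] in place of the inverse: [M] is polynomial in
   [s] and its value is [D ^+ 2] times the corrected form [F s]. *)
pose D := \det K.
pose M := D ^+ 2 *: Q - D *: (W *m \adj K *m W^T) + D ^+ 2 *: (W *m W^T).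
have symM : M^T = M.
  rewrite /M !(raddfD, raddfB) /= raddfN /= !linearZ /= symQ !trmx_mul !trmxK mulmxA.
  by rewrite trmx_adj symK.
have EQ s E : evalmx s W = evalmx s Q *m E^T -> (evalmx s W)^T = E *m evalmx s Q.
  by move=> ->; rewrite trmx_mul trmxK /evalmx map_trmx symQ.
pose F s := evalmx s Q - evalmx s W *m invmx (evalmx s K) *m (evalmx s W)^T
            + evalmx s W *m (evalmx s W)^T.
have eD s : D.[s] = \det (evalmx s K) by rewrite /D /evalmx det_map_mx.
have ME s : evalmx s K \in unitmx -> evalmx s M = D.[s] ^+ 2 *: F s.
  move=> uK.
  rewrite /M /evalmx map_mxD map_mxB !map_mxZ !map_mxM map_mx_adj -map_trmx -/(evalmx _ _).
  rewrite /F scalerDr scalerBr -!/(evalmx _ _) rmorphXn /= -[horner_eval s D]/(D.[s]).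
  congr (_ - _ + _); rewrite /invmx uK -scalemxAr -scalemxAl scalerA eD.
  by congr (_ *: _); rewrite expr2 mulfK // -unitfE -unitmxE.
have D0 s : evalmx s K \in unitmx -> 0 < D.[s] ^+ 2.
  by rewrite unitmxE unitfE -eD => D0; rewrite exprn_even_gt0.
have qME s v : evalmx s K \in unitmx -> qform (evalmx s M) v = D.[s] ^+ 2 * qform (F s) v.
  by move=> uK; rewrite /qform ME // -scalemxAr -scalemxAl mxE.
have uM s : 0 <= s <= 1 -> evalmx s M \in unitmx.
  move=> s01; have [uQ uK [E eW eK]] := H s s01.
  rewrite ME // -row_free_unit -kermx_eq0; apply/rowV0P => v /sub_kermxP.
  rewrite -scalemxAr => /eqP; rewrite scaler_eq0 gt_eqF ?D0 //= => /eqP vF.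
  have eKT : (evalmx s W)^T *m E^T = evalmx s K.
    by rewrite -trmx_mul -eK /evalmx map_trmx symK.
  (* After multiplication of [v *m F s = 0] by [E^T] the first two terms cancel, because [Q E^T = W]
     and [W^T E^T = K]; what is left is [v W K = 0]. *)
  have vW : v *m evalmx s W = 0.
    have := congr1 (fun A => A *m E^T) vF.
    rewrite mul0mx /F mulmxDr mulmxBr mulmxDl mulmxBl -[v *m evalmx s Q *m _]mulmxA -eW.
    rewrite -!mulmxA eKT (mulVmx uK) mulmx1 subrr add0r !mulmxA => vWK.
    by rewrite -[v *m _](mulmxK uK) vWK mul0mx.
  move: vF; rewrite /F mulmxDr mulmxBr !mulmxA vW !mul0mx subr0 addr0 => vQ.
  by rewrite -[v](mulmxK uQ) vQ mul0mx.
have pos1 : posdef (evalmx 1 M).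
  apply: posdef_path symM uM _ => v v0.
  have [|uQ uK [E eW eK]] := H 0; first by rewrite lexx ler01.
  rewrite qME //; apply: mulr_gt0; first exact: D0.
  (* [w] is the projection of [v] to the kernel of [W] along the row space of [E], and the two parts
     are orthogonal for [Q]. *)
  pose u := v *m evalmx 0 W *m invmx (evalmx 0 K); pose w := v - u *m E.
  have uK' : u *m evalmx 0 K = v *m evalmx 0 W by rewrite /u mulmxKV.
  have wW : w *m evalmx 0 W = 0 by rewrite mulmxBl -mulmxA -eK uK' subrr.
  have vE : v = w + u *m E by rewrite subrK.
  have WE := EQ _ _ eW.
  have -> : qform (F 0) v = qform (evalmx 0 Q) w + ((v *m evalmx 0 W) *m (v *m evalmx 0 W)^T) 0 0.
    have addE (A B : 'M[R]_1) : (A + B) 0 0 = A 0 0 + B 0 0 by rewrite mxE.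
    rewrite /qform -addE; congr ((_ : 'M_1) 0 0).
    rewrite /F mulmxDr mulmxDl trmx_mul !mulmxA; congr (_ + _).
    have e1 : v *m (evalmx 0 Q - evalmx 0 W *m invmx (evalmx 0 K) *m (evalmx 0 W)^T) = w *m evalmx 0 Q.
      by rewrite mulmxBr !mulmxA -/u WE !mulmxA -mulmxBl.
    have e2 : w *m evalmx 0 Q *m (u *m E)^T = 0.
      by rewrite trmx_mul mulmxA -[w *m _ *m E^T]mulmxA -eW wW mul0mx.
    by rewrite e1 {1}vE linearD /= mulmxDr e2 addr0.
  have [w0|w0] := eqVneq w 0; last first.
    by rewrite ltr_pwDl ?normsq_ge0 //; apply: pos0.
  rewrite w0 /qform mul0mx mul0mx [X in X + _]mxE add0r; apply: normsq_gt0.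
  apply: contra v0 => /eqP vW; rewrite vE w0 add0r -[u](mulmxK uK) uK' vW.
  by rewrite !mul0mx.
move=> v v0 vW; have [|uQ uK _] := H 1; first by rewrite lexx ler01.
have := pos1 v v0; rewrite qME // (pmulr_rgt0 _ (D0 _ uK)) /F /qform.
rewrite mulmxDr mulmxBr !mulmxA vW !mul0mx subr0 addr0.
by [].
Qed.

End PositiveDefinite.

(** * Bases modulo an ideal *)

Section Basis.
Variables (R : realType) (n : nat).
Local Notation P := {mpoly R[n]}.
Implicit Type rel : P -> Prop.

Definition comb N (b : 'I_N -> P) (x : 'rV[R]_N) : P := \sum_i x 0 i *: b i.

Definition spans rel k N (b : 'I_N -> P) : Prop :=
  forall p : P, p \is k.-homog -> exists x, generated rel (p - comb b x).

Definition indep rel N (b : 'I_N -> P) : Prop :=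
  forall x, generated rel (comb b x) -> x = 0.

Lemma dhomog_comb k N (b : 'I_N -> P) x : (forall i, b i \is k.-homog) -> comb b x \is k.-homog.
Proof. by move=> hb; apply: dhomog_sum => i _; rewrite dhomogZ. Qed.

(** A linear dependence allows one element to be dropped. The result is a subfamily, so its elements
    are still cone monomials in the application. *)
Lemma basis_extract rel k N (b : 'I_N -> P) : spans rel k b ->
  exists M (c : 'I_M -> P), [/\ spans rel k c, indep rel c & forall i, exists j, c i = b j].
Proof.
elim: N => [|N IHN] in b * => sb.
  by exists 0%N, b; split=> // [x _|i]; [apply: thinmx0|exists i].
have [ib|] := pselect (indep rel b); first by exists N.+1, b; split=> // i; exists i.
move=> /existsNP[x /not_implyP[Ix /eqP/rV0Pn[j xj]]].
have [|M [c [sc ic cb]]] := IHN (b \o lift j).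
  move=> p /sb[y Iy]; exists (\row_i (y 0 (lift j i) - y 0 j / x 0 j * x 0 (lift j i))).
  have -> : p - comb (b \o lift j) (\row_i (y 0 (lift j i) - y 0 j / x 0 j * x 0 (lift j i)))
     = p - comb b y + (y 0 j / x 0 j) *: comb b x.
    have E z : comb b z = z 0 j *: b j + \sum_i z 0 (lift j i) *: b (lift j i).
      by rewrite /comb (bigD1_ord j).
    rewrite !E scalerDr scalerA mulfVK // /comb /=.
    under eq_bigr do rewrite mxE scalerBl -scalerA.
    rewrite sumrB -scaler_sumr.
    by move: (y 0 j *: b j) (\sum_i _ *: _) (_ *: \sum_i _) => u v w; ring.
  by apply: generatedD => //; apply: generatedZ.
by exists M, c; split=> // i; have [l ->] := cb i; exists (lift j l).
Qed.

Lemma face_basis (C : {set {set 'I_n}}) L k : simplicial C L ->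
  exists N (b : 'I_N -> P), [/\ spans (crel C L) k b, indep (crel C L) b &
    forall i, exists A, [/\ A \in C, #|A| = k & b i = mono R A]].
Proof.
move=> sC; pose S := [set A in C | #|A| == k].
have [|N [b [sb ib bS]]] := @basis_extract (crel C L) k #|S| (fun i => mono R (enum_val i)).
  move=> p /(face_span sC)[g Hg]; exists (\row_i g (enum_val i)).
  rewrite /comb (_ : \sum_i _ = \sum_(A in C | #|A| == k) g A *: mono R A) //.
  rewrite [RHS](eq_bigl (mem S)) => [|A]; last by rewrite !inE.
  by rewrite [RHS]big_enum_val; apply: eq_bigr => i _; rewrite mxE.
exists N, b; split=> // i; have [j ->] := bS i.
by have := enum_valP j; rewrite inE => /andP[? /eqP ?]; exists (enum_val j).
Qed.

Definition gram (deg : {scalar P}) (l : P) m N M (b : 'I_N -> P) (c : 'I_M -> P) :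
  'M[R]_(N, M) := \matrix_(i, j) deg (l ^+ m * b i * c j).

Lemma gram_comb deg l m N M (b : 'I_N -> P) (c : 'I_M -> P) x j :
  (x *m gram deg l m b c) 0 j = deg (l ^+ m * comb b x * c j).
Proof.
rewrite mxE /comb mulr_sumr mulr_suml raddf_sum /=; apply: eq_bigr => i _.
by rewrite mxE -scalerAr -scalerAl linearZ.
Qed.

Lemma qform_comb deg l m N (b : 'I_N -> P) x :
  qform (gram deg l m b b) x = deg (l ^+ m * comb b x * comb b x).
Proof.
rewrite /qform [LHS]mxE {2}/comb mulr_sumr raddf_sum /=; apply: eq_bigr => j _.
by rewrite gram_comb mxE mulrC -scalerAr linearZ.
Qed.

Section Form.
Variables (rel : P -> Prop) (d : nat) (deg : {scalar P}) (l : P) (k : nat).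
Hypothesis degP : forall p, p \is d.-homog -> deg p = 0 <-> generated rel p.
Hypothesis pdP : pd_property (generated rel) d deg.
Hypothesis hl : l \is 1.-homog.
Hypothesis le_k : (k.*2 <= d)%N.
Hypothesis hl_inj : forall p : P, p \is k.-homog ->
  generated rel (l ^+ (d - k.*2) * p) -> generated rel p.
Variables (N : nat) (b : 'I_N -> P).
Hypothesis (bk : forall i, b i \is k.-homog) (sb : spans rel k b) (ib : indep rel b).

Let hlp (p : P) : p \is k.-homog -> l ^+ (d - k.*2) * p \is (d - k).-homog.
Proof.
by move=> hp; apply: (dhomogMe (dhomogXe hl erefl) hp); move: le_k; rewrite -addnn; lia.
Qed.

Let hlpq (p q : P) : p \is (d - k).-homog -> q \is k.-homog -> p * q \is d.-homog.
Proof. by move=> hp hq; apply: (dhomogMe hp hq); move: le_k; rewrite -addnn; lia. Qed.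

Lemma spans_pd (p : P) : p \is (d - k).-homog -> (forall j, deg (p * b j) = 0) ->
  generated rel p.
Proof.
move=> hp pb; apply: (pdP _ hp) => [|q]; first exact: leq_subr.
rewrite subKn; last by move: le_k; rewrite -addnn; lia.
move=> hq; have [x Ix] := sb hq.
have hx := dhomog_comb x bk.
rewrite (deg_congr degP (q := p * comb b x)) ?hlpq //; last first.
  by rewrite -mulrBr; apply: generatedM.
rewrite /comb mulr_sumr raddf_sum big1 // => i _ /=.
by rewrite -scalerAr linearZ /= pb mulr0.
Qed.

(** A vector in the kernel is a class whose product with [l ^+ (d - k.*2)] pairs to zero with all of
    degree [k]; duality and then injectivity make the class zero. *)
Lemma gram_unit : gram deg l (d - k.*2) b b \in unitmx.
Proof.
rewrite -row_free_unit -kermx_eq0; apply/rowV0P => v /sub_kermxP vQ.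
apply: ib; apply: hl_inj; first exact: dhomog_comb.
apply: spans_pd => [|j]; first by apply: hlp; apply: dhomog_comb.
by rewrite -gram_comb vQ mxE.
Qed.

(** Surjectivity comes from injectivity: a linear system with the invertible Gram matrix gives a
    class whose image has the same pairings as [q], and duality identifies the two. *)
Lemma hl_surjective (q : P) : q \is (d - k).-homog ->
  exists2 p : P, p \is k.-homog & generated rel (q - l ^+ (d - k.*2) * p).
Proof.
move=> hq; pose x := (\row_j deg (q * b j)) *m invmx (gram deg l (d - k.*2) b b).
exists (comb b x); first exact: dhomog_comb.
have hx := hlp (dhomog_comb x bk).
apply: spans_pd => [|j]; first exact: dhomogB.
by rewrite mulrBl raddfB /= -gram_comb /x (mulmxKV gram_unit) mxE subrr.
Qed.

End Form.

(* The classes [c j], times [l], span a complement of the primitive classes. *)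
Lemma hr_path (rel : R -> P -> Prop) (deg : R -> {scalar P}) (d m k : nat) (l : P)
    N (b : 'I_N -> P) r (c : 'I_r -> P) (sg : R) :
  l \is 1.-homog -> (m + k + k)%N = d -> sg != 0 ->
  (forall i, b i \is k.-homog) -> (forall j, l * c j \is k.-homog) ->
  (forall p, exists g : {poly R}, forall s, deg s p = g.[s]) ->
  (forall s, 0 <= s <= 1 ->
    [/\ forall p, p \is d.-homog -> deg s p = 0 <-> generated (rel s) p,
        spans (rel s) k b, indep (rel s) b, gram (deg s) l m b b \in unitmx &
        gram (deg s) l m (fun j => l * c j) (fun j => l * c j) \in unitmx]) ->
  let hr s := forall p : P, p \is k.-homog ->
    (forall j, deg s (l ^+ m * p * (l * c j)) = 0) -> ~ generated (rel s) p ->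
    0 < sg * deg s (l ^+ m * p * p) in
  hr 0 -> hr 1.
Proof.
move=> hl ed sg0 bk ck /choice[G GE] H hr hr0.
(* Matrices over the polynomials in [s] whose values are [sg] times the Gram matrices of [deg s]. *)
pose G2 M1 M2 (e : 'I_M1 -> P) (f : 'I_M2 -> P) : 'M[{poly R}]_(M1, M2) :=
  \matrix_(i, j) (sg%:P * G (l ^+ m * e i * f j)).
have G2E s M1 M2 (e : 'I_M1 -> P) (f : 'I_M2 -> P) :
    evalmx s (G2 _ _ e f) = sg *: gram (deg s) l m e f.
  by apply/matrixP => i j; rewrite evalmxE !mxE hornerM hornerC GE.
have symG M1 (e : 'I_M1 -> P) : (G2 _ _ e e)^T = G2 _ _ e e.
  by apply/matrixP => i j; rewrite !mxE mulrAC.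
pose lc j := l * c j.
have hm (p q : P) : p \is k.-homog -> q \is k.-homog -> l ^+ m * p * q \is d.-homog.
  by move=> hp hq; apply: (dhomogMe (dhomogM (dhomogXe hl erefl) hp) hq).
have qE s x : qform (evalmx s (G2 _ _ b b)) x = sg * deg s (l ^+ m * comb b x * comb b x).
  by rewrite G2E /qform -scalemxAr -scalemxAl mxE -/(qform _ _) qform_comb.
have W0 s x : x *m evalmx s (G2 _ _ b lc) = 0 <->
    forall j, deg s (l ^+ m * comb b x * lc j) = 0.
  rewrite G2E -scalemxAr; split=> [/eqP|Hx].
    by rewrite scaler_eq0 (negPf sg0) => /eqP + j; rewrite -gram_comb => ->; rewrite mxE.
  by apply/rowP => j; rewrite mxE gram_comb Hx mulr0 mxE.
have s01 : 0 <= (1 : R) <= 1 /\ 0 <= (0 : R) <= 1 by rewrite !lexx ler01.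
have [degP1 sb1 ib1 _ _] := H 1 s01.1.
have [degP0 sb0 ib0 _ _] := H 0 s01.2.
move=> p hp pc nIp; have [x Ix] := sb1 p hp; set u := comb b x in Ix.
have hu : u \is k.-homog by apply: dhomog_comb.
have degpu (q : P) : q \is k.-homog -> deg 1 (l ^+ m * p * q) = deg 1 (l ^+ m * u * q).
  move=> hq; apply: (deg_congr degP1); rewrite ?hm // -mulrBl -mulrBr.
  by apply: generatedMr; apply: generatedM.
have -> : deg 1 (l ^+ m * p * p) = deg 1 (l ^+ m * u * u).
  by rewrite degpu // [l ^+ m * u * p]mulrAC degpu.
rewrite -qE; apply: (@posdef_kernel_path R N r (G2 _ _ b b) (G2 _ _ b lc) (G2 _ _ lc lc)).
- exact: symG.
- exact: symG.
- move=> s /H[degPs sbs ibs uQ uK]; split.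
  + by rewrite G2E unitmxZ ?unitfE.
  + by rewrite G2E unitmxZ ?unitfE.
  (* The coordinates of [l * c j] in the basis [b] are the rows of [E]. They are found separately
     for each [s], which is all that [posdef_kernel_path] asks. *)
  have [e eE] := choice (fun j => sbs _ (ck j)).
  have IE (q : P) j : q \is k.-homog -> deg s (l ^+ m * q * comb b (e j)) = deg s (l ^+ m * q * lc j).
    move=> hq; symmetry; apply: (deg_congr degPs).
    - exact: hm (ck j).
    - by apply: hm => //; apply: dhomog_comb.
    - by rewrite -mulrBr; apply: generatedM; apply: eE.
  exists (\matrix_j e j).
    rewrite !G2E -scalemxAl; congr (_ *: _); apply/matrixP => i j; rewrite !mxE.
    rewrite -IE // /comb mulr_sumr raddf_sum /=; apply: eq_bigr => h _.
    by rewrite !mxE -scalerAr linearZ /= mulrC.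
  rewrite !G2E -scalemxAr; congr (_ *: _); apply/matrixP => i j; rewrite [LHS]mxE.
  transitivity ((e i *m gram (deg s) l m b lc) 0 j); last first.
    by rewrite !mxE; apply: eq_bigr => h _; rewrite !mxE.
  rewrite gram_comb mulrAC [in RHS]mulrAC IE //; exact: ck.
- move=> y y0 /W0 yW; rewrite qE; apply: hr0 => //; first exact: dhomog_comb.
  by move=> /ib0 e0; rewrite e0 eqxx in y0.
- by apply/negP => /eqP x0; apply: nIp; move: Ix; rewrite /u x0 /comb big1 ?subr0 // => i _; rewrite mxE scale0r.
- by apply/W0 => j; rewrite -/u -degpu; [exact: pc|exact: ck].
Qed.

End Basis.

(** * Projective line bundles *)

Section BundleDef.
Variables (R : realType) (n : nat).
Local Notation ray := 'I_n.
Variables (a b : ray).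

(** The linear form that the bundle has besides those of the base. It takes opposite values on the
    opposite rays [a] and [b], and [c] records how the rays of the base are tilted; its relation
    reads [x_b = x_a + plf c]. *)
Definition twist (c : ray -> R) (i : ray) : R :=
  if i == a then 1 else if i == b then -1 else c i.

Definition bcones (C : {set {set ray}}) : {set {set ray}} :=
  [set B : {set ray} | (B :\: [set a; b] \in C) && ~~ ((a \in B) && (b \in B))].

Definition blin (L : (ray -> R) -> Prop) (c g : ray -> R) : Prop :=
  exists z, exists2 l, L l & forall i, g i = z * twist c i + l i.

(** [a] and [b] are spare indices of the base, so that base and bundle share one index set and one
    polynomial ring. *)
Definition bundle_base (C : {set {set ray}}) (L : (ray -> R) -> Prop) : Prop :=
  [/\ simplicial C L, forall A, A \in C -> (a \notin A) /\ (b \notin A) &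
      forall l, L l -> l a = 0 /\ l b = 0].

End BundleDef.

Section Bundle.
Variables (R : realType) (n : nat).
Local Notation P := {mpoly R[n]}.
Local Notation ray := 'I_n.
Variables (a b : ray) (ab : a != b).
Local Notation bcones := (@bcones n a b).
Local Notation blin := (@blin R n a b).
Local Notation twist := (@twist R n a b).
Implicit Types (C : {set {set ray}}) (L : (ray -> R) -> Prop) (A B : {set ray}).

Lemma twista (c : ray -> R) : twist c a = 1. Proof. by rewrite /twist eqxx. Qed.
Lemma twistb (c : ray -> R) : twist c b = -1.
Proof. by rewrite /twist eq_sym (negPf ab) eqxx. Qed.
Lemma twistN (c : ray -> R) i : i != a -> i != b -> twist c i = c i.
Proof. by rewrite /twist => /negPf-> /negPf->. Qed.

Lemma setDab A : a \notin A -> b \notin A -> A :\: [set a; b] = A.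
Proof.
move=> aA bA; apply/setDidPl.
by rewrite disjoint_sym -setI_eq0 setIUl setU_eq0 !setI_eq0 !disjoints1 aA.
Qed.

Lemma setDabUa A : a \notin A -> b \notin A -> (a |: A) :\: [set a; b] = A.
Proof. by move=> aA bA; rewrite setDUl (setDab aA bA) (_ : [set a] :\: _ = set0) ?set0U //; apply/eqP; rewrite setD_eq0 subsetUl. Qed.

Lemma setDabUb A : a \notin A -> b \notin A -> (b |: A) :\: [set a; b] = A.
Proof. by move=> aA bA; rewrite setDUl (setDab aA bA) (_ : [set b] :\: _ = set0) ?set0U //; apply/eqP; rewrite setD_eq0 subsetUr. Qed.

Section Base.
Variables (C : {set {set ray}}) (L : (ray -> R) -> Prop) (base : bundle_base a b C L).

Let sC : simplicial C L. Proof. by case: base. Qed.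
Let aC A : A \in C -> a \notin A. Proof. by case: base => _ H _ /H[]. Qed.
Let bC A : A \in C -> b \notin A. Proof. by case: base => _ H _ /H[]. Qed.
Let La l : L l -> l a = 0. Proof. by case: base => _ _ H /H[]. Qed.
Let Lb l : L l -> l b = 0. Proof. by case: base => _ _ H /H[]. Qed.
Let rayNa i : [set i] \in C -> i != a. Proof. by move/aC; rewrite inE eq_sym. Qed.
Let rayNb i : [set i] \in C -> i != b. Proof. by move/bC; rewrite inE eq_sym. Qed.

Lemma bconesC A : A \in C -> A \in bcones C.
Proof. by move=> Ac; rewrite inE setDab ?aC ?bC // Ac (negPf (aC Ac)). Qed.

Lemma bconesUa A : A \in C -> a |: A \in bcones C.
Proof.
move=> Ac; rewrite inE setDabUa ?aC ?bC // Ac !inE eqxx (negPf (bC Ac)) orbF /=.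
by rewrite eq_sym.
Qed.

Lemma bconesUb A : A \in C -> b |: A \in bcones C.
Proof.
move=> Ac; rewrite inE setDabUb ?aC ?bC // Ac !inE eqxx (negPf (aC Ac)) orbF /=.
by rewrite (negPf ab).
Qed.

Variant bcones_spec B : Prop :=
  | BconesBase of B \in C
  | BconesA A of A \in C & B = a |: A
  | BconesB A of A \in C & B = b |: A.

Lemma bconesP B : B \in bcones C -> bcones_spec B.
Proof.
rewrite inE => /andP[Bc nab]; have [aB|aB] := boolP (a \in B).
  rewrite aB /= in nab; apply: (BconesA Bc); apply/setP => i; rewrite !inE.
  have [->|ia] := eqVneq i a; rewrite ?aB //=.
  by have [->|ib] := eqVneq i b; rewrite //= (negPf nab).
have [bB|bB] := boolP (b \in B); last by apply: BconesBase; rewrite setDab in Bc.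
apply: (BconesB Bc); apply/setP => i; rewrite !inE.
have [->|ib] := eqVneq i b; rewrite ?bB //= orbF.
by have [->|ia] := eqVneq i a; rewrite //= (negPf aB).
Qed.

Lemma bcones_ray i : ([set i] \in bcones C) = [|| i == a, i == b | [set i] \in C].
Proof.
have [->|ia] := eqVneq i a.
  by rewrite -[[set a]]setU0 bconesUa // (face0 sC).
have [->|ib] := eqVneq i b.
  by rewrite -[[set b]]setU0 bconesUb // (face0 sC).
apply/idP/idP => [|/bconesC //]; rewrite inE setDab ?inE 1?eq_sym //.
by case/andP.
Qed.

Lemma plf_bundle (g : ray -> R) :
  plf (bcones C) g = g a *: 'X_a + g b *: 'X_b + plf C g.
Proof.
rewrite /plf (bigD1 a) ?bcones_ray ?eqxx //= (bigD1 b) ?bcones_ray ?eqxx ?orbT 1?eq_sym //=.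
rewrite addrA; congr (_ + _); apply: eq_bigl => i; rewrite bcones_ray.
have [->|ia] := eqVneq i a; first by rewrite andbF; apply/esym/negbTE/negP => /rayNa/eqP.
have [->|ib] := eqVneq i b; first by rewrite andbF; apply/esym/negbTE/negP => /rayNb/eqP.
by rewrite /= !andbT.
Qed.

Lemma simplicial_bundle c : simplicial (bcones C) (blin L c).
Proof.
split.
- exact/bconesC/(face0 sC).
- move=> A B; rewrite !inE => /andP[Ac nab] BA; rewrite (face_sub sC Ac (setSD _ BA)) /=.
  by apply: contra nab => /andP[/(subsetP BA)-> /(subsetP BA)->].
- by exists 0, (fun=> 0) => [|i]; [apply: (lin0 sC)|rewrite mul0r addr0].
- move=> l m [z [k Lk kE]] [z' [k' Lk' kE']].
  exists (z + z'), (fun i => k i + k' i); first exact: (linD sC).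
  by move=> i; rewrite kE kE' mulrDl addrACA.
- move=> y l [z [k Lk kE]]; exists (y * z), (fun i => y * k i); first exact: (linZ sC).
  by move=> i; rewrite kE mulrDr mulrA.
move=> T u TB; have TC : T :\: [set a; b] \in C by move: TB; rewrite inE => /andP[].
(* The coefficient of [twist c] is dictated by the value at whichever of [a] and [b] lies in [T]; at
   most one does, and the sign at [b] comes from [twist c b = -1]. *)
pose z := if a \in T then u a else if b \in T then - u b else 0.
have [l Ll lu] := lin_interp sC (fun i => u i - z * twist c i) TC.
exists (fun i => z * twist c i + l i); first by exists z, l.
move=> i iT /=; have [ia|ia] := eqVneq i a.
  by rewrite ia (La Ll) twista mulr1 addr0 /z -ia iT.
have [ib|ib] := eqVneq i b; last by rewrite lu ?inE ?negb_or ?ia ?ib // addrC subrK.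
rewrite ib (Lb Ll) twistb mulrN1 addr0 /z; move: TB; rewrite inE => /andP[_].
by rewrite -ib iT andbT => /negPf->; rewrite opprK.
Qed.

Lemma cdim_bundle : cdim (bcones C) = (cdim C).+1.
Proof.
apply/eqP; rewrite eqn_leq; apply/andP; split.
  apply/bigmax_leqP => B /bconesP[Bc|A Ac ->|A Ac ->].
  - by apply: leqW; apply: cdim_ge.
  - by rewrite cardsU1 aC // ltnS cdim_ge.
  - by rewrite cardsU1 bC // ltnS cdim_ge.
have [A Ac <-] := cdim_attained (face0 sC).
by have := cdim_ge (bconesUa Ac); rewrite cardsU1 aC.
Qed.

Lemma starc_bundle_a : starc (bcones C) [set a] = C.
Proof.
apply/setP => A; rewrite in_starc disjoint_sym disjoints1 setUC.
apply/andP/idP => [[aA /bconesP[]]|Ac]; last by rewrite aC // bconesUa.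
- by move/aC; rewrite setU11.
- move=> A' A'C e; suff -> : A = A' by [].
  by rewrite -(setU1K aA) e setU1K // aC.
- move=> A' A'C /setP/(_ a); rewrite setU11 !inE (negPf ab) /= => /esym.
  by rewrite (negPf (aC A'C)).
Qed.

Lemma starc_bundle_b : starc (bcones C) [set b] = C.
Proof.
apply/setP => A; rewrite in_starc disjoint_sym disjoints1 setUC.
apply/andP/idP => [[bA /bconesP[]]|Ac]; last by rewrite bC // bconesUb.
- by move/bC; rewrite setU11.
- move=> A' A'C /setP/(_ b); rewrite setU11 !inE eq_sym (negPf ab) /= => /esym.
  by rewrite (negPf (bC A'C)).
- move=> A' A'C e; suff -> : A = A' by [].
  by rewrite -(setU1K bA) e setU1K // bC.
Qed.

Lemma starl_bundle_a c : starl (blin L c) [set a] = L.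
Proof.
apply/predeqP => g; split=> [[[z [l Ll gE]] ga]|Lg]; last first.
  split; first by exists 0, g => // i; rewrite mul0r add0r.
  by move=> i; rewrite inE => /eqP->; apply: La.
suff -> : g = l by [].
apply/funext => i; rewrite gE; have := ga a; rewrite gE twista (La Ll) ?inE eqxx mulr1 addr0.
by move=> ->; rewrite ?mul0r ?add0r.
Qed.

Lemma starl_bundle_b c : starl (blin L c) [set b] = L.
Proof.
apply/predeqP => g; split=> [[[z [l Ll gE]] gb]|Lg]; last first.
  split; first by exists 0, g => // i; rewrite mul0r add0r.
  by move=> i; rewrite inE => /eqP->; apply: Lb.
suff -> : g = l by [].
apply/funext => i; rewrite gE; have := gb b; rewrite gE twistb (Lb Ll) ?inE eqxx mulrN1 addr0.
by move=> /(_ isT)/eqP; rewrite oppr_eq0 => /eqP->; rewrite mul0r add0r.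
Qed.

Lemma base_star T : T \in C -> bundle_base a b (starc C T) (starl L T).
Proof.
move=> TC; split; first exact: simplicial_star.
- move=> A; rewrite in_starc => /andP[_ ATC].
  split; [have := aC ATC|have := bC ATC]; by rewrite inE negb_or => /andP[].
- by move=> l [Ll _]; split; [apply: La|apply: Lb].
Qed.

Lemma starc_bundle T : T \in C -> starc (bcones C) T = bcones (starc C T).
Proof.
move=> TC; have Tab : [disjoint T & [set a; b]].
  by rewrite disjoint_sym -setI_eq0 setIUl setU_eq0 !setI_eq0 !disjoints1 aC ?bC.
apply/setP => A; rewrite in_starc inE [in RHS]inE in_starc.
have -> : A :\: [set a; b] :|: T = (A :|: T) :\: [set a; b].
  by rewrite setDUl (setDidPl Tab).
rewrite !inE (negPf (aC TC)) (negPf (bC TC)) !orbF.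
have -> : [disjoint A :\: [set a; b] & T] = [disjoint A & T].
  rewrite -!setI_eq0; congr (_ == _); apply/setP => i; rewrite !inE.
  have [iT|] := boolP (i \in T); last by rewrite !andbF.
  by move: (disjointFr Tab iT); rewrite !inE => ->.
by rewrite andbA.
Qed.

(** The star over [T] is a bundle again, with the twist corrected by a linear form of the base so
    that it vanishes on [T]; the induction on stars therefore runs over all twists. *)
Lemma starl_bundle T c m : T \in C -> L m -> (forall i, i \in T -> m i = c i) ->
  starl (blin L c) T = blin (starl L T) (fun i => c i - m i).
Proof.
move=> TC Lm mc; have tm i : twist (fun i => c i - m i) i = twist c i - m i.
  have [->|ia] := eqVneq i a; first by rewrite !twista (La Lm) subr0.
  by have [->|ib] := eqVneq i b; rewrite ?twistb ?(Lb Lm) ?subr0 ?(twistN _ ia ib).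
have tc i : i \in T -> twist c i = c i.
  move=> iT; apply: twistN; first by apply: contraNneq (aC TC) => <-.
  by apply: contraNneq (bC TC) => <-.
apply/predeqP => g; split=> [[[z [l Ll gE]] gT]|[z [l [Ll lT] gE]]].
  exists z, (fun i => l i + z * m i) => [|i]; last by rewrite gE tm; ring.
  split; first exact: (linD sC Ll (linZ sC z Lm)).
  by move=> i iT; rewrite mc // -tc // addrC -gE gT.
split; last by move=> i iT; rewrite gE tm tc // mc // subrr mulr0 lT // addr0.
exists z, (fun i => l i - z * m i); first exact: (linB sC Ll (linZ sC z Lm)).
by move=> i; rewrite gE tm; ring.
Qed.

End Base.
End Bundle.

(** * Reduction modulo the fibre relation x (x + c) = 0 *)

Lemma drop_poly1D (A : comNzRingType) (p q : {poly A}) (c : A) :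
  p = q * 'X + c%:P -> drop_poly 1 p = q /\ p.[0] = c.
Proof.
move=> ->; split; last by rewrite hornerMXaddC mulr0 add0r.
by rewrite addrC -['X]expr1 drop_polyDMXn // size_polyC leq_b1.
Qed.

Lemma poly1_split (A : comNzRingType) (p : {poly A}) :
  p = drop_poly 1 p * 'X + (p.[0])%:P.
Proof.
rewrite -{1}(poly_take_drop 1 p) expr1 addrC; congr (_ + _).
apply/polyP => i; rewrite coef_take_poly coefC horner_coef0.
by case: i.
Qed.

(** Product rule for [p = p1 * 'X + p0] with the quotient by ['X] evaluated at [x]. For [x = - cc]
    it expresses that the square of [x_a] is [- cc * x_a]. *)
Lemma drop_poly1M (A : comNzRingType) (p q : {poly A}) (x : A) :
  (drop_poly 1 (p * q)).[x] = (drop_poly 1 p).[x] * q.[0] + p.[0] * (drop_poly 1 q).[x]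
    + x * ((drop_poly 1 p).[x] * (drop_poly 1 q).[x]).
Proof.
set p1 := drop_poly 1 p; set q1 := drop_poly 1 q.
have [-> _] : drop_poly 1 (p * q) = p1 * q1 * 'X + p1 * (q.[0])%:P + (p.[0])%:P * q1 /\
    (p * q).[0] = p.[0] * q.[0].
  have E (u v w y z : {poly A}) :
    (u * w + y) * (v * w + z) = (u * v * w + u * z + y * v) * w + y * z by ring.
  by apply: drop_poly1D; rewrite polyCM -E -!poly1_split.
by rewrite !(hornerD, hornerM, hornerX, hornerC); ring.
Qed.

(** A polynomial read as one in [x_a], written ['X], with [x_b] replaced by [x_a + cc]. Then
    [x_a * x_b = 0] becomes ['X * ('X + cc) = 0], so the cofactor of ['X] may be evaluated at
    [- cc]. *)
HB.lock Definition fib_poly (R : realType) n (a b : 'I_n) (cc p : {mpoly R[n]}) :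
  {poly {mpoly R[n]}} :=
  mmap (@polyC {mpoly R[n]} \o @mpolyC n R)
    (fun i => if i == a then 'X else if i == b then 'X + cc%:P else ('X_i)%:P) p.

Section Fibre.
Variables (R : realType) (n : nat).
Local Notation P := {mpoly R[n]}.
Local Notation ray := 'I_n.
Variables (a b : ray) (ab : a != b) (cc : P).
Local Notation fib_poly := (fib_poly a b cc).

Lemma fib_poly_is_additive : additive fib_poly.
Proof. by rewrite fib_poly.unlock => p q; rewrite raddfB. Qed.
HB.instance Definition _ :=
  GRing.isAdditive.Build P {poly P} fib_poly fib_poly_is_additive.

Lemma fib_poly_is_multiplicative : multiplicative fib_poly.
Proof. by rewrite fib_poly.unlock; split=> [p q|]; rewrite ?rmorphM ?rmorph1. Qed.
HB.instance Definition _ :=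
  GRing.isMultiplicative.Build P {poly P} fib_poly fib_poly_is_multiplicative.

(* Modulo the relations [x_a x_b = 0] and [x_b = x_a + cc], every polynomial is
   congruent to [fib0 p + fib1 p * x_a]. *)
Definition fib0 (p : P) : P := (fib_poly p).[0].
Definition fib1 (p : P) : P := (drop_poly 1 (fib_poly p)).[- cc].

Lemma fib_polyC z : fib_poly z%:MP = (z%:MP)%:P.
Proof. by rewrite fib_poly.unlock mmapC. Qed.

Lemma fib_polyX i : fib_poly 'X_i =
  if i == a then 'X else if i == b then 'X + cc%:P else ('X_i)%:P.
Proof. by rewrite fib_poly.unlock mmapX mmap1U. Qed.

Lemma fib0_is_additive : additive fib0.
Proof. by move=> p q; rewrite /fib0 rmorphB hornerD hornerN. Qed.
HB.instance Definition _ := GRing.isAdditive.Build P P fib0 fib0_is_additive.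
Lemma fib0_is_multiplicative : multiplicative fib0.
Proof. by split=> [p q|]; rewrite /fib0 ?rmorphM ?rmorph1 ?hornerM ?hornerC. Qed.
HB.instance Definition _ := GRing.isMultiplicative.Build P P fib0 fib0_is_multiplicative.
Lemma fib0C c : fib0 c%:MP = c%:MP.
Proof. by rewrite /fib0 fib_polyC hornerC. Qed.
Lemma fib0_is_scalable : scalable fib0.
Proof. by move=> c p; rewrite -!mul_mpolyC rmorphM /= fib0C. Qed.
HB.instance Definition _ := GRing.isScalable.Build R P P *:%R fib0 fib0_is_scalable.

Lemma fib1_is_additive : additive fib1.
Proof. by move=> p q; rewrite /fib1 rmorphB /= raddfB /= hornerD hornerN. Qed.
HB.instance Definition _ := GRing.isAdditive.Build P P fib1 fib1_is_additive.
Lemma fib1C c : fib1 c%:MP = 0.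
Proof.
rewrite /fib1 fib_polyC.
by have [|-> _] := @drop_poly1D P (c%:MP)%:P 0 c%:MP; rewrite ?mul0r ?add0r ?horner0.
Qed.
Lemma fib1M p q : fib1 (p * q) = fib1 p * fib0 q + fib0 p * fib1 q - cc * (fib1 p * fib1 q).
Proof. by rewrite /fib1 rmorphM drop_poly1M mulNr. Qed.
Lemma fib1_is_scalable : scalable fib1.
Proof. by move=> c p; rewrite -!mul_mpolyC fib1M fib1C fib0C !mul0r mulr0 subr0 add0r. Qed.
HB.instance Definition _ := GRing.isScalable.Build R P P *:%R fib1 fib1_is_scalable.

Lemma fib0D p q : fib0 (p + q) = fib0 p + fib0 q. Proof. exact: raddfD. Qed.
Lemma fib0B p q : fib0 (p - q) = fib0 p - fib0 q. Proof. exact: raddfB. Qed.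
Lemma fib0M p q : fib0 (p * q) = fib0 p * fib0 q. Proof. exact: rmorphM. Qed.
Lemma fib0X p k : fib0 (p ^+ k) = fib0 p ^+ k. Proof. exact: rmorphXn. Qed.
Lemma fib0Z z p : fib0 (z *: p) = z *: fib0 p. Proof. exact: linearZ. Qed.
Lemma fib0_0 : fib0 0 = 0. Proof. exact: raddf0. Qed.
Lemma fib1D p q : fib1 (p + q) = fib1 p + fib1 q. Proof. exact: raddfD. Qed.
Lemma fib1B p q : fib1 (p - q) = fib1 p - fib1 q. Proof. exact: raddfB. Qed.
Lemma fib1Z z p : fib1 (z *: p) = z *: fib1 p. Proof. exact: linearZ. Qed.
Lemma fib1_0 : fib1 0 = 0. Proof. exact: raddf0. Qed.

Lemma fib0a : fib0 'X_a = 0.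
Proof. by rewrite /fib0 fib_polyX eqxx hornerX. Qed.
Lemma fib0b : fib0 'X_b = cc.
Proof. by rewrite /fib0 fib_polyX eq_sym (negPf ab) eqxx hornerD hornerX hornerC add0r. Qed.
Lemma fib0N i : i != a -> i != b -> fib0 'X_i = 'X_i.
Proof. by rewrite /fib0 fib_polyX => /negPf-> /negPf->; rewrite hornerC. Qed.
Lemma fib1a : fib1 'X_a = 1.
Proof.
rewrite /fib1 fib_polyX eqxx.
by have [|-> _] := @drop_poly1D P ('X : {poly P}) 1 0; rewrite ?mul1r ?addr0 ?hornerC.
Qed.
Lemma fib1b : fib1 'X_b = 1.
Proof.
rewrite /fib1 fib_polyX eq_sym (negPf ab) eqxx.
by have [|-> _] := @drop_poly1D P ('X + cc%:P : {poly P}) 1 cc; rewrite ?mul1r ?hornerC.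
Qed.
Lemma fib1N i : i != a -> i != b -> fib1 'X_i = 0.
Proof.
rewrite /fib1 fib_polyX => /negPf-> /negPf->.
by have [|-> _] := @drop_poly1D P ('X_i : P)%:P 0 'X_i; rewrite ?mul0r ?add0r ?horner0.
Qed.

Hypothesis hcc : cc \is 1.-homog.

Lemma dhomog_fib0 k p : p \is k.-homog -> fib0 p \is k.-homog.
Proof.
have -> : fib0 p = psub (fun i => fib0 'X_i) p.
  elim/mpoly_ring_ind: p => [c|i|p q Hp Hq|p q Hp Hq].
  - by rewrite fib0C psubC.
  - by rewrite psubX.
  - by rewrite !raddfD /= Hp Hq.
  - by rewrite !rmorphM /= Hp Hq.
apply: dhomog_psub => i; have [->|ia] := eqVneq i a; first by rewrite fib0a dhomog0.
by have [->|ib] := eqVneq i b; rewrite ?fib0b // fib0N // dhomogXU.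
Qed.

Lemma fib1_homog0 p : p \is 0.-homog -> fib1 p = 0.
Proof.
move: p; apply: dhomog_ind => [|c p q Hp Hq|m /eqP].
- by rewrite raddf0.
- by rewrite linearP /= Hp Hq scaler0 addr0.
by rewrite mdeg_eq0 => /eqP->; rewrite mpolyX0 -mpolyC1 fib1C.
Qed.

Lemma dhomog_fib1 k p : p \is k.+1.-homog -> fib1 p \is k.-homog.
Proof.
move: p; apply: dhomog_ind => [|c p q Hp Hq|m dm].
- by rewrite raddf0 dhomog0.
- by rewrite linearP /= dhomogD // dhomogZ.
elim: k => [|k IHk] in m dm *; have [i [m' [-> dm']]] := mdegS_split dm;
  rewrite mpolyXD fib1M.
  have h0 : 'X_[R, m'] \is 0.-homog by rewrite dhomogX /= dm'.
  rewrite (fib1_homog0 h0) !mulr0 addr0 subr0; apply: (@dhomogMe _ _ 0 0 0 _ _ _ (dhomog_fib0 h0) (addn0 0)).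
  have [->|ia] := eqVneq i a; first by rewrite fib1a dhomog1.
  by have [->|ib] := eqVneq i b; rewrite ?fib1b ?dhomog1 // fib1N // dhomog0.
have h0 : 'X_[R, m'] \is k.+1.-homog by rewrite dhomogX /= dm'.
have hX : fib1 'X_i \is 0.-homog.
  have [->|ia] := eqVneq i a; first by rewrite fib1a dhomog1.
  by have [->|ib] := eqVneq i b; rewrite ?fib1b ?dhomog1 // fib1N // dhomog0.
apply: dhomogB; first apply: dhomogD.
- exact: (dhomogMe hX (dhomog_fib0 h0)).
- exact: (dhomogMe (dhomog_fib0 (dhomogXU _ i)) (IHk _ dm')).
- exact: (dhomogMe hcc (dhomogMe hX (IHk _ dm') erefl)).
Qed.

End Fibre.

(** * The Chow ring of a bundle *)

Section BundleChow.
Variables (R : realType) (n : nat).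
Local Notation P := {mpoly R[n]}.
Local Notation ray := 'I_n.
Variables (a b : ray) (ab : a != b).
Variables (C : {set {set ray}}) (L : (ray -> R) -> Prop) (base : bundle_base a b C L).
Variable c : ray -> R.
Local Notation D := (bcones a b C).
Local Notation M := (blin a b L c).
Local Notation I := (cideal C L).
Local Notation J := (cideal D M).
Local Notation cc := (plf C c).
Local Notation f0 := (fib0 a b cc).
Local Notation f1 := (fib1 a b cc).
Implicit Types (A B : {set ray}).

Let sC : simplicial C L. Proof. by case: base. Qed.
Let aC A : A \in C -> a \notin A. Proof. by case: base => _ H _ /H[]. Qed.
Let bC A : A \in C -> b \notin A. Proof. by case: base => _ H _ /H[]. Qed.
Let La l : L l -> l a = 0. Proof. by case: base => _ _ H /H[]. Qed.
Let Lb l : L l -> l b = 0. Proof. by case: base => _ _ H /H[]. Qed.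
Let rayNa i : [set i] \in C -> i != a. Proof. by move/aC; rewrite inE eq_sym. Qed.
Let rayNb i : [set i] \in C -> i != b. Proof. by move/bC; rewrite inE eq_sym. Qed.

Lemma hcc : cc \is 1.-homog. Proof. exact: dhomog_plf. Qed.

Lemma fib0_plf f : f0 (plf C f) = plf C f.
Proof.
rewrite /plf raddf_sum; apply: eq_bigr => i iC.
by rewrite /= linearZ /= fib0N ?rayNa ?rayNb.
Qed.

Lemma fib1_plf f : f1 (plf C f) = 0.
Proof.
rewrite /plf raddf_sum big1 // => i iC.
by rewrite /= linearZ /= fib1N ?rayNa ?rayNb // scaler0.
Qed.

Lemma fib_mono A : a \notin A -> b \notin A ->
  f0 (mono R A) = mono R A /\ f1 (mono R A) = 0.
Proof.
move=> aA bA; have iN i : i \in A -> i != a /\ i != b.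
  by move=> iA; split; [apply: contraNneq aA => <-|apply: contraNneq bA => <-].
split; first by rewrite /mono rmorph_prod; apply: eq_bigr => i /iN[] *; apply: fib0N.
rewrite /mono; elim/big_rec: _ => [|i p /iN[ia ib] Hp]; first by rewrite -mpolyC1 fib1C.
by rewrite fib1M fib1N // Hp !(mul0r, mulr0) addr0 subr0.
Qed.

(** By [fib1M], the polynomials with both components in the ideal of the base form an ideal, so only
    relations are checked: the one of [twist c], those of the base, and monomials that contain both
    [a] and [b] or a non-cone of the base. *)
Lemma fib_ideal p : J p -> I (f0 p) /\ I (f1 p).
Proof.
pose Q (q : P) := I (f0 q) /\ I (f1 q).
have QM f g : Q g -> Q (f * g).
  move=> [g0 g1]; split; first by rewrite fib0M; apply: generatedM.
  rewrite fib1M; apply: generatedB; last by do 2!apply: generatedM.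
  by apply: generatedD; apply: generatedM.
have QD f g : Q f -> Q g -> Q (f + g).
  move=> [Hf0 Hf1] [Hg0 Hg1]; rewrite /Q fib0D fib1D.
  by split; [apply: generatedD Hf0 Hg0|apply: generatedD Hf1 Hg1].
move: p; apply: generated_ind => //.
  by split; rewrite ?fib0_0 ?fib1_0; apply: generated0.
move=> f g Hg; apply: (QM); case: Hg => [[A + ->]|[l [z [k Lk lE]] ->]]; last first.
  rewrite (plf_bundle ab base).
  have -> : l a *: 'X_a + l b *: 'X_b + plf C l = z *: ('X_a - 'X_b + cc) + plf C k.
    rewrite !lE twista twistb // (La Lk) (Lb Lk) !addr0 mulr1 mulrN1.
    rewrite !scalerDr scalerN scaleNr -!addrA; congr (_ + (_ + _)).
    rewrite /plf scaler_sumr -big_split /=; apply: eq_bigr => i iC.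
    by rewrite lE twistN ?rayNa ?rayNb // scalerDl scalerA.
  apply: QD; last first.
    by split; rewrite ?fib0_plf ?fib1_plf; [apply: cideal_lin|apply: generated0].
  rewrite /Q fib0Z fib1Z fib0D fib0B fib1D fib1B fib0a fib0b // fib1a fib1b // fib0_plf fib1_plf.
  by rewrite sub0r addNr subrr addr0 !scaler0; split; apply: generated0.
rewrite inE negb_and negbK => /orP[AC|/andP[aA bA]].
  have -> : A = (A :\: [set a; b]) :|: (A :&: [set a; b]) by rewrite setUC setID.
  rewrite monoU; last first.
    rewrite -setI_eq0 -subset0; apply/subsetP => i; rewrite !inE.
    by case: (_ || _); rewrite ?andbF.
  rewrite mulrC; apply: QM.
  have [||e0 e1] := @fib_mono (A :\: [set a; b]); rewrite ?inE ?eqxx ?orbT //.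
  by split; rewrite ?e0 ?e1; [apply: cideal_nonface|apply: generated0].
rewrite -(setD1K aA) monoU1 ?inE ?eqxx // -(setD1K (_ : b \in A :\ a)) ?inE 1?eq_sym ?ab //.
rewrite monoU1 ?inE ?eqxx // mulrA mulrC; apply: QM.
rewrite /Q fib1M fib0M fib0a fib0b // fib1a fib1b // !(mul0r, mul1r, mulr1, addr0) subrr.
by split; apply: generated0.
Qed.

(** Picks, for a class of the base, a representative free of ['X_a] and ['X_b]; on these [fib0] is
    the identity and [fib1] is zero. *)
Definition fib_kill : P -> P := psub (fun i => if (i == a) || (i == b) then 0 else 'X_i).
HB.instance Definition _ := GRing.RMorphism.on fib_kill.
HB.instance Definition _ := GRing.Linear.on fib_kill.

Lemma fib_killX i : fib_kill 'X_i = if (i == a) || (i == b) then 0 else 'X_i.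
Proof. exact: psubX. Qed.

Lemma fib_killC z : fib_kill z%:MP = z%:MP.
Proof. exact: psubC. Qed.

Lemma fib_kill_plf f : fib_kill (plf C f) = plf C f.
Proof.
rewrite /plf raddf_sum; apply: eq_bigr => i iC.
by rewrite /= linearZ /= fib_killX (negPf (rayNa iC)) (negPf (rayNb iC)).
Qed.

Lemma fib0_kill p : f0 (fib_kill p) = fib_kill p.
Proof.
elim/mpoly_ring_ind: p => [z|i|p q Hp Hq|p q Hp Hq].
- by rewrite fib_killC fib0C.
- rewrite fib_killX; case: ifP => [_|/negbT]; first exact: fib0_0.
  by rewrite negb_or => /andP[ia ib]; rewrite fib0N.
- by rewrite [fib_kill _]raddfD /= fib0D Hp Hq.
- by rewrite [fib_kill _]rmorphM /= fib0M Hp Hq.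
Qed.

Lemma fib1_kill p : f1 (fib_kill p) = 0.
Proof.
elim/mpoly_ring_ind: p => [z|i|p q Hp Hq|p q Hp Hq].
- by rewrite fib_killC fib1C.
- rewrite fib_killX; case: ifP => [_|/negbT]; first exact: fib1_0.
  by rewrite negb_or => /andP[ia ib]; rewrite fib1N.
- by rewrite [fib_kill _]raddfD /= fib1D Hp Hq addr0.
- by rewrite [fib_kill _]rmorphM /= fib1M Hp Hq !(mul0r, mulr0) addr0 subr0.
Qed.

Lemma fib_kill_congr p : I (p - fib_kill p).
Proof.
elim/mpoly_ring_ind: p => [z|i|p q Hp Hq|p q Hp Hq].
- by rewrite fib_killC subrr; apply: generated0.
- rewrite fib_killX; case: ifP => [ab'|_]; last by rewrite subrr; apply: generated0.
  rewrite subr0; apply: cideal_X; apply/negP => iC.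
  by move: ab'; rewrite (negPf (rayNa iC)) (negPf (rayNb iC)).
- by rewrite [fib_kill _]raddfD /= opprD addrACA; exact: generatedD Hp Hq.
- by rewrite [fib_kill _]rmorphM /=; exact: generated_congrM Hp Hq.
Qed.

Lemma dhomog_fib_kill k p : p \is k.-homog -> fib_kill p \is k.-homog.
Proof. by apply: dhomog_psub => i; case: ifP => _; rewrite ?dhomog0 ?dhomogXU. Qed.

Lemma fib_kill_ideal p : I p -> J (fib_kill p).
Proof.
apply: generated_map => g [[A Ac ->]|[l Ll ->]]; rewrite /=.
  rewrite /mono rmorph_prod /=; have [aA|aA] := boolP (a \in A).
    by rewrite (bigD1 a) //= fib_killX eqxx mul0r; apply: generated0.
  have [bA|bA] := boolP (b \in A).
    by rewrite (bigD1 b) //= fib_killX eqxx orbT mul0r; apply: generated0.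
  rewrite (eq_bigr (fun i => 'X_i)) => [|i iA].
    by apply: (@cideal_nonface _ _ D M A); rewrite inE setDab // (negPf Ac).
  rewrite fib_killX; have [ia|_] := eqVneq i a; first by rewrite -ia iA in aA.
  by have [ib|_] := eqVneq i b; first by rewrite -ib iA in bA.
rewrite fib_kill_plf; have -> : plf C l = plf D l.
  by rewrite (plf_bundle ab base) (La Ll) (Lb Ll) !scale0r !add0r.
by apply: cideal_lin; exists 0, l => // i; rewrite mul0r add0r.
Qed.

Lemma fibXab : J ('X_a * 'X_b).
Proof.
rewrite -[X in J (_ * X)]mono1 -monoU1 ?inE //.
by apply: cideal_nonface; rewrite !inE !eqxx orbT andbF.
Qed.

Lemma fibXb : J ('X_a + cc - 'X_b).
Proof.
have -> : 'X_a + cc - 'X_b = plf D (twist a b c).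
  rewrite (plf_bundle ab base) twista twistb // scale1r scaleN1r addrAC; congr (_ + _).
  by apply: eq_bigr => i iC; rewrite twistN ?rayNa ?rayNb.
apply: cideal_lin; exists 1, (fun=> 0) => [|i]; first exact: (lin0 sC).
by rewrite mul1r addr0.
Qed.

Lemma fib_decomp p : J (p - (fib_kill (f0 p) + fib_kill (f1 p) * 'X_a)).
Proof.
elim/mpoly_ring_ind: p => [z|i|p q Hp Hq|p q Hp Hq].
- rewrite fib0C fib1C raddf0 mul0r addr0 fib_killC subrr; exact: generated0.
- have [->|ia] := eqVneq i a.
    by rewrite fib0a fib1a raddf0 rmorph1 mul1r add0r subrr; apply: generated0.
  have [->|ib] := eqVneq i b.
    rewrite fib0b // fib1b // rmorph1 mul1r fib_kill_plf [cc + _]addrC -opprB.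
    by apply: generatedN; apply: fibXb.
  rewrite fib0N // fib1N // raddf0 mul0r addr0 fib_killX (negPf ia) (negPf ib) subrr.
  exact: generated0.
- rewrite fib0D fib1D ![fib_kill _]raddfD /= mulrDl.
  have E (u v w x y z : P) : u + v - (w + x + (y + z)) = u - (w + y) + (v - (x + z)) by ring.
  by rewrite E; exact: generatedD Hp Hq.
rewrite fib0M fib1M [fib_kill (_ - _)]raddfB /= [fib_kill (_ + _)]raddfD /= !rmorphM /= fib_kill_plf.
have := generated_congrM Hp Hq.
set u := fib_kill (f0 p); set v := fib_kill (f1 p); set w := fib_kill (f0 q); set x := fib_kill (f1 q).
(* The discrepancy between the two products is a multiple of ['X_a * ('X_a + cc)], which is a
   combination of the two fibre relations. *)
have E : (u + v * 'X_a) * (w + x * 'X_a) - (u * w + (v * w + u * x - cc * (v * x)) * 'X_a)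
   = v * x * ('X_a * ('X_a + cc - 'X_b) + 'X_a * 'X_b).
  by move: u v w x ('X_a : P) ('X_b : P) cc => u v w x y z t; ring.
move=> /generatedD/(_ (_ : J (v * x * ('X_a * ('X_a + cc - 'X_b) + 'X_a * 'X_b)))).
rewrite -E addrA subrK; apply; rewrite E; apply: generatedM; apply: generatedD.
  by apply: generatedM; apply: fibXb.
exact: fibXab.
Qed.

(** The Chow ring of the bundle is free over that of the base on 1 and ['X_a], so a question about
    the bundle splits into two about the base. *)
Lemma fib_idealP p : J p <-> I (f0 p) /\ I (f1 p).
Proof.
split=> [/fib_ideal //|[H0 H1]]; apply: generated_subl (fib_decomp p) _.
by apply: generatedD; [|apply: generatedMr]; apply: fib_kill_ideal.
Qed.

Variable deg : {scalar P}.
(** Integration along the fibre followed by the degree of the base. *)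
Definition fib_deg : P -> R^o := deg \o f1.
HB.instance Definition _ := GRing.Linear.on fib_deg.

Hypothesis degP : forall p, p \is (cdim C).-homog -> deg p = 0 <-> I p.
Hypothesis deg_pos : forall A, A \in C -> #|A| = cdim C -> 0 < deg (mono R A).

Lemma fib_degP p : p \is (cdim D).-homog -> fib_deg p = 0 <-> J p.
Proof.
rewrite (cdim_bundle ab base) => hp; have h1 := dhomog_fib1 ab hcc hp.
rewrite fib_idealP /fib_deg /= degP //; split=> [H1|[]//]; split=> //.
by apply: (cideal_above_dim sC (ltnSn _)); exact: (dhomog_fib0 ab hcc hp).
Qed.

Lemma fib1Xa q : f1 q = 0 -> f1 ('X_a * q) = f0 q.
Proof. by move=> q0; rewrite fib1M fib1a fib0a q0 !mulr0 mul1r addr0 subr0. Qed.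

Lemma fib1Xb q : f1 q = 0 -> f1 ('X_b * q) = f0 q.
Proof. by move=> q0; rewrite fib1M fib1b // fib0b // q0 !mulr0 mul1r addr0 subr0. Qed.

Lemma fib_deg_Ua A : A \in C -> fib_deg (mono R (a |: A)) = deg (mono R A).
Proof.
move=> Ac; have [e0 e1] := fib_mono (aC Ac) (bC Ac).
by rewrite monoU1 ?aC // /fib_deg /= fib1Xa // e0.
Qed.

Lemma fib_deg_Ub A : A \in C -> fib_deg (mono R (b |: A)) = deg (mono R A).
Proof.
move=> Ac; have [e0 e1] := fib_mono (aC Ac) (bC Ac).
by rewrite monoU1 ?bC // /fib_deg /= fib1Xb // e0.
Qed.

Lemma fib_deg_pos B : B \in D -> #|B| = cdim D -> 0 < fib_deg (mono R B).
Proof.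
rewrite (cdim_bundle ab base) => /bconesP[Bc|A Ac ->|A Ac ->].
- by move: (cdim_ge Bc) => + e; rewrite e ltnn.
- by rewrite cardsU1 aC // => -[eA]; rewrite fib_deg_Ua // deg_pos.
- by rewrite cardsU1 bC // => -[eA]; rewrite fib_deg_Ub // deg_pos.
Qed.

Hypothesis wC : forall v, balanced C L (cdim C) v ->
  exists z, forall A, A \in C -> #|A| = cdim C -> v A = z * deg (mono R A).

(** On the cones [a |: A] a weight of the bundle is a weight of the base. Balancing at a top cone
    [A] of the base, tested with [twist c] minus a form of the base equal to [c] on [A], gives equal
    values on [a |: A] and [b |: A]. *)
Lemma fib_weights v : balanced D M (cdim D) v ->
  exists z, forall B, B \in D -> #|B| = cdim D -> v B = z * fib_deg (mono R B).
Proof.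
rewrite (cdim_bundle ab base) => bv; have [|z zP] := wC (v := fun A => v (a |: A)).
  move=> T Tc eT l [Ll lT].
  have := bv (a |: T) (bconesUa ab base Tc); rewrite cardsU1 aC // add1n eT.
  have l' : starl M (a |: T) l.
    split; first by exists 0, l => // i; rewrite mul0r add0r.
    by move=> i; rewrite !inE => /predU1P[->|/lT //]; apply: La.
  move=> /(_ erefl l l') E0; rewrite -[RHS]E0; apply: eq_big => [i|i _]; last by rewrite setUCA.
  have -> : (i |: T \in C) = (i |: T \in starc D [set a]) by rewrite (starc_bundle_a ab base).
  rewrite in_starc disjoint_sym disjoints1 !in_setU1 !negb_or (negPf (aC Tc)) andbT.
  have -> : i |: T :|: [set a] = i |: (a |: T) by rewrite -setUA (setUC T).
  by rewrite andbA [a == i]eq_sym [(i != a) && _]andbC.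
have vab A : A \in C -> #|A| = cdim C -> v (b |: A) = v (a |: A).
  move=> Ac eA.
  have [l Ll lA] := lin_interp sC c Ac.
  have l' : starl M A (fun i => twist a b c i - l i).
    split; last first.
      move=> i iA; rewrite twistN ?lA ?subrr //; first by apply: contraNneq (aC Ac) => <-.
      by apply: contraNneq (bC Ac) => <-.
    exists 1, (fun i => - l i) => [|i]; last by rewrite mul1r.
    by have := linZ sC (-1) Ll; under eq_fun do rewrite mulN1r.
  have := bv A (bconesC base Ac); rewrite eA => /(_ erefl _ l').
  have Pa : (a \notin A) && (a |: A \in D) by rewrite aC // (bconesUa ab base).
  have Pb : (b \notin A) && (b |: A \in D) && (b != a).
    by rewrite bC // (bconesUb ab base) //= eq_sym.
  rewrite (bigD1 a Pa) /= (bigD1 b Pb) /=.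
  rewrite big1 => [|i /andP[/andP[/andP[iA /bconesP[iC|A' A'C e|A' A'C e]] ia] ib]].
  - by rewrite twista twistb // (La Ll) (Lb Ll) !subr0 addr0 mulr1 mulrN1 => /subr0_eq.
  - by have := cdim_ge iC; rewrite cardsU1 iA eA ltnn.
  - by have := setU11 a A'; rewrite -e !inE eq_sym (negPf ia) (negPf (aC Ac)).
  - by have := setU11 b A'; rewrite -e !inE eq_sym (negPf ib) (negPf (bC Ac)).
exists z => B /bconesP[Bc|A Ac ->|A Ac ->].
- by move: (cdim_ge Bc) => + e; rewrite e ltnn.
- by rewrite cardsU1 aC // add1n => -[eA]; rewrite fib_deg_Ua // zP.
- by rewrite cardsU1 bC // add1n => -[eA]; rewrite fib_deg_Ub // vab // zP.
Qed.

Hypothesis pdC : pd_property I (cdim C) deg.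

(** Pairing with classes of the base detects [fib1 p]; pairing with ['X_a] times such classes
    detects [fib0 p - cc * fib1 p], hence [fib0 p] once [fib1 p] is zero. *)
Lemma fib_pd : pd_property J (cdim D) fib_deg.
Proof.
rewrite (cdim_bundle ab base) => k p le_k hp Hp.
have H1 : I (f1 p).
  case: k => [|k] in le_k hp Hp *; first by rewrite fib1_homog0 //; apply: generated0.
  apply: (pdC _ (dhomog_fib1 ab hcc hp)) => // q hq.
  have hm (u v : P) : u \is k.-homog -> v \is (cdim C - k).-homog -> u * v \is (cdim C).-homog.
    by move=> hu hv; apply: (dhomogMe hu hv); rewrite subnKC.
  have h1 := dhomog_fib1 ab hcc hp; have hk := dhomog_fib_kill hq.
  rewrite (deg_congr degP (q := f1 p * fib_kill q)) ?hm //; last first.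
    by rewrite -mulrBr; apply: generatedM; apply: fib_kill_congr.
  have : deg (f1 (p * fib_kill q)) = 0 by exact: Hp hk.
  by rewrite fib1M fib1_kill fib0_kill !mulr0 addr0 subr0.
apply/fib_idealP; split=> //; have h0 := dhomog_fib0 ab hcc hp.
move: le_k; rewrite leq_eqVlt ltnS => /predU1P[ek|le_k].
  by apply: (cideal_above_dim sC (ltnSn _)); rewrite -ek.
apply: (pdC _ h0) => // q hq; have hk := dhomog_fib_kill hq.
have hm (u v : P) : u \is k.-homog -> v \is (cdim C - k).-homog -> u * v \is (cdim C).-homog.
  by move=> hu hv; apply: (dhomogMe hu hv); rewrite subnKC.
rewrite (deg_congr degP (q := f0 p * fib_kill q)) ?hm //; last first.
  by rewrite -mulrBr; apply: generatedM; apply: fib_kill_congr.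
have hX : 'X_a * fib_kill q \is ((cdim C).+1 - k).-homog.
  by apply: (dhomogMe (dhomogXU _ a) hk); rewrite add1n subSn.
have : deg (f1 (p * ('X_a * fib_kill q))) = 0 by exact: Hp hX.
rewrite fib1M fib1Xa ?fib1_kill // fib0M fib0a mul0r mulr0 add0r.
rewrite fib0_kill raddfB /= => /eqP; rewrite subr_eq0 => /eqP ->.
have h1 : f1 p * fib_kill q \is (cdim C).-1.-homog \/ f1 p = 0.
  case: k hp {Hp h0 hm} le_k hq hk hX => [|k] hp le_k hq hk hX.
    by right; apply: fib1_homog0 hp.
  by left; apply: (dhomogMe (dhomog_fib1 ab hcc hp) hk); lia.
case: h1 => [h1|->]; last by rewrite mul0r mulr0 raddf0.
have [d0|d0] := posnP (cdim C).
  by move: le_k; rewrite d0 leqn0 => /eqP k0; rewrite k0 in hp; rewrite fib1_homog0 // mul0r mulr0 raddf0.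
apply/degP; last by apply: generatedM; apply: generatedMr.
by apply: (dhomogMe hcc h1); rewrite add1n prednK.
Qed.

End BundleChow.

(** * Convex functions on a bundle *)

Section Convexity.
Variables (R : realType) (n : nat).
Local Notation P := {mpoly R[n]}.
Local Notation ray := 'I_n.

Lemma convex_shift (C : {set {set ray}}) L (f k : ray -> R) :
  simplicial C L -> L k -> convex C L f -> convex C L (fun i => f i + k i).
Proof.
move=> sC Lk fC T /fC[m [Lm mf] mpos]; exists (fun i => m i + k i).
  by split=> [|i /mf ->] //; apply: (linD sC).
by move=> i iT iTC; have := mpos i iT iTC; rewrite opprD addrACA subrr addr0.
Qed.

Lemma convex_combine (C : {set {set ray}}) L (f g : ray -> R) s :
  simplicial C L -> 0 <= s <= 1 -> convex C L f -> convex C L g ->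
  convex C L (fun i => (1 - s) * f i + s * g i).
Proof.
move=> sC /andP[s0 s1] fC gC T TC.
have [m [Lm mf] mpos] := fC T TC; have [k [Lk kf] kpos] := gC T TC.
exists (fun i => (1 - s) * m i + s * k i).
  split; first exact: (linD sC (linZ sC _ Lm) (linZ sC _ Lk)).
  by move=> i iT; rewrite mf // kf.
move=> i iT iTC; have := mpos i iT iTC; have := kpos i iT iTC.
move: (f i) (m i) (g i) (k i) => x y z w wz yx.
have -> : (1 - s) * x + s * z - ((1 - s) * y + s * w) = (1 - s) * (x - y) + s * (z - w) by ring.
have [->|sn0] := eqVneq s 0; first by rewrite subr0 mul1r mul0r addr0.
have sp : 0 < s by rewrite lt_neqAle eq_sym sn0.
by apply: ltr_wpDl; [apply: mulr_ge0; lra|apply: mulr_gt0].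
Qed.

Variables (a b : ray) (ab : a != b).
Variables (C : {set {set ray}}) (L : (ray -> R) -> Prop) (base : bundle_base a b C L).
Let sC : simplicial C L. Proof. by case: base. Qed.
Let aC A : A \in C -> a \notin A. Proof. by case: base => _ H _ /H[]. Qed.
Let bC A : A \in C -> b \notin A. Proof. by case: base => _ H _ /H[]. Qed.
Let La l : L l -> l a = 0. Proof. by case: base => _ _ H /H[]. Qed.
Let Lb l : L l -> l b = 0. Proof. by case: base => _ _ H /H[]. Qed.

Lemma mem_twist (c : ray -> R) (T : {set ray}) i : T \in C -> i \in T -> twist a b c i = c i.
Proof.
move=> TC iT; apply: twistN; first by apply: contraNneq (aC TC) => <-.
by apply: contraNneq (bC TC) => <-.
Qed.

(** The functions [f] and [f - f a * c] are the restrictions of [f] to the stars at [b] and [a], and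
    [f a] is positive because a linear form takes opposite values at [a] and [b]. *)
Lemma convex_bundleW (c f : ray -> R) :
  f b = 0 -> convex (bcones a b C) (blin a b L c) f ->
  [/\ 0 < f a, convex C L f & convex C L (fun i => f i - f a * c i)].
Proof.
move=> fb fD; split.
- have [|m [[z [l Ll mE]] _] mpos] := fD set0; first exact/(bconesC base)/(face0 sC).
  have := mpos a; have := mpos b; rewrite !in_set0 !setU0 !(bcones_ray ab base) !eqxx orbT.
  rewrite !mE fb twista twistb // (La Ll) (Lb Ll) => /(_ isT isT) + /(_ isT isT).
  lra.
- move=> T TC; have [|m [[z [l Ll mE]] mf] mpos] := fD (b |: T).
    exact: (bconesUb ab base).
  have z0 : z = 0.
    have := mf b; rewrite setU11 mE twistb // (Lb Ll) fb => /(_ isT); lra.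
  have mE' i : m i = l i by rewrite mE z0 mul0r add0r.
  exists l => [|i iT iTC]; first by split=> // i iT; rewrite -mE' mf // inE iT orbT.
  rewrite -mE'; apply: mpos; last by rewrite setUCA; apply: (bconesUb ab base).
  by rewrite in_setU1 negb_or iT andbT; apply: contraNneq (bC iTC) => <-; rewrite setU11.
move=> T TC; have [|m [[z [l Ll mE]] mf] mpos] := fD (a |: T).
  exact: (bconesUa ab base).
have z0 : z = f a by have := mf a; rewrite setU11 mE twista (La Ll) => /(_ isT); lra.
exists l => [|i iT iTC].
  split=> // i iT; rewrite -mf ?inE ?iT ?orbT // mE z0 (mem_twist _ TC iT); ring.
have := mpos i; rewrite mE z0 (mem_twist _ iTC (setU11 _ _)) setUCA.
rewrite in_setU1 negb_or iT andbT (_ : i != a); last first.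
  by apply: contraNneq (aC iTC) => <-; rewrite setU11.
move=> /(_ isT (bconesUa ab base iTC)).
by move: (f i) (f a) (l i) (c i) => x y z' w; lra.
Qed.

(** At a cone containing [a] or [b] one of the two convexity assumptions applies directly. At a cone
    of the base, the mean of the two linear forms plus [f a / 2] times [twist c] leaves the positive
    value [f a / 2] at both [a] and [b]. *)
Lemma convex_bundle (c f : ray -> R) :
  f b = 0 -> 0 < f a -> convex C L f -> convex C L (fun i => f i - f a * c i) ->
  convex (bcones a b C) (blin a b L c) f.
Proof.
move=> fb fa fC gC B /bconesP[TC|T TC ->|T TC ->].
- have [l [Ll lf] lpos] := fC B TC; have [k [Lk kf] kpos] := gC B TC.
  exists (fun i => f a / 2 * twist a b c i + (l i / 2 + k i / 2)).
    split=> [|i iB]; last by rewrite lf // kf // (mem_twist _ TC iB); field.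
    exists (f a / 2), (fun i => l i / 2 + k i / 2) => //.
    have := linD sC (linZ sC 2^-1 Ll) (linZ sC 2^-1 Lk).
    by under eq_fun do rewrite ![2^-1 * _]mulrC.
  move=> i iB /bconesP[iC|A Ac e|A Ac e].
  + have := lpos i iB iC; have := kpos i iB iC; rewrite (mem_twist _ iC (setU11 _ _)).
    by move: (f i) (f a) (l i) (c i) (k i) => x y z w v; lra.
  + have -> : i = a.
      have := setU11 a A; rewrite -e !inE (negPf (aC TC)) orbF => /eqP-> //.
    by rewrite twista (La Ll) (La Lk); move: fa; move: (f a) => x; lra.
  have -> : i = b.
    have := setU11 b A; rewrite -e !inE (negPf (bC TC)) orbF => /eqP-> //.
  by rewrite twistb // (Lb Ll) (Lb Lk) fb; move: fa; move: (f a) => x; lra.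
- have [k [Lk kf] kpos] := gC T TC.
  exists (fun i => f a * twist a b c i + k i).
    split=> [|i]; first by exists (f a), k.
    rewrite !inE => /predU1P[->|iT]; first by rewrite twista (La Lk) mulr1 addr0.
    by rewrite kf // (mem_twist _ TC iT); ring.
  move=> i; rewrite in_setU1 negb_or => /andP[ia iT].
  have [->|ib] := eqVneq i b; first by rewrite !inE !eqxx orbT /= andbF.
  move=> iaT; rewrite twistN //.
  have iTC : i |: T \in C.
    have := face_sub (simplicial_bundle ab base c) iaT (setUS [set i] (subsetUr [set a] T)).
    move=> /bconesP[//|A _ e|A _ e].
      by have := setU11 a A; rewrite -e !inE eq_sym (negPf ia) (negPf (aC TC)).
    by have := setU11 b A; rewrite -e !inE eq_sym (negPf ib) (negPf (bC TC)).
  by have := kpos i iT iTC; move: (f i) (f a) (k i) (c i) => x y z w; lra.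
have [l [Ll lf] lpos] := fC T TC.
exists l; first split.
- by exists 0, l => // i; rewrite mul0r add0r.
- by move=> i; rewrite !inE => /predU1P[->|/lf //]; rewrite (Lb Ll) fb.
move=> i; rewrite in_setU1 negb_or => /andP[ib iT].
have [->|ia] := eqVneq i a; first by rewrite !inE !eqxx orbT /= andbF.
move=> ibT; apply: lpos => //.
have := face_sub (simplicial_bundle ab base c) ibT (setUS [set i] (subsetUr [set b] T)).
move=> /bconesP[//|A _ e|A _ e].
  by have := setU11 a A; rewrite -e !inE eq_sym (negPf ia) (negPf (aC TC)).
by have := setU11 b A; rewrite -e !inE eq_sym (negPf ib) (negPf (bC TC)).
Qed.

End Convexity.

(** * Hodge-Riemann relations for bundles *)

Section BundleBasis.
Variables (R : realType) (n : nat).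
Local Notation P := {mpoly R[n]}.
Local Notation ray := 'I_n.
Variables (a b : ray) (ab : a != b).
Variables (C : {set {set ray}}) (L : (ray -> R) -> Prop) (base : bundle_base a b C L).
Let sC : simplicial C L. Proof. by case: base. Qed.
Let aC A : A \in C -> a \notin A. Proof. by case: base => _ H _ /H[]. Qed.
Let bC A : A \in C -> b \notin A. Proof. by case: base => _ H _ /H[]. Qed.

(* Homogeneous of degree k - 1, which for k = 0 leaves only the zero polynomial. *)
Definition homog_pred k (p : P) : Prop := if k is k'.+1 then p \is k'.-homog else p = 0.

Lemma face_basis_pred k : exists N (e : 'I_N -> P),
  [/\ forall q, homog_pred k q -> exists x, cideal C L (q - comb e x),
      indep (crel C L) e &
      forall i, exists A, [/\ A \in C, #|A|.+1 = k & e i = mono R A]].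
Proof.
case: k => [|k]; last first.
  have [N [e [se ie eA]]] := face_basis k sC; exists N, e; split=> // i.
  by have [A [Ac <- ->]] := eA i; exists A.
exists 0%N, (fun=> 0); split=> [q ->|x _|[]//]; last exact: thinmx0.
by exists 0; rewrite /comb big_ord0 subrr; apply: generated0.
Qed.

Lemma comb_split N1 N2 (e1 : 'I_N1 -> P) (e2 : 'I_N2 -> P) x :
  comb (fun i => match split i with inl j => e1 j | inr j => e2 j end) x =
  comb e1 (lsubmx x) + comb e2 (rsubmx x).
Proof.
rewrite /comb big_split_ord /=; congr (_ + _); apply: eq_bigr => i _; rewrite mxE.
  by rewrite (unsplitK (inl i : 'I_N1 + 'I_N2)%type).
by rewrite (unsplitK (inr i : 'I_N1 + 'I_N2)%type).
Qed.

(** The family depends on the base alone: a basis of cone monomials in degree [k], and ['X_a] times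
    one in degree [k - 1]. Since it serves for all twists, Gram matrices of different twists can be
    compared. *)
Lemma bundle_basis k : exists N (e : 'I_N -> P),
  (forall i, e i \is k.-homog) /\
  forall c, spans (crel (bcones a b C) (blin a b L c)) k e /\
            indep (crel (bcones a b C) (blin a b L c)) e.
Proof.
have [N1 [e1 [s1 i1 A1]]] := face_basis k sC.
have [N2 [e2 [s2 i2 A2]]] := face_basis_pred k.
exists (N1 + N2)%N, (fun i => match split i with inl j => e1 j | inr j => 'X_a * e2 j end).
split=> [i|c].
  case: (split i) => j; first by have [A [_ <- ->]] := A1 j; apply: dhomog_mono.
  have [A [_ eA ->]] := A2 j.
  by apply: (dhomogMe (dhomogXU _ a) (dhomog_mono R A)); rewrite add1n.
have hcc := dhomog_plf C c.
have fib1_0' N (e : 'I_N -> P) x : (forall i, exists2 A, A \in C & e i = mono R A) ->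
  fib0 a b (plf C c) (comb e x) = comb e x /\ fib1 a b (plf C c) (comb e x) = 0.
  move=> eA; rewrite /comb; split.
    rewrite raddf_sum; apply: eq_bigr => i _; rewrite /= fib0Z.
    have [A Ac ->] := eA i.
    by have [-> _] := fib_mono C c (aC Ac) (bC Ac).
  rewrite raddf_sum big1 // => i _; rewrite /= fib1Z.
  have [A Ac ->] := eA i.
  by have [_ ->] := fib_mono C c (aC Ac) (bC Ac); rewrite scaler0.
have A1' i : exists2 A, A \in C & e1 i = mono R A by have [A []] := A1 i; exists A.
have A2' i : exists2 A, A \in C & e2 i = mono R A by have [A []] := A2 i; exists A.
have Xcomb x : comb (fun j => 'X_a * e2 j) x = 'X_a * comb e2 x.
  by rewrite /comb mulr_sumr; apply: eq_bigr => i _; rewrite scalerAr.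
have fibE x y : fib0 a b (plf C c) (comb e1 x + 'X_a * comb e2 y) = comb e1 x /\
    fib1 a b (plf C c) (comb e1 x + 'X_a * comb e2 y) = comb e2 y.
  have [x0 x1] := fib1_0' _ e1 x A1'; have [y0 y1] := fib1_0' _ e2 y A2'.
  rewrite fib0D fib0M fib0a mul0r addr0 x0 fib1D x1 add0r; split=> //.
  by rewrite (fib1Xa y1) y0.
split=> [p hp|x].
  have [x Ix] := s1 _ (dhomog_fib0 ab hcc hp).
  have [|y Iy] := s2 (fib1 a b (plf C c) p).
    case: k hp {s1 s2 A1 A2} => [|k] hp; first exact: fib1_homog0.
    exact: (dhomog_fib1 ab hcc hp).
  exists (row_mx x y); rewrite comb_split row_mxKl row_mxKr Xcomb.
  apply/(fib_idealP ab base c); have [e0 e1'] := fibE x y.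
  by rewrite fib0B fib1B e0 e1'.
rewrite comb_split Xcomb => /(fib_idealP ab base c); have [-> ->] := fibE (lsubmx x) (rsubmx x).
by move=> [/i1 x1 /i2 x2]; rewrite -[x]hsubmxK x1 x2 row_mx0.
Qed.

End BundleBasis.

(** * Hodge-Riemann relations for the product with a projective line *)

Section Untwisted.
Variables (R : realType) (n : nat).
Local Notation P := {mpoly R[n]}.
Variables (rel : P -> Prop) (d : nat) (deg : {scalar P}) (l : P).
Hypothesis degP : forall p, p \is d.-homog -> deg p = 0 <-> generated rel p.
Hypothesis hl : l \is 1.-homog.
Hypothesis hr : hr_property (generated rel) d deg l.

(* The product of a fan with the fan of the projective line: with
   [q = - be / ((m + 1) t)] and [al0 = al - l q], the class [al + be x] splits
   into the primitive classes [al0] and [q]. *)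
Lemma hr_untwisted k m t (al be : P) :
  (m + k + k)%N = d.+1 -> 0 < t -> al \is k.-homog -> homog_pred k be ->
  generated rel (l ^+ m.+1 * al) ->
  generated rel (l ^+ m.+1 * be + (m.+1%:R * t) *: (l ^+ m * al)) ->
  ~ (generated rel al /\ generated rel be) ->
  0 < (-1) ^+ k * deg (l ^+ m * al * be *+ 2 + (m%:R * t) *: (l ^+ m.-1 * al * al)).
Proof.
move=> ed t0 hal hbe I1 I2 nI.
pose z : R := m.+1%:R * t; have z0 : 0 < z by rewrite mulr_gt0 // ltr0Sn.
have zn0 : z != 0 by rewrite gt_eqF.
pose q := - z^-1 *: be; pose al0 := al - l * q.
have hq : homog_pred k q.
  case: (k) hbe => [be0|k' h] /=; rewrite /q; first by rewrite be0 scaler0.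
  by rewrite dhomogZ.
have beE : be = - z *: q by rewrite /q scalerA mulrNN divff // scale1r.
have alE : al = al0 + l * q by rewrite subrK.
have hlq : l * q \is k.-homog.
  case: k hq {hal hbe nI ed} => [->|k hq]; first by rewrite mulr0 dhomog0.
  by apply: (dhomogMe hl hq); rewrite add1n.
have hal0 : al0 \is k.-homog by apply: dhomogB.
(* Since [m = d + 1 - 2 k], this says that [al0] is primitive in degree [k] of the base, and [J2]
   that [q] is primitive in degree [k - 1]. *)
have J1 : generated rel (l ^+ m * al0).
  have -> : l ^+ m * al0 = z^-1 *: (l ^+ m.+1 * be + z *: (l ^+ m * al)).
    rewrite beE -scalerAr scalerDr !scalerA mulrN mulVf // scaleN1r scale1r /al0.
    by rewrite mulrBr mulrA -exprSr addrC.
  exact: generatedZ.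
have J2 : generated rel (l ^+ m.+2 * q).
  have -> : l ^+ m.+2 * q = l ^+ m.+1 * al - l * (l ^+ m * al0).
    by rewrite /al0 !exprS; move: (l ^+ m) => u; ring.
  by apply: generatedB => //; apply: generatedM.
have hpq k' (p p' : P) : p \is k.-homog -> homog_pred k' p' -> (m + k + k' = d.+1)%N ->
    l ^+ m * p * p' \is d.-homog.
  move=> hp; case: k' => [->|k'] => [_|hp' e]; first by rewrite mulr0 dhomog0.
  by apply: (dhomogMe (dhomogM (dhomogXe hl erefl) hp) hp'); lia.
have deg0 : deg (l ^+ m * al0 * q) = 0.
  by apply/degP; [exact: hpq hq ed|exact: generatedMr].
(* The cross term is [deg0]. The coefficient of the square of [q] is [m - 2 (m + 1) = - (m + 2)]
   times [t]; its sign makes up for the change of [(-1) ^+ k] between degrees [k] and [k - 1]. *)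
have E : deg (l ^+ m * al * be *+ 2 + (m%:R * t) *: (l ^+ m.-1 * al * al)) =
  m%:R * t * deg (l ^+ m.-1 * al0 * al0) - m.+2%:R * t * deg (l ^+ m.+1 * q * q).
  have -> : l ^+ m * al * be *+ 2 + (m%:R * t) *: (l ^+ m.-1 * al * al) =
      (m%:R * t) *: (l ^+ m.-1 * al0 * al0) - (m.+2%:R * t) *: (l ^+ m.+1 * q * q)
      - (2 * t) *: (l ^+ m * al0 * q).
    rewrite beE alE -!mul_mpolyC mpolyCN /z !rmorphM /= !rmorph_nat.
    case: (m) => [|m'] /=; rewrite ?expr0 ?expr1 -?natr1 ?exprS; first by ring.
    by move: (l ^+ m') (t%:MP) (m'%:R : P) => u T M; ring.
  by rewrite !raddfB /= !linearZ /= deg0 mulr0 subr0.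
have A0 : 0 <= (-1) ^+ k * (m%:R * t * deg (l ^+ m.-1 * al0 * al0)) /\
    (~ generated rel al0 -> 0 < (-1) ^+ k * (m%:R * t * deg (l ^+ m.-1 * al0 * al0))).
  (* For [m = 0] the degree [k] exceeds half of [d], and [J1] already puts [al0] in the ideal. *)
  have [m0|m0] := posnP m.
    by rewrite m0 !mul0r mulr0; split=> // []; move: J1; rewrite m0 mul1r.
  have [I0|nI0] := pselect (generated rel al0).
    split=> //; rewrite (degP _).2 ?mulr0 //; last exact: generatedM.
    by apply: (dhomogMe (dhomogM (dhomogXe hl erefl) hal0) hal0); lia.
  have k2 : (k.*2 <= d)%N by rewrite -addnn; lia.
  have := hr k2 hal0; have -> : (d - k.*2 = m.-1)%N by rewrite -addnn; lia.
  rewrite prednK // => /(_ J1 nI0) pos.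
  have mt : 0 < m%:R * t by rewrite mulr_gt0 // ltr0n.
  by rewrite mulrCA; split=> [|_]; [apply: ltW|]; exact: mulr_gt0 mt pos.
have Q0 : 0 <= - ((-1) ^+ k * (m.+2%:R * t * deg (l ^+ m.+1 * q * q))) /\
    (~ generated rel q -> 0 < - ((-1) ^+ k * (m.+2%:R * t * deg (l ^+ m.+1 * q * q)))).
  have [Iq|nIq] := pselect (generated rel q).
    split=> //; rewrite (_ : deg _ = 0) ?mulr0 ?oppr0 //.
    case: (k) hq ed => [->|k'] => [_|hq' e]; first by rewrite !mulr0 raddf0.
    apply/degP; last exact: generatedM.
    by apply: (dhomogMe (dhomogM (dhomogXe hl erefl) hq') hq'); lia.
  case: (k) hq ed => [q0|k' hq' e]; first by case: nIq; rewrite q0; apply: generated0.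
  have k2 : (k'.*2 <= d)%N by rewrite -addnn; lia.
  have := hr k2 hq'; have -> : (d - k'.*2 = m.+1)%N by rewrite -addnn; lia.
  move=> /(_ J2 nIq) pos; rewrite exprS mulN1r mulNr opprK mulrCA.
  have mt : 0 < m.+2%:R * t by rewrite mulr_gt0 // ltr0n.
  by split=> [|_]; [apply: ltW|]; exact: mulr_gt0 mt pos.
rewrite E mulrBr; have [I0|nI0] := pselect (generated rel al0); last first.
  by apply: ltr_pwDl; [exact: A0.2|exact: Q0.1].
apply: ltr_wpDl; first exact: A0.1.
apply: Q0.2 => Iq; apply: nI; split.
  by rewrite alE; apply: generatedD => //; apply: generatedM.
by rewrite beE; apply: generatedZ.
Qed.

End Untwisted.

Section Congruence.
Variables (R : realType) (n : nat).
Local Notation P := {mpoly R[n]}.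
Variables (rel : P -> Prop) (d : nat) (deg : {scalar P}) (l l' : P).
Hypothesis degP : forall p, p \is d.-homog -> deg p = 0 <-> generated rel p.
Hypotheses (hl : l \is 1.-homog) (hl' : l' \is 1.-homog) (ll' : generated rel (l - l')).

Lemma hl_congr : hl_property (generated rel) d l -> hl_property (generated rel) d l'.
Proof.
move=> H k le_k; have [inj surj] := H k le_k.
have E (p : P) : generated rel (l ^+ (d - k.*2) * p - l' ^+ (d - k.*2) * p).
  by rewrite -mulrBl; apply: generatedMr; apply: generated_congrX.
split=> [p hp Hp|q hq]; first by apply: inj => //; apply: generated_subl (E p) Hp.
have [p hp Hp] := surj q hq; exists p => //.
have -> : q - l' ^+ (d - k.*2) * p =
  (q - l ^+ (d - k.*2) * p) + (l ^+ (d - k.*2) * p - l' ^+ (d - k.*2) * p) by rewrite addrA subrK.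
exact: generatedD.
Qed.

Lemma hr_congr : hr_property (generated rel) d deg l -> hr_property (generated rel) d deg l'.
Proof.
move=> H k p le_k hp Hp nIp.
have E j : generated rel (l ^+ j * p - l' ^+ j * p).
  by rewrite -mulrBl; apply: generatedMr; apply: generated_congrX.
have := H k p le_k hp (generated_subl (E _) Hp) nIp.
have hX (u : P) : u \is 1.-homog -> u ^+ (d - k.*2) * p * p \is d.-homog.
  move=> hu; apply: (dhomogMe (dhomogM (dhomogXe hu erefl) hp) hp).
  by move: le_k; rewrite -addnn; lia.
rewrite (deg_congr degP (hX _ hl) (hX _ hl')) // -mulrBl.
by apply: generatedMr; apply: E.
Qed.

End Congruence.

(** * Kahler property of bundles *)

Section BundleKahler.
Variables (R : realType) (n : nat).
Local Notation P := {mpoly R[n]}.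
Local Notation ray := 'I_n.
Variables (a b : ray) (ab : a != b).

Section Step.
Variables (C : {set {set ray}}) (L : (ray -> R) -> Prop) (base : bundle_base a b C L).
Let sC : simplicial C L. Proof. by case: base. Qed.
Local Notation D := (bcones a b C).
Local Notation J c := (cideal D (blin a b L c)).

Definition scaled (c : ray -> R) (s : R) : ray -> R := fun i => s * c i.

(** The twist enters the product rule [fib1M] only through [cc], which is [s] times a fixed
    class. *)
Lemma fib_polynomial c p :
  (exists G : {poly P}, forall s, fib0 a b (plf C (scaled c s)) p = G.[s%:MP]) /\
  (exists G : {poly P}, forall s, fib1 a b (plf C (scaled c s)) p = G.[s%:MP]).
Proof.
have plfE s : plf C (scaled c s) = s%:MP * plf C c.
  rewrite mul_mpolyC /plf scaler_sumr; apply: eq_bigr => i _.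
  by rewrite scalerA.
elim/mpoly_ring_ind: p => [z|i|p q [[G0 E0] [G1 E1]] [[H0 F0] [H1 F1]]|
    p q [[G0 E0] [G1 E1]] [[H0 F0] [H1 F1]]].
- split; [exists (z%:MP)%:P|exists 0] => s; first by rewrite fib0C hornerC.
  by rewrite fib1C horner0.
- have [->|ia] := eqVneq i a.
    split; [exists 0|exists 1] => s; first by rewrite fib0a horner0.
    by rewrite fib1a hornerC.
  have [->|ib] := eqVneq i b.
    split; [exists ('X * (plf C c)%:P)|exists 1] => s; last by rewrite fib1b // hornerC.
    by rewrite fib0b // hornerM hornerX hornerC plfE.
  split; [exists ('X_i)%:P|exists 0] => s; first by rewrite fib0N // hornerC.
  by rewrite fib1N // horner0.
- split; [exists (G0 + H0)|exists (G1 + H1)] => s; first by rewrite fib0D hornerD E0 F0.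
  by rewrite fib1D hornerD E1 F1.
split; [exists (G0 * H0)|exists (G1 * H0 + G0 * H1 - 'X * (plf C c)%:P * (G1 * H1))] => s.
  by rewrite fib0M hornerM E0 F0.
by rewrite fib1M hornerD hornerN hornerD !hornerM hornerX hornerC E0 F0 E1 F1 plfE.
Qed.

Lemma fib_deg_polynomial c (deg : {scalar P}) p :
  exists g : {poly R}, forall s, fib_deg a b C (scaled c s) deg p = g.[s].
Proof.
have [_ [G GE]] := fib_polynomial c p; exists (\poly_(i < size G) deg G`_i) => s.
rewrite /fib_deg /= GE horner_coef raddf_sum horner_poly; apply: eq_bigr => i _.
by rewrite /= -rmorphXn mulrC mul_mpolyC linearZ /= mulrC.
Qed.

Hypothesis kC : kahler C L.
Hypothesis kD : forall c i, [set i] \in C ->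
  kahler (starc D [set i]) (starl (blin a b L c) [set i]).

(** The assumption on ray stars is made for all twists, because hard Lefschetz is needed at every
    point of the path [scaled c s]. *)
Lemma kahler_bundle_step c : kahler D (blin a b L c).
Proof.
have [deg [degP deg_pos wC pdC HC]] := kC.
pose degB c' : {scalar P} := fib_deg a b C c' deg.
have degBP c' := fib_degP ab base c' degP.
have pdB c' : pd_property (J c') (cdim D) (degB c') := fib_pd ab base degP pdC.
have inj c' f k (p : P) : convex D (blin a b L c') f -> (k.*2 <= cdim D)%N -> p \is k.-homog ->
    J c' (plf D f ^+ (cdim D - k.*2) * p) -> J c' p.
  apply: (hl_injective (simplicial_bundle ab base c') (degBP c')
    (fib_deg_pos ab base c' deg_pos) (pdB c')).
  move=> i; rewrite (bcones_ray ab base) => /or3P[/eqP->|/eqP->|iC].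
  - by rewrite (starc_bundle_a ab base) (starl_bundle_a base).
  - by rewrite (starc_bundle_b ab base) (starl_bundle_b ab base).
  - exact: kD.
exists (degB c); split.
- exact: degBP.
- exact: (fib_deg_pos ab base c deg_pos).
- exact: (fib_weights ab base wC).
- exact: pdB.
(* A multiple of the linear form [twist c] makes the function vanish at [b] without changing its
   class. *)
move=> f0 f0D; pose f i := f0 i + f0 b * twist a b c i.
have twL : blin a b L c (fun i => f0 b * twist a b c i).
  by exists (f0 b), (fun=> 0) => [|i]; [apply: (lin0 sC)|rewrite addr0].
have fD : convex D (blin a b L c) f := convex_shift (simplicial_bundle ab base c) twL f0D.
have fb : f b = 0 by rewrite /f twistb // mulrN1 subrr.
suff [HL HR] : hl_property (J c) (cdim D) (plf D f) /\
    hr_property (J c) (cdim D) (degB c) (plf D f).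
  have ff0 : J c (plf D f - plf D f0).
    have -> : plf D f - plf D f0 = plf D (fun i => f0 b * twist a b c i).
      by rewrite /plf -sumrB; apply: eq_bigr => i _; rewrite -scalerBl /f addrAC subrr add0r.
    exact: cideal_lin.
  split; first exact: hl_congr ff0 HL.
  exact: hr_congr (degBP c) (dhomog_plf _ _) (dhomog_plf _ _) ff0 HR.
have [fa fC gC] := convex_bundleW ab base fb fD.
set l := plf D f; have hl : l \is 1.-homog := dhomog_plf D f.
(* [f - f a * (s * c)] is the combination of [f] and [f - f a * c] with weights [1 - s] and [s]. *)
have fs s : 0 <= s <= 1 -> convex D (blin a b L (scaled c s)) f.
  move=> s01; apply: (convex_bundle ab base fb fa fC).
  have := convex_combine sC s01 fC gC; congr (convex C L _); apply/funext => i.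
  by rewrite /scaled; ring.
have eD := cdim_bundle ab base.
split=> [k le_k|k p le_k hp Hp nIp].
  split=> [p|]; first exact: (inj c f k p fD le_k).
  have [N [e [eh /(_ c)[es ei]]]] := bundle_basis ab base k.
  apply: (hl_surjective (degBP c) (pdB c) hl le_k _ eh es ei) => p.
  exact: (inj c f k p fD le_k).
have [N [e [eh eP]]] := bundle_basis ab base k.
have c1 : scaled c 1 = c by apply/funext => i; rewrite /scaled mul1r.
(* [e'] is a basis in degree [k - 1], so that by duality primitivity is orthogonality to all
   [l * e' j]. Their Gram matrix is that of [e'] with two more factors [l], invertible by hard
   Lefschetz in degree [k - 1]. For [k = 0] the family is empty. *)
have [r [e' [eh' eP' K1 K0]]] : exists r (e' : 'I_r -> P),
   [/\ forall j, l * e' j \is k.-homog,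
       forall s, 0 <= s <= 1 -> gram (degB (scaled c s)) l (cdim D - k.*2)
          (fun j => l * e' j) (fun j => l * e' j) \in unitmx,
       (forall j, J c (l ^+ (cdim D - k.*2).+1 * p) ->
          degB c (l ^+ (cdim D - k.*2) * p * (l * e' j)) = 0) &
       forall p : P, p \is k.-homog ->
         (forall j, degB (scaled c 0) (l ^+ (cdim D - k.*2) * p * (l * e' j)) = 0) ->
         J (scaled c 0) (l ^+ (cdim D - k.*2).+1 * p)].
  case: k le_k hp {N e eh eP Hp} => [|k] le_k hp.
    exists 0%N, (fun=> 0); split=> [[]//|s _|[]//|p' hp' _].
      by rewrite unitmxE det_mx00 unitr1.
    apply: (cideal_above_dim (simplicial_bundle ab base _) (ltnSn _)).
    by apply: (dhomogMe (dhomogXe hl erefl) hp'); rewrite addn0 subn0.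
  have [r [e' [eh' eP']]] := bundle_basis ab base k.
  have le_k' : (k.*2 <= cdim D)%N by move: le_k; rewrite -!addnn; lia.
  have em : (cdim D - k.*2 = (cdim D - k.+1.*2).+2)%N by move: le_k; rewrite -!addnn; lia.
  exists r, e'; split=> [j|s s01|j HJ|p' hp' H0].
  - by apply: (dhomogMe hl (eh' j)).
  - have [es ei] := eP' (scaled c s).
    have := gram_unit (degBP (scaled c s)) (pdB _) hl le_k' _ eh' es ei.
    move=> /(_ (fun p' => inj _ f k p' (fs s s01) le_k')); rewrite em.
    congr (_ \in unitmx); apply/matrixP => i j; rewrite !mxE; congr (degB _ _).
    by rewrite !exprS; move: (l ^+ _) => u; ring.
  - apply/degBP; last first.
      have -> : l ^+ (cdim D - k.+1.*2) * p * (l * e' j) = l ^+ (cdim D - k.+1.*2).+1 * p * e' j.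
        by rewrite exprSr; move: (l ^+ _) => u; ring.
      exact: generatedMr.
    apply: (dhomogMe (dhomogM (dhomogXe hl erefl) hp) (dhomogMe hl (eh' j) erefl)).
    by move: le_k; rewrite -!addnn; lia.
  have [es ei] := eP' (scaled c 0).
  apply: (spans_pd (degBP _) (pdB _) hl le_k' eh' es) => [|j].
    by apply: (dhomogMe (dhomogXe hl erefl) hp'); move: le_k; rewrite -!addnn; lia.
  rewrite -[RHS](H0 j); congr (degB _ _).
  by rewrite exprSr; move: (l ^+ _) => u; ring.
have em : (cdim D - k.*2 + k + k = cdim D)%N by move: le_k; rewrite -addnn; lia.
have sg0 : (-1) ^+ k != 0 :> R by rewrite signr_eq0.
have := @hr_path R n (fun s => crel D (blin a b L (scaled c s))) (fun s => degB (scaled c s))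
  (cdim D) (cdim D - k.*2) k l N e r e' ((-1) ^+ k) hl em sg0 eh eh'
  (fib_deg_polynomial c deg).
rewrite /= c1; apply=> //; last 1 first.
- by move=> j; apply: K1.
- move=> s s01; have [es ei] := eP (scaled c s); split=> //.
  + exact: degBP.
  + apply: (gram_unit (degBP _) (pdB _) hl le_k _ eh es ei) => p'.
    exact: (inj _ f k p' (fs s s01) le_k).
  + exact: eP'.
(* What remains is the twist 0. There [cc] is zero, so [F1] obeys the Leibniz rule over [F0], and
   [l ^+ j] has the components [plf C f ^+ j] and [j%:R * f a] times [plf C f ^+ j.-1]. *)
move=> p' hp' H0 nIp'.
have hcc := dhomog_plf C (scaled c 0).
have cc0 : plf C (scaled c 0) = 0.
  by rewrite /plf big1 // => i _; rewrite /scaled mul0r scale0r.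
set m := (cdim D - k.*2)%N in em H0 *.
have I0 := K0 p' hp' H0; rewrite -/m in I0.
pose F0 := fib0 a b (plf C (scaled c 0)); pose F1 := fib1 a b (plf C (scaled c 0)).
have lE : l = f a *: 'X_a + plf C f by rewrite /l (plf_bundle ab base) fb scale0r addr0.
have F0l j : F0 (l ^+ j) = plf C f ^+ j.
  by rewrite /F0 fib0X lE fib0D fib0Z fib0a scaler0 add0r (fib0_plf base).
have F1M u v : F1 (u * v) = F1 u * F0 v + F0 u * F1 v.
  rewrite /F1 fib1M [X in _ - X](_ : _ = 0) ?subr0 //.
  by rewrite [X in X * _]cc0 mul0r.
have F1l j : F1 (l ^+ j) = (j%:R * f a) *: plf C f ^+ j.-1.
  elim: j => [|j IHj]; first by rewrite expr0 -mpolyC1 /F1 fib1C mul0r scale0r.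
  rewrite exprS F1M IHj F0l.
  have -> : F1 l = (f a)%:MP.
    by rewrite /F1 lE fib1D fib1Z fib1a (fib1_plf base) addr0 -mul_mpolyC mulr1.
  have -> : F0 l = plf C f by have := F0l 1%N; rewrite !expr1.
  rewrite -!mul_mpolyC rmorphM /= [in RHS]rmorphM /= !rmorph_nat -natr1.
  case: j {IHj} => [|j] /=; first by rewrite !expr0; ring.
  by rewrite exprS; move: (plf C f) (plf C f ^+ j) => u v; ring.
have al := dhomog_fib0 ab hcc hp'.
have be : homog_pred k (F1 p').
  case: k hp' {Hp hp le_k e eh eP e' eh' eP' K1 K0 H0 em sg0 al I0 m} => [|k] hp'.
    exact: fib1_homog0.
  exact: (dhomog_fib1 ab hcc hp').
have := fib_idealP ab base (scaled c 0) (l ^+ m.+1 * p').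
move=> [/(_ I0)[I1 I2] _]; rewrite fib0M -/F0 F0l in I1.
rewrite -/F1 F1M F0l F1l /= in I2.
have := hr_untwisted degP (dhomog_plf C f) (HC f fC).2 _ fa al be I1.
have -> : degB (scaled c 0) (l ^+ m * p' * p') =
   deg (plf C f ^+ m * fib0 a b (plf C (scaled c 0)) p' * F1 p' *+ 2 +
     (m%:R * f a) *: (plf C f ^+ m.-1 * fib0 a b (plf C (scaled c 0)) p' *
        fib0 a b (plf C (scaled c 0)) p')).
  rewrite [LHS]/(deg (F1 _)) !F1M [F0 (_ * _)]fib0M -/F0 F0l F1l; congr (deg _).
  by rewrite -!scalerAl mulrDl -!scalerAl; move: (plf C f ^+ m) (_ *: _) => u v; ring.
apply; first by rewrite em.
  by rewrite addrC scalerAl.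
by move=> /(fib_idealP ab base (scaled c 0) p').
Qed.

End Step.

(** Induction on the number of cones of the base, over all twists: the star at a ray [i] of the base
    is a bundle over the star of [i] in [C], whose stars are stars of [C]. *)
Theorem kahler_bundle (C : {set {set ray}}) (L : (ray -> R) -> Prop) (c : ray -> R) : bundle_base a b C L ->
  (forall T, T \in C -> kahler (starc C T) (starl L T)) ->
  kahler (bcones a b C) (blin a b L c).
Proof.
have [N] := ubnP #|C|; elim: N => // N IHN in C L c *.
move=> lt_N base H; have [sC aC _] := base; apply: kahler_bundle_step => //.
  by have := H set0 (face0 sC); rewrite starc0 starl0.
move=> c' i iC; have [m Lm mc] := lin_interp sC c' iC.
rewrite (starc_bundle base iC) (starl_bundle ab base iC Lm mc).
apply: IHN; last 1 first.
- move=> T TC; have := TC; rewrite in_starc => /andP[_ TiC].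
  by rewrite starc_starc // starl_starl; apply: H; rewrite setUC.
- rewrite ltnS in lt_N; apply: leq_trans lt_N; apply: proper_card; apply/properP; split.
    apply/subsetP => B; rewrite in_starc => /andP[_ /(face_sub sC)]; apply.
    exact: subsetUl.
  by exists [set i] => //; rewrite in_starc disjoints1 inE eqxx.
- exact: (base_star base iC).
Qed.

End BundleKahler.

(** * Isomorphisms up to rescaling *)

(* An isomorphism of fans up to rescaling of the generators: the ray i is
   matched with g i, whose generator is r i times that of i. *)
Record fan_iso (R : realType) n m (C : {set {set 'I_n}}) (L : ('I_n -> R) -> Prop)
    (C' : {set {set 'I_m}}) (L' : ('I_m -> R) -> Prop)
    (g : 'I_n -> 'I_m) (h : 'I_m -> 'I_n) (r : 'I_n -> R) (r' : 'I_m -> R) : Prop := FanIso {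
  iso_gK : forall i, [set i] \in C -> h (g i) = i;
  iso_hK : forall j, [set j] \in C' -> g (h j) = j;
  iso_g : forall A : {set 'I_n}, A \in C -> g @: A \in C';
  iso_h : forall A : {set 'I_m}, A \in C' -> h @: A \in C;
  iso_r : forall i, [set i] \in C -> 0 < r i;
  iso_r' : forall j, [set j] \in C' -> 0 < r' j;
  iso_rr' : forall i, [set i] \in C -> r i * r' (g i) = 1;
  iso_L : forall l, L l -> exists2 l', L' l' & forall i, [set i] \in C -> l' (g i) = r i * l i;
  iso_L' : forall l', L' l' -> exists2 l, L l & forall j, [set j] \in C' -> l (h j) = r' j * l' j }.

Lemma fan_iso_sym (R : realType) n m (C : {set {set 'I_n}}) (L : ('I_n -> R) -> Prop)
    (C' : {set {set 'I_m}}) (L' : ('I_m -> R) -> Prop) g h r r' :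
  fan_iso C L C' L' g h r r' -> fan_iso C' L' C L h g r' r.
Proof.
case=> gK hK Hg Hh Hr Hr' rr' HL HL'; split=> // j jC.
have hC : [set h j] \in C by rewrite -imset_set1; apply: Hh.
by rewrite mulrC -{2}(hK j jC) rr'.
Qed.

Section IsoMap.
Variables (R : realType) (n m : nat).
Local Notation P := {mpoly R[n]}.
Local Notation P' := {mpoly R[m]}.
Implicit Type A : {set 'I_n}.
Variables (C : {set {set 'I_n}}) (L : ('I_n -> R) -> Prop).
Variables (C' : {set {set 'I_m}}) (L' : ('I_m -> R) -> Prop).
Variables (g : 'I_n -> 'I_m) (h : 'I_m -> 'I_n) (r : 'I_n -> R) (r' : 'I_m -> R).
Hypotheses (sC : simplicial C L) (sC' : simplicial C' L').
Hypothesis iso : fan_iso C L C' L' g h r r'.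

Let ray_g i : [set i] \in C -> [set g i] \in C'.
Proof. by rewrite -imset_set1; apply: (iso_g iso). Qed.
Let ray_h j : [set j] \in C' -> [set h j] \in C.
Proof. by rewrite -imset_set1; apply: (iso_h iso). Qed.
Let mem_ray A i : A \in C -> i \in A -> [set i] \in C.
Proof. by move=> Ac iA; apply: (face_sub sC Ac); rewrite sub1set. Qed.

(** The factor [r i] turns the relation of [l] into that of [l'], where [l' (g i) = r i * l i].
    Indices that are not rays are zero in the Chow ring and are sent to 0. *)
Definition iso_map : P -> P' :=
  psub (fun i => if [set i] \in C then r i *: 'X_(g i) else 0).
HB.instance Definition _ := GRing.RMorphism.on iso_map.
HB.instance Definition _ := GRing.Linear.on iso_map.

Lemma iso_mapX i : iso_map 'X_i = if [set i] \in C then r i *: 'X_(g i) else 0.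
Proof. exact: psubX. Qed.

Lemma dhomog_iso_map k p : p \is k.-homog -> iso_map p \is k.-homog.
Proof.
by apply: dhomog_psub => i; case: ifP => _; rewrite ?dhomog0 // dhomogZ // dhomogXU.
Qed.

Lemma iso_map_plf (f : 'I_n -> R) (f' : 'I_m -> R) :
  (forall i, [set i] \in C -> f' (g i) = r i * f i) -> iso_map (plf C f) = plf C' f'.
Proof.
move=> ff'; rewrite /plf raddf_sum /= [RHS](reindex_onto g h) /=; last first.
  by move=> j /(iso_hK iso).
apply: eq_big => [i|i iC].
  apply/idP/andP => [iC|[gC /eqP <-]]; last by apply: ray_h.
  by rewrite ray_g // (iso_gK iso).
by rewrite linearZ /= iso_mapX iC scalerA ff' // mulrC.
Qed.

Lemma iso_inj A : (forall i, i \in A -> [set i] \in C) -> {in A &, injective g}.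
Proof.
move=> AC i j iA jA e.
by rewrite -(iso_gK iso (AC i iA)) e (iso_gK iso (AC j jA)).
Qed.

Lemma iso_card A : A \in C -> #|g @: A| = #|A|.
Proof. by move=> Ac; apply: card_in_imset; apply: iso_inj => i /(mem_ray Ac). Qed.

Lemma iso_map_mono A : (forall i, i \in A -> [set i] \in C) ->
  iso_map (mono R A) = (\prod_(i in A) r i) *: mono R (g @: A).
Proof.
move=> AC; rewrite /mono rmorph_prod big_imset /=; last exact: iso_inj.
rewrite -scaler_prod; apply: eq_bigr => i iA.
by rewrite iso_mapX AC.
Qed.

Lemma iso_imsetK A : (forall i, i \in A -> [set i] \in C) -> h @: (g @: A) = A.
Proof.
move=> AC; rewrite -imset_comp; apply/setP => i; apply/imsetP/idP => [[j jA ->]|iA].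
  by rewrite /= (iso_gK iso) ?AC.
by exists i => //=; rewrite (iso_gK iso) ?AC.
Qed.

Lemma iso_map_ideal p : cideal C L p -> cideal C' L' (iso_map p).
Proof.
apply: generated_map => q [[A Ac ->]|[l Ll ->]] /=; last first.
  by have [l' Ll' ll'] := iso_L iso Ll; rewrite (iso_map_plf ll'); apply: cideal_lin.
have [/forallP AC|/forallPn[i]] := boolP [forall i, (i \in A) ==> ([set i] \in C)].
  have {}AC i : i \in A -> [set i] \in C by apply/implyP/AC.
  rewrite iso_map_mono //; apply: generatedZ; apply: cideal_nonface.
  by apply: contra Ac => /(iso_h iso); rewrite iso_imsetK.
rewrite negb_imply => /andP[iA /negPf iC].
rewrite /mono (bigD1 i) //= rmorphM /= iso_mapX iC mul0r; exact: generated0.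
Qed.

Lemma iso_cdim_le : (cdim C <= cdim C')%N.
Proof.
have [A Ac <-] := cdim_attained (face0 sC).
by rewrite -iso_card //; apply: cdim_ge; apply: (iso_g iso).
Qed.

End IsoMap.

Section IsoInverse.
Variables (R : realType) (n m : nat).
Local Notation P := {mpoly R[n]}.
Local Notation P' := {mpoly R[m]}.
Implicit Type A : {set 'I_n}.
Variables (C : {set {set 'I_n}}) (L : ('I_n -> R) -> Prop).
Variables (C' : {set {set 'I_m}}) (L' : ('I_m -> R) -> Prop).
Variables (g : 'I_n -> 'I_m) (h : 'I_m -> 'I_n) (r : 'I_n -> R) (r' : 'I_m -> R).
Hypotheses (sC : simplicial C L) (sC' : simplicial C' L').
Hypothesis iso : fan_iso C L C' L' g h r r'.
Let iso' := fan_iso_sym iso.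
Local Notation phi := (@iso_map R m n C' h r').
Local Notation psi := (@iso_map R n m C g r).

Let ray_g i : [set i] \in C -> [set g i] \in C'.
Proof. by rewrite -imset_set1; apply: (iso_g iso). Qed.
Let mem_ray A i : A \in C -> i \in A -> [set i] \in C.
Proof. by move=> Ac iA; apply: (face_sub sC Ac); rewrite sub1set. Qed.
Let mem_ray' (A : {set 'I_m}) j : A \in C' -> j \in A -> [set j] \in C'.
Proof. by move=> Ac jA; apply: (face_sub sC' Ac); rewrite sub1set. Qed.

Lemma iso_cdim : cdim C = cdim C'.
Proof.
apply/eqP; rewrite eqn_leq (iso_cdim_le sC iso).
exact: (iso_cdim_le sC' iso').
Qed.

Lemma iso_mapK p : cideal C L (phi (psi p) - p).
Proof.
elim/mpoly_ring_ind: p => [z|i|p q Hp Hq|p q Hp Hq].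
- by rewrite /iso_map !psubC subrr; apply: generated0.
- rewrite iso_mapX; case: ifP => [iC|/negbT iC].
    rewrite [phi _]linearZ /= iso_mapX ray_g // (iso_gK iso) // scalerA (iso_rr' iso) //.
    by rewrite scale1r subrr; apply: generated0.
  by rewrite raddf0 sub0r; apply: generatedN; apply: cideal_X.
- by rewrite [psi _]raddfD /= [phi _]raddfD /= opprD addrACA; exact: generatedD Hp Hq.
- by rewrite [psi _]rmorphM /= [phi _]rmorphM /=; exact: generated_congrM Hp Hq.
Qed.

Lemma iso_star_sum (T : {set 'I_n}) (F : 'I_m -> R) : T \in C ->
  \sum_(i | (i \notin T) && (i |: T \in C)) F (g i) =
  \sum_(j | (j \notin g @: T) && (j |: g @: T \in C')) F j.
Proof.
move=> TC; rewrite [RHS](reindex_onto g h) /=; last first.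
  by move=> j /andP[_ jTC]; apply: (iso_hK iso); apply: (mem_ray' jTC); apply: setU11.
apply: eq_bigl => i; apply/andP/andP => [[iT iTC]|[/andP[gT gTC] /eqP e]].
  have iC : [set i] \in C by apply: (mem_ray iTC); apply: setU11.
  rewrite (iso_gK iso) // -imsetU1 (iso_g iso) // andbT; split=> //.
  apply: contra iT => /imsetP[j jT e]; rewrite -(iso_gK iso iC) e (iso_gK iso) //.
  exact: mem_ray jT.
split; first by apply: contra gT => iT; apply: imset_f.
have := iso_h iso gTC; rewrite imsetU1 e (iso_imsetK iso) // => j; exact: mem_ray.
Qed.

End IsoInverse.

Section IsoKahler.
Variables (R : realType) (n m : nat).
Local Notation P := {mpoly R[n]}.
Local Notation P' := {mpoly R[m]}.
Implicit Type A : {set 'I_n}.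
Variables (C : {set {set 'I_n}}) (L : ('I_n -> R) -> Prop).
Variables (C' : {set {set 'I_m}}) (L' : ('I_m -> R) -> Prop).
Variables (g : 'I_n -> 'I_m) (h : 'I_m -> 'I_n) (r : 'I_n -> R) (r' : 'I_m -> R).
Hypotheses (sC : simplicial C L) (sC' : simplicial C' L').
Hypothesis iso : fan_iso C L C' L' g h r r'.
Let iso' := fan_iso_sym iso.
Local Notation phi := (@iso_map R m n C' h r').
Local Notation psi := (@iso_map R n m C g r).

Let ray_g i : [set i] \in C -> [set g i] \in C'.
Proof. by rewrite -imset_set1; apply: (iso_g iso). Qed.
Let mem_ray A i : A \in C -> i \in A -> [set i] \in C.
Proof. by move=> Ac iA; apply: (face_sub sC Ac); rewrite sub1set. Qed.
Let mem_ray' (A : {set 'I_m}) j : A \in C' -> j \in A -> [set j] \in C'.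
Proof. by move=> Ac jA; apply: (face_sub sC' Ac); rewrite sub1set. Qed.


(** [phi] and [psi] are inverse to each other modulo the ideals, and they change monomials of cones
    only by positive factors, which preserve the positivity of degrees. *)
Theorem kahler_iso : kahler C L -> kahler C' L'.
Proof.
case=> deg [degP deg_pos wC pdC HC].
have eD : cdim C = cdim C' := iso_cdim sC sC' iso.
have phi_ideal p : cideal C' L' p -> cideal C L (phi p) := iso_map_ideal iso' (p := p).
have psi_ideal p : cideal C L p -> cideal C' L' (psi p) := iso_map_ideal iso (p := p).
have hphi k (p : P') : p \is k.-homog -> phi p \is k.-homog.
  exact: dhomog_iso_map.
have hpsi k (p : P) : p \is k.-homog -> psi p \is k.-homog.
  exact: dhomog_iso_map.
have phiK (p : P) : cideal C L (phi (psi p) - p) := iso_mapK iso p.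
have psiK (p : P') : cideal C' L' (psi (phi p) - p) := iso_mapK iso' p.
have phiI (p : P') : cideal C L (phi p) -> cideal C' L' p.
  by move=> /psi_ideal; apply: generated_subr; apply: psiK.
have rays A : A \in C -> forall i, i \in A -> [set i] \in C by move=> Ac i; apply: mem_ray.
have rays' (A : {set 'I_m}) : A \in C' -> forall i, i \in A -> [set i] \in C'.
  by move=> Ac i; apply: mem_ray'.
pose deg' : {scalar P'} := deg \o phi.
have deg'E (p : P') : deg' p = deg (phi p) by [].
have deg'P (p : P') : p \is (cdim C').-homog -> deg' p = 0 <-> cideal C' L' p.
  move=> hp; rewrite deg'E degP; last by rewrite eD; apply: hphi.
  by split=> [/phiI|/phi_ideal].
have deg'_mono (A : {set 'I_m}) : A \in C' -> deg' (mono R A) = (\prod_(j in A) r' j) * deg (mono R (h @: A)).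
  by move=> Ac; rewrite deg'E (iso_map_mono iso' (rays' _ Ac)) linearZ.
have rpos (A : {set 'I_m}) : A \in C' -> 0 < \prod_(j in A) r' j.
  by move=> Ac; apply: prodr_gt0 => j jA; apply: (iso_r' iso); apply: rays' jA.
have hcard (A : {set 'I_m}) : A \in C' -> #|h @: A| = #|A| := iso_card sC' iso' (A := A).
have gcard A : A \in C -> #|g @: A| = #|A| := iso_card sC iso (A := A).
have gK A : A \in C -> h @: (g @: A) = A by move=> Ac; apply: (iso_imsetK iso); apply: rays.
have hK (A : {set 'I_m}) : A \in C' -> g @: (h @: A) = A by move=> Ac; apply: (iso_imsetK iso'); apply: rays'.
have prod_rr (A : {set 'I_m}) : A \in C' -> (\prod_(i in h @: A) r i) * \prod_(j in A) r' j = 1.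
  move=> Ac; rewrite big_imset /=; last by apply: (iso_inj iso'); apply: rays'.
  rewrite -big_split big1 //= => j jA.
  by rewrite mulrC (iso_rr' iso') //; apply: rays' jA.
exists deg'; split=> //.
- move=> A Ac eA; rewrite deg'_mono // mulr_gt0 ?rpos // deg_pos ?hcard ?eD //.
  exact: (iso_h iso).
(* The product makes up for the rescaling of the linear forms, so that [v] is balanced. *)
- move=> v' bv'; pose v A := v' (g @: A) * \prod_(i in A) r i.
  have [|z zP] := wC v.
    move=> T TC eT l [Ll lT]; have [l' Ll' ll'] := iso_L iso Ll.
    have gT' : starl L' (g @: T) l'.
      split=> // j /imsetP[i iT ->]; rewrite ll' ?lT ?mulr0 //; exact: rays iT.
    have := bv' (g @: T) (iso_g iso TC); rewrite gcard // eT eD => /(_ erefl _ gT').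
    rewrite -(iso_star_sum sC sC' iso (fun j => v' (j |: g @: T) * l' j) TC) => sum0.
    transitivity ((\prod_(i in T) r i) * \sum_(i | (i \notin T) && (i |: T \in C))
        v' (g i |: g @: T) * l' (g i)); last by rewrite sum0 mulr0.
    rewrite mulr_sumr; apply: eq_bigr => i /andP[iT iTC].
    rewrite /v imsetU1 big_setU1 //= ll'; last by apply: (rays _ iTC); apply: setU11.
    by ring.
  exists z => A Ac eA; have := zP (h @: A) (iso_h iso Ac).
  rewrite hcard // eA eD => /(_ erefl); rewrite /v hK // deg'_mono // => e.
  by rewrite mulrCA -e mulrCA [X in _ * X]mulrC prod_rr // mulr1.
- move=> k p le_k hp Hp; apply: phiI; apply: (pdC k) => [||q]; rewrite ?eD //; first exact: hphi.
  move=> hq; rewrite -[RHS](Hp _ (hpsi _ _ hq)) deg'E [phi (_ * _)]rmorphM /=.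
  have hm (u v : P) : u \is k.-homog -> v \is (cdim C' - k).-homog -> u * v \is (cdim C).-homog.
    by move=> hu hv; apply: (dhomogMe hu hv); rewrite subnKC ?eD.
  apply: (deg_congr degP); rewrite ?hm ?hphi ?hpsi // -mulrBr -opprB mulrN.
  by apply: generatedN; apply: generatedM; apply: phiK.
move=> f' f'C; pose f i := r' (g i) * f' (g i).
have ff' j : [set j] \in C' -> f (h j) = r' j * f' j by move=> jC; rewrite /f (iso_hK iso).
have fC : convex C L f.
  move=> T TC; have [m' [Lm' mf'] mpos'] := f'C _ (iso_g iso TC).
  have [l Ll ll'] := iso_L' iso Lm'.
  have lE i : [set i] \in C -> l i = r' (g i) * m' (g i).
    by move=> iC; rewrite -ll' ?ray_g // (iso_gK iso).
  exists l => [|i iT iTC].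
    by split=> // i iT; rewrite lE ?mf' ?imset_f //; apply: rays iT.
  have iC : [set i] \in C by apply: (rays _ iTC); apply: setU11.
  rewrite lE // /f -mulrBr mulr_gt0 ?(iso_r' iso) ?ray_g // mpos' //.
    apply: contra iT => /imsetP[j jT e].
    by rewrite -(iso_gK iso iC) e (iso_gK iso) //; apply: rays jT.
  by rewrite -imsetU1 (iso_g iso).
have [HL HR] := HC f fC.
have lE : phi (plf C' f') = plf C f by apply: (iso_map_plf iso').
have lE' : cideal C' L' (psi (plf C f) - plf C' f') by rewrite -lE; apply: psiK.
split=> [k|k p]; rewrite -eD => le_k.
  have [inj surj] := HL k le_k; split=> [p hp Hp|q hq].
    apply: phiI; apply: inj; first exact: hphi.
    by have := phi_ideal _ Hp; rewrite rmorphM rmorphXn /= lE.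
  have [p hp Hp] := surj _ (hphi _ _ hq); exists (psi p); first exact: hpsi.
  have := psi_ideal _ Hp; rewrite [psi _]raddfB /= [psi (_ * _)]rmorphM rmorphXn /=.
  apply: generated_subl.
  have -> : q - plf C' f' ^+ (cdim C - k.*2) * psi p -
      (psi (phi q) - psi (plf C f) ^+ (cdim C - k.*2) * psi p) =
      (psi (plf C f) ^+ (cdim C - k.*2) - plf C' f' ^+ (cdim C - k.*2)) * psi p
      - (psi (phi q) - q).
    rewrite mulrBl; move: (psi (phi q)) (_ * psi p) (_ * psi p) => u v w; ring.
  apply: generatedB; last exact: psiK.
  by apply: generatedMr; apply: generated_congrX.
move=> hp Hp nIp; have := HR k (phi p) le_k (hphi _ _ hp).
have -> : deg' (plf C' f' ^+ (cdim C - k.*2) * p * p) =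
    deg (plf C f ^+ (cdim C - k.*2) * phi p * phi p).
  by rewrite deg'E !rmorphM rmorphXn /= lE.
apply; last by move=> /phiI.
by have := phi_ideal _ Hp; rewrite rmorphM rmorphXn /= lE.
Qed.

End IsoKahler.

Lemma fan_iso_star (R : realType) n m (C : {set {set 'I_n}}) (L : ('I_n -> R) -> Prop)
    (C' : {set {set 'I_m}}) (L' : ('I_m -> R) -> Prop) g h r r' (U : {set 'I_n}) :
  simplicial C L -> simplicial C' L' -> fan_iso C L C' L' g h r r' -> U \in C ->
  fan_iso (starc C U) (starl L U) (starc C' (g @: U)) (starl L' (g @: U)) g h r r'.
Proof.
move=> sC sC' iso UC; have iso' := fan_iso_sym iso.
have rays (A : {set 'I_n}) i : A \in C -> i \in A -> [set i] \in C.
  by move=> Ac iA; apply: (face_sub sC Ac); rewrite sub1set.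
have rays' (A : {set 'I_m}) i : A \in C' -> i \in A -> [set i] \in C'.
  by move=> Ac iA; apply: (face_sub sC' Ac); rewrite sub1set.
have star_ray i : [set i] \in starc C U -> [set i] \in C.
  by rewrite in_starc => /andP[_ /(face_sub sC)]; apply; apply: subsetUl.
have star_ray' i : [set i] \in starc C' (g @: U) -> [set i] \in C'.
  by rewrite in_starc => /andP[_ /(face_sub sC')]; apply; apply: subsetUl.
have gU : h @: (g @: U) = U by apply: (iso_imsetK iso) => i; apply: rays.
have disj k l (f : 'I_k -> 'I_l) (A B : {set 'I_k}) :
    {in A :|: B &, injective f} -> [disjoint A & B] -> [disjoint f @: A & f @: B].
  move=> inj dAB; rewrite -setI_eq0; apply/eqP/setP => y; rewrite !inE; apply/negP.
  move=> /andP[/imsetP[x xA ->] /imsetP[x' xB e]].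
  have xx : x = x' by apply: inj; rewrite ?inE ?xA ?xB ?orbT.
  by move: (disjointFr dAB xA); rewrite xx xB.
split.
- by move=> i /star_ray; apply: (iso_gK iso).
- by move=> i /star_ray'; apply: (iso_hK iso).
- move=> A; rewrite !in_starc => /andP[dA AU]; rewrite -imsetU (iso_g iso AU) andbT.
  by apply: disj dA; apply: (iso_inj iso) => i; apply: rays.
- move=> A; rewrite !in_starc => /andP[dA AU].
  rewrite -{2}gU -imsetU (iso_h iso AU) andbT -gU.
  by apply: disj dA; apply: (iso_inj iso') => i; apply: rays'.
- by move=> i /star_ray; apply: (iso_r iso).
- by move=> i /star_ray'; apply: (iso_r' iso).
- by move=> i /star_ray; apply: (iso_rr' iso).
- move=> l [Ll lU]; have [l' Ll' ll'] := iso_L iso Ll; exists l' => [|i /star_ray]; last exact: ll'.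
  split=> // j /imsetP[i iU ->]; rewrite ll' ?lU ?mulr0 //; exact: rays iU.
move=> l [Ll lU]; have [l' Ll' ll'] := iso_L' iso Ll; exists l' => [|i /star_ray']; last exact: ll'.
split=> // i iU; have iC := rays _ _ UC iU.
rewrite -(iso_gK iso iC) ll' ?lU ?mulr0 ?imset_f //.
by rewrite -imset_set1; apply: (iso_g iso).
Qed.

(** The recursion in [lefschetz] unfolded: stars of stars are stars, and the fan itself is the star
    of [set0]. *)
Definition kahler_stars (R : realType) n (C : {set {set 'I_n}}) (L : ('I_n -> R) -> Prop) : Prop :=
  forall T, T \in C -> kahler (starc C T) (starl L T).

Lemma kahler_stars_iso (R : realType) n m (C : {set {set 'I_n}}) (L : ('I_n -> R) -> Prop)
    (C' : {set {set 'I_m}}) (L' : ('I_m -> R) -> Prop) g h r r' :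
  simplicial C L -> simplicial C' L' -> fan_iso C L C' L' g h r r' ->
  kahler_stars C L -> kahler_stars C' L'.
Proof.
move=> sC sC' iso H V VC; have hV := iso_h iso VC.
have gV : g @: (h @: V) = V.
  apply: (iso_imsetK (fan_iso_sym iso)) => i iV.
  by apply: (face_sub sC' VC); rewrite sub1set.
have := fan_iso_star sC sC' iso hV; rewrite gV => isoV.
apply: (kahler_iso _ _ isoV (H _ hV)); exact: simplicial_star.
Qed.

(** * Linear functions of a lattice fan *)

Section Content.
Variable n : nat.
Implicit Type v : 'rV[int]_n.

Lemma content_dvd v j : (content v %| absz (v 0%R j))%N.
Proof. by rewrite /content (bigD1 j) //= dvdn_gcdl. Qed.

Lemma dvd_content k v : (forall j, k %| absz (v 0%R j))%N -> (k %| content v)%N.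
Proof.
move=> kv; rewrite /content; elim/big_rec: _ => [|j x _ kx]; first exact: dvdn0.
by rewrite dvdn_gcd kv.
Qed.

Lemma content_primv v : v = (content v)%:Z *: primv v.
Proof.
apply/rowP => j; rewrite !mxE mulrC divzK //.
by rewrite -[(_ %| _)%Z]/(content v %| absz (v 0%R j))%N content_dvd.
Qed.

End Content.

Lemma content_mulmx n p (v : 'rV[int]_n) (Y : 'M[int]_(n, p)) : (content v %| content (v *m Y))%N.
Proof.
apply: dvd_content => j; rewrite (content_primv v) -scalemxAl mxE abszM /=.
by rewrite -content_primv dvdn_mulr.
Qed.

Section LinearFunctions.
Variable R : realType.
Local Notation intmx := (map_mx (intr : int -> R)).

Definition lin (S : fan) (l : 'I_(nrays S) -> R) : Prop :=
  exists m : 'cV[R]_(lrank S), forall i, l i = (rgen R i *m m) 0 0.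

Definition good_fan (S : fan) : Prop := simplicial (cones S) (@lin S).

Lemma chow_idealE (S : fan) : @chow_ideal R S = cideal (cones S) (@lin S).
Proof.
suff E : @chow_relation R S = crel (cones S) (@lin S) by rewrite /cideal -E.
apply/predeqP => g; split=> -[[A Ac ->]|].
- by left; exists A.
- by move=> [m ->]; right; exists (fun i => (rgen R i *m m) 0 0) => //; exists m.
- by left; exists A.
move=> [l [m lE] ->]; right; exists m; congr pl_form; exact/funext.
Qed.

(** The generators of a cone are the rows of a row-free matrix, and a right inverse of it produces
    linear forms with prescribed values. *)
Lemma simplicial_good (S : fan) : simplicial_fan R S -> good_fan S.
Proof.
case=> C0 Csub _ indS _; split=> //.
- by exists 0 => i; rewrite mulmx0 mxE.
- move=> l l' [m lE] [m' lE']; exists (m + m') => i.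
  by rewrite mulmxDr mxE lE lE'.
- by move=> z l [m lE]; exists (z *: m) => i; rewrite -scalemxAr mxE lE.
move=> T u TC; pose M : 'M[R]_(#|T|, lrank S) := \matrix_i rgen R (enum_val i).
have freeM : row_free M.
  rewrite -kermx_eq0; apply/rowV0P => v /sub_kermxP vM.
  pose a i := if [pick j | enum_val j == i] is Some j then v 0 j else 0.
  have aE j : a (enum_val j : 'I_(nrays S)) = v 0 j.
    rewrite /a; case: pickP => [j' /eqP/enum_val_inj->//|/(_ j)]; by rewrite eqxx.
  have sum0 : \sum_(i in T) a i *: rgen R i = 0.
    rewrite big_enum_val /= -[RHS]vM mulmx_sum_row; apply: eq_bigr => j _.
    by rewrite aE rowK.
  apply/rowP => j; rewrite -aE mxE; apply: indS sum0 _ (enum_valP j); exact: TC.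
pose m := pinvmx M *m \col_j u (enum_val j).
exists (fun i => (rgen R i *m m) 0 0) => [|i iT]; first by exists m.
have -> : rgen R i = row (enum_rank_in iT i) M by rewrite rowK enum_rankK_in.
rewrite -row_mul /m mulmxA mulmxVp // mul1mx !mxE enum_rankK_in //.
Qed.

(** * Linear forms on the quotient lattice of a star *)

Section Star.
Variables (S : fan) (T : {set 'I_(nrays S)}).
Hypotheses (gS : good_fan S) (TC : T \in cones S).
Local Notation Q := (qmap T).

(** The matrix [1 - Q P] is killed by [Q], so its rows are lattice points of the span of [T]. Hence
    every vector is the lift by [P] of its image in the quotient plus a combination of the
    generators of [T]. *)
Lemma qmap_split : exists (P : 'M[int]_(_, _)) (X : 'M[R]_(_, _)),
  P *m Q = 1%:M /\ 1%:M = intmx Q *m intmx P + X *m intmx (cone_mx T).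
Proof.
have [P PQ] := s2valP (lattice_quotient (cone_mx T)).
have kerQ := s2valP' (lattice_quotient (cone_mx T)).
pose N := 1%:M - Q *m P.
have NQ : N *m Q = 0 by rewrite mulmxBl mul1mx -mulmxA PQ mulmx1 subrr.
have /submxP[X NE] : (map_mx (intr : int -> rat) N <= map_mx intr (cone_mx T))%MS.
  apply/row_subP => i; rewrite -map_row; apply/kerQ.
  by rewrite -row_mul NQ row0.
exists P, (map_mx ratr X); split=> //.
have ratE a b (Y : 'M[int]_(a, b)) : map_mx (ratr : rat -> R) (map_mx intr Y) = intmx Y.
  by apply/matrixP => i j; rewrite !mxE ratr_int.
have -> : map_mx ratr X *m intmx (cone_mx T) = intmx N.
  by rewrite -(ratE _ _ (cone_mx T)) -map_mxM -NE ratE.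
by rewrite /N map_mxB map_mxM map_mx1 addrC subrK.
Qed.

Lemma gen_qmap t : t \in T -> gen t *m Q = 0.
Proof.
move=> tT; apply/(s2valP' (lattice_quotient (cone_mx T))).
have -> : gen t = row (enum_rank_in tT t) (cone_mx T) by rewrite rowK enum_rankK_in.
by rewrite map_row row_sub.
Qed.

Lemma rgen_star i :
  rgen R i *m intmx Q = (qmult T i)%:R *: rgen R (i : 'I_(nrays (star T))).
Proof.
rewrite /rgen -map_mxM {1}(content_primv (gen i *m Q)) map_mxZ.
by rewrite /qmult /= -pmulrn.
Qed.

(** A linear form that vanishes on [T] descends to the quotient by composition with the section [P]
    of [qmap_split]. *)
Lemma starl_linP l : starl (@lin S) T l <->
  exists m' : 'cV[R]_(qrank T), forall i, l i = (rgen R i *m intmx Q *m m') 0 0.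
Proof.
have [P [X [PQ E]]] := qmap_split; split=> [[[m lE] lT]|[m' lE]]; last first.
  split; first by exists (intmx Q *m m') => i; rewrite mulmxA.
  by move=> t tT; rewrite lE /rgen -map_mxM gen_qmap // map_mx0 mul0mx mxE.
have Mm : intmx (cone_mx T) *m m = 0.
  apply/colP => j; have := lT _ (enum_valP j); rewrite lE => e; rewrite [RHS]mxE -[RHS]e.
  by rewrite !mxE; apply: eq_bigr => h _; rewrite !mxE.
exists (intmx P *m m) => i.
by rewrite lE -{1}(mul1mx m) E mulmxDl -(mulmxA X) Mm mulmx0 addr0 !mulmxA.
Qed.

(** If [gen i] died in the quotient, no linear form could be 1 at [i] and vanish on [T], against
    [lin_interp]. *)
Lemma qmult_gt0 i : i \notin T -> i |: T \in cones S -> (0 < qmult T i)%N.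
Proof.
move=> iT iTC; rewrite lt0n; apply/negP => /eqP q0.
have [l Ll lE] := lin_interp gS (fun j => (j == i)%:R) iTC.
have /starl_linP[m' lm] : starl (@lin S) T l.
  split=> // t tT; rewrite lE ?inE ?tT ?orbT // (_ : (t == i) = false) //.
  by apply: contraNF iT => /eqP<-.
have := lm i; rewrite lE ?setU11 // eqxx rgen_star q0 scale0r mul0mx mxE => /eqP.
by rewrite oner_eq0.
Qed.

Lemma star_ray_qmult i : [set i] \in cones (star T) -> (0 < qmult T i)%N.
Proof.
rewrite [cones _]/(starc (cones S) T) in_starc disjoints1 => /andP[iT iTC].
exact: qmult_gt0.
Qed.

(** The lattice star has primitive generators, while [starl] evaluates forms on the images of the
    old generators; the two differ by the factors [qmult]. *)
Lemma star_fan_iso : fan_iso (cones (star T)) (@lin (star T))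
  (starc (cones S) T) (starl (@lin S) T) id id
  (fun i => (qmult T i)%:R) (fun i => (qmult T i)%:R^-1).
Proof.
split=> //.
- by move=> A; rewrite imset_id.
- by move=> A; rewrite imset_id.
- by move=> i /star_ray_qmult; rewrite ltr0n.
- by move=> i /star_ray_qmult; rewrite invr_gt0 ltr0n.
- by move=> i /star_ray_qmult q0; rewrite divff // pnatr_eq0 -lt0n.
- move=> l [m' lE]; exists (fun i => (rgen R i *m intmx Q *m m') 0 0); first by apply/starl_linP; exists m'.
  by move=> i _; rewrite rgen_star -scalemxAl mxE lE.
move=> l /starl_linP[m' lE].
exists (fun i : 'I_(nrays (star T)) => (rgen R i *m m') 0 0); first by exists m'.
move=> i /star_ray_qmult q0; rewrite lE rgen_star -scalemxAl [in RHS]mxE mulKf //.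
by rewrite pnatr_eq0 -lt0n.
Qed.

Lemma good_star : good_fan (star T).
Proof.
have sT := simplicial_star gS TC; split.
- exact: (face0 sT).
- exact: (face_sub sT).
- by exists 0 => i; rewrite mulmx0 mxE.
- move=> l l' [m lE] [m' lE']; exists (m + m') => i.
  by rewrite mulmxDr mxE lE lE'.
- by move=> z l [m lE]; exists (z *: m) => i; rewrite -scalemxAr mxE lE.
move=> A u AC; have [l Ll lE] := lin_interp sT (fun i => (qmult T i)%:R * u i) AC.
have [l' Ll' ll'] := iso_L' star_fan_iso Ll; exists l' => // i iA.
have iC : [set i] \in cones (star T) by apply: (face_sub sT AC); rewrite sub1set.
by rewrite (ll' i) // lE // mulKf // pnatr_eq0 -lt0n star_ray_qmult.
Qed.

End Star.
End LinearFunctions.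

(** * Indices of sublattices *)

Section Minors.

Definition minors_gcd k n (M : 'M[int]_(k, n)) : nat :=
  \big[gcdn/0%N]_(f : {ffun 'I_k -> 'I_n}) absz (\det (colsub f M)).

Lemma minors_gcd_dvd k n (M : 'M[int]_(k, n)) (f : 'I_k -> 'I_n) :
  (minors_gcd M %| absz (\det (colsub f M)))%N.
Proof.
have -> : colsub f M = colsub (finfun f) M.
  by apply/matrixP => i j; rewrite !mxE ffunE.
by rewrite /minors_gcd (bigD1 (finfun f)) //= dvdn_gcdl.
Qed.

Lemma dvd_minors_gcd k n (M : 'M[int]_(k, n)) c :
  (forall f : {ffun 'I_k -> 'I_n}, c %| absz (\det (colsub f M)))%N -> (c %| minors_gcd M)%N.
Proof.
move=> cM; rewrite /minors_gcd; elim/big_rec: _ => [|f x _ cx]; first exact: dvdn0.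
by rewrite dvdn_gcd cM.
Qed.

Lemma minors_gcd_mull k n (A : 'M[int]_k) (M : 'M[int]_(k, n)) :
  minors_gcd (A *m M) = (absz (\det A) * minors_gcd M)%N.
Proof.
rewrite /minors_gcd (big_morph (muln (absz (\det A))) (muln_gcdr _) (muln0 _)).
by apply: eq_bigr => f _; rewrite -mulmx_colsub det_mulmx abszM.
Qed.

(* Cauchy-Binet, without collecting equal terms. *)
Lemma det_mulmx_expand k n (M : 'M[int]_(k, n)) (W : 'M[int]_(n, k)) :
  \det (M *m W) = \sum_(f : {ffun 'I_k -> 'I_n}) (\prod_i W (f i) i) * \det (colsub f M).
Proof.
rewrite -det_tr trmx_mul; transitivity (\sum_(s : 'S_k) (-1) ^+ s *
    \sum_(f : {ffun 'I_k -> 'I_n}) \prod_i (W (f i) i * M (s i) (f i))).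
  apply: eq_bigr => s _; congr (_ * _).
  rewrite -(bigA_distr_bigA (fun i j => W j i * M (s i) j)); apply: eq_bigr => i _.
  by rewrite mxE; apply: eq_bigr => j _; rewrite !mxE.
under eq_bigr do rewrite mulr_sumr.
rewrite exchange_big; apply: eq_bigr => f _ /=.
rewrite -det_tr mulr_sumr; apply: eq_bigr => s _.
rewrite big_split /= mulrCA; congr (_ * (_ * _)).
by apply: eq_bigr => i _; rewrite !mxE.
Qed.

Lemma minors_gcd_det k n (M : 'M[int]_(k, n)) (W : 'M[int]_(n, k)) :
  (minors_gcd M %| absz (\det (M *m W)))%N.
Proof.
rewrite det_mulmx_expand -[(_ %| _)%N]/((minors_gcd M)%:Z %| _)%Z.
apply: rpred_sum => f _; apply: dvdz_mull.
exact: minors_gcd_dvd.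
Qed.

Lemma minors_gcd_mulr_dvd k n p (M : 'M[int]_(k, n)) (V : 'M[int]_(n, p)) :
  (minors_gcd M %| minors_gcd (M *m V))%N.
Proof.
by apply: dvd_minors_gcd => f; rewrite -mulmx_colsub; apply: minors_gcd_det.
Qed.

Lemma minors_gcd_mulr k n (M : 'M[int]_(k, n)) (V : 'M[int]_n) :
  V \in unitmx -> minors_gcd (M *m V) = minors_gcd M.
Proof.
move=> uV; apply/eqP; rewrite eqn_dvd minors_gcd_mulr_dvd andbT.
by rewrite -{2}(mulmxK uV M) minors_gcd_mulr_dvd.
Qed.

Lemma minors_gcd_corner k p (v : 'rV[int]_p) :
  minors_gcd (block_mx 0 v 1%:M 0 : 'M_(1 + k, k + p)) = content v.
Proof.
apply/eqP; rewrite eqn_dvd; apply/andP; split.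
  apply: dvd_content => j.
  (* These columns select the entry [v 0 j] and the identity block. *)
  pose f (x : 'I_(1 + k)) : 'I_(k + p) :=
    match split x with inl _ => rshift k j | inr i => lshift p i end.
  have := minors_gcd_dvd (block_mx 0 v 1%:M 0 : 'M_(1 + k, k + p)) f.
  have -> : colsub f (block_mx 0 v 1%:M 0 : 'M_(1 + k, k + p)) =
      block_mx (v 0 j)%:M 0 0 1%:M.
    apply/matrixP => x y; rewrite mxE /f; case: (splitP y) => y' ey.
      have -> : y = lshift k y' by apply: val_inj.
      case: (splitP x) => x' ex.
        have -> : x = lshift k x' by apply: val_inj.
        by rewrite block_mxEur block_mxEul !ord1 mxE eqxx.
      have -> : x = rshift 1 x' by apply: val_inj.
      by rewrite block_mxEdr block_mxEdl !mxE.
    have -> : y = rshift 1 y' by apply: val_inj.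
    case: (splitP x) => x' ex.
      have -> : x = lshift k x' by apply: val_inj.
      by rewrite block_mxEul block_mxEur !mxE.
    have -> : x = rshift 1 x' by apply: val_inj.
    by rewrite block_mxEdl block_mxEdr.
  by rewrite det_ublock det_scalar1 det1 mulr1.
have -> : block_mx 0 v 1%:M 0 =
    block_mx (content v)%:Z%:M 0 0 1%:M *m block_mx 0 (primv v) 1%:M 0 :> 'M_(1 + k, k + p).
  rewrite mulmx_block !mul0mx !mulmx0 !mul1mx !addr0 !add0r mul_scalar_mx.
  by rewrite -content_primv.
by rewrite minors_gcd_mull det_ublock det_scalar1 det1 mulr1 dvdn_mulr.
Qed.

(** [Q2] factors through [Q1], and a further integer matrix can only multiply the content. Used in
    both directions, this makes the content independent of the matrix chosen for the quotient. *)
Lemma content_quotient n q1 q2 (Q1 : 'M[int]_(n, q1)) (Q2 : 'M[int]_(n, q2)) P1 (v : 'rV[int]_n) :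
  P1 *m Q1 = 1%:M -> (forall w : 'rV[int]_n, w *m Q1 = 0 -> w *m Q2 = 0) ->
  (content (v *m Q1) %| content (v *m Q2))%N.
Proof.
move=> PQ1 H; have -> : Q2 = Q1 *m (P1 *m Q2).
  have NQ2 : (1%:M - Q1 *m P1) *m Q2 = 0.
    apply/row_matrixP => i; rewrite row_mul row0; apply: H.
    by rewrite -row_mul mulmxBl mul1mx -mulmxA PQ1 mulmx1 subrr row0.
  by apply/eqP; rewrite -subr_eq0 mulmxA -{1}[Q2]mul1mx -mulmxBl NQ2.
by rewrite mulmxA; apply: content_mulmx.
Qed.

(* [minors_gcd M] is the index of the row lattice of M in its saturation, and
   [v *m Q] is v modulo this saturation. *)
Lemma minors_gcd_col_mx k n q (M : 'M[int]_(k, n)) (v : 'rV[int]_n) (Q : 'M[int]_(n, q)) P :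
  \rank (map_mx (intr : int -> rat) M) = k -> P *m Q = 1%:M ->
  (forall w : 'rV[int]_n, w *m Q = 0 <->
     (map_mx (intr : int -> rat) w <= map_mx (intr : int -> rat) M)%MS) ->
  minors_gcd (col_mx v M) = (minors_gcd M * content (v *m Q))%N.
Proof.
move=> rkM PQ kerQ; have [r [le_rk le_rn] [A Au [V Vu defM]]] := int_diag_form M.
have VuQ : map_mx (intr : int -> rat) V \in unitmx.
  by rewrite unitmxE det_map_mx; apply: rmorph_unit; rewrite -unitmxE.
have er : r = k.
  move: rkM; rewrite defM !map_mxM mxrankMfree ?row_free_unit // map_pid_mx.
  by rewrite (eqmxMfull _ (_ : row_full _)) ?row_full_unit // rank_pid_mx.
move: {rkM le_rk} le_rn; rewrite er => le_kn.
have [p ep] : exists p, n = (k + p)%N by exists (n - k)%N; rewrite subnKC.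
(* In the lattice basis given by [V] the rows of [M] span the first [k] coordinates, so the last [p]
   coordinates form a second quotient map [Q2], for which the formula is a block computation. *)
subst n; subst r; pose E := invmx V.
have eI : pid_mx k = row_mx 1%:M 0 :> 'M[int]_(k, k + p).
  apply/matrixP => i j; rewrite !mxE ltn_ord andbT.
  by case: splitP => j' ej; rewrite !mxE ej //; have := ltn_ord i; case: eqP => // -> ; lia.
have ME : M *m E = row_mx A 0 by rewrite defM eI mulmxK // mul_mx_row mulmx1 mulmx0.
have mM : minors_gcd M = absz (\det A).
  rewrite -(minors_gcd_mulr M (V := E)) ?unitmx_inv // ME.
  have -> : row_mx A 0 = A *m row_mx 1%:M 0 :> 'M_(k, k + p) by rewrite mul_mx_row mulmx1 mulmx0.
  rewrite minors_gcd_mull (_ : minors_gcd _ = 1%N) ?muln1 //; apply/eqP; rewrite -dvdn1.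
  have := minors_gcd_det (row_mx 1%:M 0 : 'M[int]_(k, k + p)) (col_mx 1%:M 0).
  by rewrite mul_row_col mulmx1 mulmx0 addr0 det1.
pose v1 := lsubmx (v *m E); pose v2 := rsubmx (v *m E).
pose Q2 := E *m col_mx 0 1%:M : 'M_(k + p, p); pose P2 := row_mx 0 1%:M *m V : 'M_(p, k + p).
have wQ2 (w : 'rV_(k + p)) : w *m Q2 = rsubmx (w *m E).
  by rewrite mulmxA -{1}[w *m E]hsubmxK mul_row_col mulmx0 add0r mulmx1.
have -> : minors_gcd (col_mx v M) = (absz (\det A) * content v2)%N.
  have uE : E \in unitmx by rewrite unitmx_inv.
  rewrite -(minors_gcd_mulr (col_mx v M) uE) mul_col_mx ME -[v *m E]hsubmxK -/v1 -/v2.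
  have -> : col_mx (row_mx v1 v2) (row_mx A 0) =
      block_mx 1%:M v1 0 A *m block_mx 0 v2 1%:M 0 :> 'M_(1 + k, k + p).
    by rewrite mulmx_block !mul0mx !mulmx0 !mul1mx !mulmx1 !addr0 !add0r.
  by rewrite minors_gcd_mull det_ublock det1 mul1r minors_gcd_corner.
rewrite mM; congr (_ * _)%N; rewrite -[v2]wQ2; apply/eqP; rewrite eqn_dvd.
have MQ2 : M *m Q2 = 0.
  by rewrite /Q2 mulmxA ME mul_row_col mulmx0 mul0mx addr0.
have PQ2 : P2 *m Q2 = 1%:M.
  by rewrite /P2 /Q2 mulmxA mulmxK // mul_row_col mul0mx mul1mx add0r.
apply/andP; split.
  apply: (content_quotient _ PQ2) => w; rewrite wQ2 => w2; apply/kerQ.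
  apply/submxP; exists (map_mx intr (lsubmx (w *m E)) *m invmx (map_mx intr A)).
  rewrite defM eI !map_mxM /= !mulmxA mulmxKV // -!map_mxM; congr map_mx.
  by rewrite mul_mx_row mulmx1 mulmx0 -[0 in RHS]w2 hsubmxK mulmxKV.
apply: (content_quotient _ PQ) => w /kerQ/submxP[X wE].
have E0 : map_mx intr (w *m Q2) = 0 :> 'M[rat]_(1, p).
  by rewrite map_mxM wE -mulmxA -map_mxM MQ2 !map_mx0 mulmx0.
apply/matrixP => i j; have /eqP := congr1 (fun Z : 'M[rat]_(1, p) => Z i j) E0.
by rewrite mxE [X in _ == X]mxE intr_eq0 => /eqP->; rewrite mxE.
Qed.

End Minors.

(** * Multiplicities of cones *)

Section Multiplicity.
Variable S : fan.
Implicit Type A : {set 'I_(nrays S)}.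

Lemma multE A : mult A = minors_gcd (cone_mx A).
Proof. by []. Qed.

(** A reordering of the rows multiplies all maximal minors by the same sign. *)
Lemma mult_enum A k (e : 'I_k -> 'I_(nrays S)) : injective e ->
  (forall i, (i \in A) = (i \in codom e)) ->
  minors_gcd (\matrix_(i < k) gen (e i)) = mult A.
Proof.
move=> inj_e eA; have ek : k = #|A|.
  by rewrite (eq_card eA) card_codom // card_ord.
subst k; have eV i : exists j : 'I_#|A|, enum_val j = e i.
  have iA : e i \in A by rewrite eA codom_f.
  by exists (enum_rank_in iA (e i)); rewrite enum_rankK_in.
have [t tE] := choice eV.
have inj_t : injective t by move=> i j tij; apply: inj_e; rewrite -!tE tij.
have -> : \matrix_i gen (e i) = perm_mx (perm inj_t) *m cone_mx A.
  by rewrite -row_permE; apply/matrixP => i j; rewrite !mxE permE tE.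
rewrite minors_gcd_mull det_perm (_ : absz _ = 1%N) ?mul1n //.
by case: (odd_perm _).
Qed.

Lemma mult0 : @mult S set0 = 1%N.
Proof.
apply/eqP; rewrite -dvdn1 multE.
have := minors_gcd_det (cone_mx (@set0 'I_(nrays S))) (const_mx 0).
rewrite (_ : \det _ = 1) //.
have := cards0 'I_(nrays S); move: (_ *m _); case: #|_| => // M _.
by rewrite det_mx00.
Qed.

Lemma multU1 (T : {set 'I_(nrays S)}) i :
  \rank (map_mx (intr : int -> rat) (cone_mx T)) = #|T| -> i \notin T ->
  mult (i |: T) = (mult T * qmult T i)%N.
Proof.
move=> rk iT; have [P PQ] := s2valP (lattice_quotient (cone_mx T)).
have kerQ := s2valP' (lattice_quotient (cone_mx T)).
rewrite [RHS](esym (minors_gcd_col_mx (gen i) rk PQ kerQ)).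
pose e (x : 'I_(1 + #|T|)) : 'I_(nrays S) :=
  match split x with inl _ => i | inr j => enum_val j end.
rewrite -(@mult_enum (i |: T) _ e).
- congr minors_gcd; apply/matrixP => x j; rewrite mxE /e.
  case: (splitP x) => y ey.
    have -> : x = lshift #|T| y by apply: val_inj.
    by rewrite col_mxEu !ord1.
  have -> : x = rshift 1 y by apply: val_inj.
  by rewrite col_mxEd mxE.
- move=> x y; rewrite /e; case: (splitP x) => x' ex; case: (splitP y) => y' ey.
  + by move=> _; apply: val_inj; rewrite /= ex ey !ord1.
  + by move=> ei; move: iT; rewrite ei enum_valP.
  + by move=> ei; move: iT; rewrite -ei enum_valP.
  by move=> /enum_val_inj exy; apply: val_inj; rewrite /= ex ey exy.
move=> x; apply/setU1P/codomP => [[->|xT]|[y ->]].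
- by exists (lshift _ 0); rewrite /e (unsplitK (inl 0 : 'I_1 + 'I_#|T|)%type).
- exists (rshift 1 (enum_rank_in xT x)).
  by rewrite /e (unsplitK (inr _ : 'I_1 + 'I_#|T|)%type) enum_rankK_in.
by rewrite /e; case: (split y) => y'; [left|right; apply: enum_valP].
Qed.
End Multiplicity.

(** * Lefschetz fans *)

Section Lefschetz.
Variable R : realType.
Local Notation intmx := (map_mx (intr : int -> R)).
Local Notation lin S := (@lin R S).

(** Linear forms dual to the generators give a right inverse over [R], and the rank is the same over
    [rat] and [R]. *)
Lemma rank_cone_mx (S : fan) (T : {set 'I_(nrays S)}) : good_fan R S -> T \in cones S ->
  \rank (map_mx (intr : int -> rat) (cone_mx T)) = #|T|.
Proof.
move=> gS TC; rewrite -(mxrank_map (ratr : {rmorphism rat -> R})).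
have -> : map_mx (ratr : rat -> R) (map_mx intr (cone_mx T)) = intmx (cone_mx T).
  by apply/matrixP => i j; rewrite !mxE ratr_int.
have eM (j : 'I_#|T|) : exists m : 'cV[R]_(lrank S), intmx (cone_mx T) *m m = delta_mx j 0.
  have [l [m lE] lj] := lin_interp gS (fun i => (i == enum_val j)%:R) TC.
  exists m; apply/colP => i; have := lj _ (enum_valP i); rewrite lE !mxE => e.
  transitivity ((enum_val i == enum_val j)%:R : R); last by rewrite (inj_eq enum_val_inj) eqxx andbT.
  by rewrite -e; apply: eq_bigr => h _; rewrite !mxE.
have [m mE] := choice eM; apply/eqP/row_freeP.
exists (\matrix_(i, j) m j i 0); apply/matrixP => i j.
have := congr1 (fun Z : 'cV[R]_#|T| => Z i 0) (mE j); rewrite !mxE eqxx andbT => <-.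
by apply: eq_bigr => h _; rewrite !mxE.
Qed.

Lemma multU1_good (S : fan) (T : {set 'I_(nrays S)}) i : good_fan R S -> i \notin T ->
  i |: T \in cones S -> mult (i |: T) = (mult T * qmult T i)%N.
Proof.
move=> gS iT iTC; apply: multU1 => //; apply: rank_cone_mx => //.
exact: (face_sub gS iTC (subsetUr _ _)).
Qed.

Lemma mult_gt0 (S : fan) (T : {set 'I_(nrays S)}) : good_fan R S -> T \in cones S ->
  (0 < mult T)%N.
Proof.
move=> gS; have [N] := ubnP #|T|; elim: N T => // N IHN T.
have [->|[i iT]] := set_0Vmem T; first by rewrite mult0.
rewrite -(setD1K iT) cardsU1 setD11 add1n ltnS => lt_N TC.
rewrite multU1_good ?setD11 // muln_gt0; apply/andP; split.
  by apply: IHN => //; apply: (face_sub gS TC (subsetUr _ _)).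
by apply: (qmult_gt0 gS) => //; rewrite setD11.
Qed.

(** By [multU1_good], [mult (i |: T)] times the primitive generator of the image ray is [mult T]
    times the image of [gen i]; the common factor [mult T] is then cancelled. *)
Lemma minkowski_balanced (S : fan) k (v : {set 'I_(nrays S)} -> R) : good_fan R S ->
  minkowski_weight k (fun A => v A * (mult A)%:R) <-> balanced (cones S) (lin S) k v.
Proof.
move=> gS.
have key (T : {set 'I_(nrays S)}) (m : 'cV[R]_(qrank T)) : T \in cones S ->
  (mult T)%:R * \sum_(i | (i \notin T) && (i |: T \in cones S))
     v (i |: T) * (rgen R i *m intmx (qmap T) *m m) 0 0 =
  ((\sum_(i | (i \notin T) && (i |: T \in cones S))
     (v (i |: T) * (mult (i |: T))%:R) *: rgen R (i : 'I_(nrays (star T)))) *m m) 0 0.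
  move=> TC; rewrite mulmx_suml summxE mulr_sumr; apply: eq_bigr => i /andP[iT iTC].
  rewrite multU1_good // rgen_star -!scalemxAl natrM.
  by rewrite [in LHS]mxE [in RHS]mxE; ring.
split=> [mw T TC eT l /starl_linP[m lE]|bv T TC eT].
  have mT : (mult T)%:R != 0 :> R by rewrite pnatr_eq0 -lt0n mult_gt0.
  apply: (mulfI mT); rewrite mulr0; under eq_bigr do rewrite lE.
  by rewrite key // mw // mul0mx mxE.
apply/rowP => j; rewrite [RHS]mxE.
have := key T (delta_mx j 0) TC.
rewrite (bv T TC eT (fun i => (rgen R i *m intmx (qmap T) *m delta_mx j 0) 0 0)); last first.
  by apply/starl_linP; exists (delta_mx j 0).
rewrite mulr0; set s := \sum_(i | _) _; rewrite -colE mxE => <-.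
by [].
Qed.

(** The representative on the star of [T] is the difference of [c] and a linear form, divided by
    [qmult]; its positivity on cones amounts to positivity on rays, as the coefficients of a nonzero
    vector are not all zero. *)
Lemma strictly_convexE (S : fan) (c : 'I_(nrays S) -> R) : good_fan R S ->
  strictly_convex c <-> convex (cones S) (lin S) c.
Proof.
move=> gS; have starE (T : {set 'I_(nrays S)}) i :
    ([set i] \in cones (star T)) = (i \notin T) && (i |: T \in cones S).
  by rewrite [cones _]/(starc (cones S) T) in_starc disjoints1.
split=> cC T TC.
  have [c' [m mT mc'] pos] := cC T TC.
  exists (fun i => (rgen R i *m m) 0 0) => [|i iT iTC]; first by split=> //; exists m.
  have iS : [set i] \in cones (star T) by rewrite starE iT.
  rewrite (mc' i iS) mulr_gt0 // ?ltr0n ?(qmult_gt0 gS) //.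
  have := pos [set i] (fun=> 1) iS (fun=> ler01); rewrite !big_set1 scale1r mul1r; apply.
  have [l [m' lE] li] := lin_interp (good_star gS TC) (fun=> 1) iS.
  apply/eqP => g0; have := li i (set11 i).
  by rewrite lE g0 mul0mx mxE => /eqP; rewrite eq_sym oner_eq0.
have [l [[m lE] lT] lpos] := cC T TC.
exists (fun i => (c i - l i) / (qmult T i)%:R).
  exists m => [i iT|i iS]; first by rewrite -lE lT.
  by rewrite -lE mulrC divfK // pnatr_eq0 -lt0n (star_ray_qmult gS).
move=> A u AC u0 nz.
have cpos i : i \in A -> 0 < (c i - l i) / (qmult T i)%:R.
  move=> iA; have : [set i] \in cones (star T).
    by apply: (face_sub (good_star gS TC) AC); rewrite sub1set.
  rewrite starE => /andP[iT iTC].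
  by rewrite divr_gt0 ?lpos // ltr0n (qmult_gt0 gS).
have ge0 i : i \in A -> 0 <= u i * ((c i - l i) / (qmult T i)%:R).
  by move=> iA; rewrite mulr_ge0 // ltW // cpos.
rewrite lt_neqAle sumr_ge0 // andbT; apply: contra nz => /eqP/esym/psumr_eq0P e0.
apply/eqP/big1 => i iA; have /eqP := e0 ge0 i iA.
by rewrite mulf_eq0 [X in _ || X]gt_eqF ?cpos // orbF => /eqP->; rewrite scale0r.
Qed.

(** The relation of [l] times the monomial of [T] has degree zero. Rays of [T] drop out because [l]
    vanishes there, and rays outside the star because they give non-cones. *)
Lemma balanced_deg n (C : {set {set 'I_n}}) L k (deg : {scalar {mpoly R[n]}}) :
  (forall A B : {set 'I_n}, A \in C -> B \subset A -> B \in C) ->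
  (forall p, p \is k.-homog -> deg p = 0 <-> cideal C L p) ->
  balanced C L k (fun A => deg (mono R A)).
Proof.
move=> Csub degP T TC eT l [Ll lT].
have : deg (mono R T * plf C l) = 0.
  apply/degP; first by apply: (dhomogMe (dhomog_mono R T) (dhomog_plf C l)); rewrite addn1.
  by apply: generatedM; apply: cideal_lin.
rewrite /plf mulr_sumr raddf_sum /= => sum0; rewrite -[RHS]sum0.
rewrite [RHS](bigID (fun i => (i \notin T) && (i |: T \in C))) /=.
rewrite [X in _ = _ + X]big1 ?addr0 => [|i /andP[iC]].
  apply: eq_big => [i|i /andP[iT iTC]].
    apply/idP/andP => [iTC|[]//]; split=> //; case/andP: iTC => _ /Csub; apply.
    exact: subsetUl.
  by rewrite monoU1 // -scalerAr linearZ /= [mono R T * _]mulrC [LHS]mulrC.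
rewrite negb_and negbK -scalerAr linearZ /= => /orP[iT|iTC]; first by rewrite lT // mul0r.
have [iT|iT] := boolP (i \in T); first by rewrite lT // mul0r.
rewrite [mono R T * _]mulrC -monoU1 // (_ : deg _ = 0) ?mulr0 //; apply/degP; last exact: cideal_nonface.
by have := dhomog_mono R (i |: T); rewrite cardsU1 iT add1n eT.
Qed.

(** Weight and degree are matched by [w A = deg (mono R A) * (mult A)%:R]. *)
Lemma lefschetz_conditionsE (S : fan) : good_fan R S ->
  lefschetz_conditions R S <-> kahler (cones S) (lin S).
Proof.
move=> gS; rewrite /lefschetz_conditions /kahler -/(cdim (cones S)).
have eI := chow_idealE R S.
have mneq0 A : A \in cones S -> (mult A)%:R != 0 :> R.
  by move=> AC; rewrite pnatr_eq0 -lt0n (mult_gt0 gS).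
have mpos A : A \in cones S -> 0 < (mult A)%:R :> R.
  by move=> AC; rewrite ltr0n (mult_gt0 gS).
have convE c : strictly_convex c <-> convex (cones S) (lin S) c := strictly_convexE c gS.
split=> [[w [deg [wpos [wmw wspan] [degP degs degw] pd HC]]]|[deg [degP deg_pos wC pd HC]]].
  exists deg; split.
  - by move=> p hp; rewrite -eI; apply: degP.
  - move=> A AC eA; have := wpos A AC eA; rewrite -degw // pmulr_lgt0 //; exact: mpos.
  - move=> v /(minkowski_balanced _ _ gS)/wspan[z zP]; exists z => A AC eA.
    by apply: (mulIf (mneq0 A AC)); rewrite zP // -degw // mulrA.
  - by rewrite -eI.
  - by move=> f /convE/HC; rewrite -eI.
exists (fun A => deg (mono R A) * (mult A)%:R), deg; split.
- by move=> A AC eA; rewrite mulr_gt0 ?mpos // deg_pos.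
- split.
    by apply/minkowski_balanced => //; apply: balanced_deg => //; apply: (face_sub gS).
  move=> v mv; have [|z zP] := wC (fun A => v A / (mult A)%:R).
    apply/minkowski_balanced => // T TC eT; rewrite -[RHS](mv T TC eT).
    by apply: eq_bigr => i /andP[_ iTC]; rewrite mulfVK ?mneq0.
  by exists z => A AC eA; rewrite mulrA -zP // mulfVK // mneq0.
- split.
  + by move=> p hp; rewrite eI; apply: degP.
  + move=> x; have [A AC eA] := cdim_attained (face0 gS).
    have pos := deg_pos A AC eA.
    exists ((x / deg (mono R A)) *: mono R A); last by rewrite linearZ /= mulfVK // gt_eqF.
    by rewrite dhomogZ //; have := dhomog_mono R A; rewrite eA.
  + by [].
- by move: pd; rewrite -eI.
- by move=> f /convE/HC; rewrite -eI.
Qed.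

(** Induction on the number of cones: the star of a nonzero cone [T] has fewer, since [T] itself is
    lost, and its stars are those of [S] up to rescaling. *)
Theorem lefschetzE (S : fan) : good_fan R S ->
  lefschetz R S <-> kahler_stars (cones S) (lin S).
Proof.
have [N] := ubnP #|cones S|; elim: N S => [S|N IHN S lt_N gS]; first by rewrite ltn0.
have starK (T : {set 'I_(nrays S)}) : T \in cones S ->
    kahler (cones (star T)) (lin (star T)) <-> kahler (starc (cones S) T) (starl (lin S) T).
  move=> TC; have sT := simplicial_star gS TC; have gT := good_star gS TC.
  have iso := star_fan_iso T gS.
  by split; [apply: (kahler_iso gT sT iso)|apply: (kahler_iso sT gT (fan_iso_sym iso))].
split=> [[condS starS] T TC|H].
  have [->|T0] := eqVneq T set0.
    by rewrite starc0 starl0; apply/lefschetz_conditionsE.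
  apply/(starK T TC)/lefschetz_conditionsE; first exact: good_star.
  by case: (starS T TC T0).
split; first by apply/lefschetz_conditionsE => //; have := H _ (face0 gS); rewrite starc0 starl0.
move=> T TC T0; have gT := good_star gS TC; have sT := simplicial_star gS TC; have iso := star_fan_iso T gS.
apply/IHN => //.
  rewrite ltnS in lt_N; apply: leq_trans lt_N; apply: proper_card; apply/properP; split.
    apply/subsetP => B; rewrite [cones _]/(starc (cones S) T) in_starc.
    by move=> /andP[_ /(face_sub gS)]; apply; apply: subsetUl.
  exists T => //; rewrite [cones _]/(starc (cones S) T) in_starc -setI_eq0 setIid.
  by rewrite (negPf T0).
move=> U US; have US' : U \in starc (cones S) T by [].
have TUC : T :|: U \in cones S by move: US'; rewrite in_starc setUC => /andP[].
have := H (T :|: U) TUC; rewrite -starc_starc // -starl_starl.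
have := fan_iso_star gT sT iso US; rewrite imset_id => /fan_iso_sym isoU.
apply: (kahler_iso _ _ isoU).
- exact: simplicial_star (simplicial_star gS TC) US'.
- exact: simplicial_star gT US.
Qed.

End Lefschetz.

(** * Stellar subdivisions *)

Lemma lefschetz_starE (R : realType) (S : fan) (T : {set 'I_(nrays S)}) :
  good_fan R S -> T \in cones S ->
  lefschetz R (star T) <-> kahler_stars (starc (cones S) T) (starl (@lin R S) T).
Proof.
move=> gS TC; have gT := good_star gS TC; have sT := simplicial_star gS TC.
have iso := star_fan_iso T gS; rewrite lefschetzE //; split; first exact: (kahler_stars_iso gT sT iso).
exact: (kahler_stars_iso sT gT (fan_iso_sym iso)).
Qed.

(** The stars at [a |: U] and [b |: U] are the star of the base at [U], which settles one direction;
    in the other only the cones of the base call for [kahler_bundle]. *)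
Lemma kahler_stars_bundle (R : realType) n (a b : 'I_n) (ab : a != b)
    (C : {set {set 'I_n}}) (L : ('I_n -> R) -> Prop) (base : bundle_base a b C L) c :
  kahler_stars (bcones a b C) (blin a b L c) <-> kahler_stars C L.
Proof.
have [sC aC La] := base.
have Ua U : U \in C -> starc (bcones a b C) (a |: U) = starc C U /\
    starl (blin a b L c) (a |: U) = starl L U.
  move=> UC; rewrite -starc_starc ?(starc_bundle_a ab base) //.
  by rewrite -starl_starl (starl_bundle_a base).
have Ub U : U \in C -> starc (bcones a b C) (b |: U) = starc C U /\
    starl (blin a b L c) (b |: U) = starl L U.
  move=> UC; rewrite -starc_starc ?(starc_bundle_b ab base) //.
  by rewrite -starl_starl (starl_bundle_b ab base).
split=> [H U UC|H V /bconesP[UC|U UC ->|U UC ->]].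
- by have := H _ (bconesUa ab base UC); have [-> ->] := Ua U UC.
- have [m Lm mc] := lin_interp sC c UC.
  rewrite (starc_bundle base UC) (starl_bundle ab base UC Lm mc).
  apply: kahler_bundle => // [|T TU]; first exact: base_star.
  rewrite starc_starc // starl_starl; apply: H.
  by move: TU; rewrite in_starc setUC => /andP[].
- by have [-> ->] := Ua U UC; apply: H.
- by have [-> ->] := Ub U UC; apply: H.
Qed.

Section Stellar.
Variables (R : realType) (S : fan) (sigma : {set 'I_(nrays S)}).
Hypotheses (gS : good_fan R S) (sigmaC : sigma \in cones S) (sigma2 : #|sigma| = 2%N).
Local Notation n := (nrays S).
Local Notation tS := (stellar sigma).
Local Notation up := (lift (@ord_max n)).
Local Notation rho := (@ord_max n).

Definition down (A : {set 'I_n.+1}) : {set 'I_n} := [set i | up i \in A].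

Lemma down_up (B : {set 'I_n}) : down [set up i | i in B] = B.
Proof. by apply/setP => i; rewrite inE mem_imset //; apply: lift_inj. Qed.

Lemma down_newU (A : {set 'I_n.+1}) : down (rho |: A) = down A.
Proof. by apply/setP => i; rewrite !inE eq_sym (negPf (neq_lift _ _)). Qed.

Lemma up_notin (B : {set 'I_n}) : rho \notin [set up i | i in B].
Proof. by apply/imsetP => -[i _ /eqP]; rewrite (negPf (neq_lift _ _)). Qed.

Lemma up_down (A : {set 'I_n.+1}) : rho \notin A -> [set up i | i in down A] = A.
Proof.
move=> rA; apply/setP => x; apply/imsetP/idP => [[i]|xA]; first by rewrite inE => ? ->.
have xr : rho != x by apply: contraNneq rA => ->.
by have [i ei _] := unlift_some xr; exists i => //; rewrite inE -ei.
Qed.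

(** For a cone with the new ray, the face of [sigma] and the cone of the link are recovered as the
    parts of [down A] inside and outside [sigma]. *)
Lemma in_stellar (A : {set 'I_n.+1}) : (A \in cones tS) =
  ~~ (sigma \subset down A) &&
  (if rho \in A then down A :|: sigma \in cones S else down A \in cones S).
Proof.
apply/idP/idP => [|/andP[nsub]].
  rewrite inE => /orP[/imsetP[B]|/imset2P[T L]].
    by rewrite inE => /andP[BC sB] ->; rewrite down_up (negPf (up_notin B)) sB.
  rewrite !inE => Tsig /andP[LC /andP[dL sLC]] ->.
  rewrite down_newU down_up setU11; apply/andP; split.
    apply: contraL Tsig => sTL; rewrite properE negb_and negbK; apply/orP; right.
    apply/subsetP => i isig; have := subsetP sTL i isig.
    by rewrite inE (disjointFr dL isig) orbF.
  by rewrite -setUA (setUC L) setUA (setUidPr (proper_sub Tsig)).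
case: ifP => [rA AC|/negbT rA AC]; rewrite inE; apply/orP; [right|left].
  apply/imset2P; exists (down A :&: sigma) (down A :\: sigma).
  - by rewrite inE properE subsetIr subsetI subxx andbT.
  - rewrite inE; apply/and3P; split.
    + by apply: (face_sub gS AC); apply: subset_trans (subsetDl _ _) (subsetUl _ _).
    + rewrite -setI_eq0; apply/eqP/setP => i; rewrite !inE.
      by case: (i \in sigma); rewrite ?andbF.
    + rewrite (_ : sigma :|: _ = down A :|: sigma) //; apply/setP => i; rewrite !inE.
      by case: (i \in sigma); rewrite ?orbT ?orbF.
  rewrite setID; apply/setP => x; rewrite in_setU1.
  have [->|xr] := eqVneq x rho => //=.
  rewrite eq_sym in xr; have [i -> _] := unlift_some xr.
  by rewrite mem_imset ?inE //; apply: lift_inj.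
apply/imsetP; exists (down A); last by rewrite up_down.
by rewrite inE AC nsub.
Qed.

Lemma rgen_up i : rgen R (up i : 'I_(nrays tS)) = rgen R i.
Proof. by rewrite /rgen /= liftK. Qed.

(** The content enters because the sum of the generators need not be primitive when [sigma] is not
    unimodular. *)
Lemma rgen_rho (m : 'cV[R]_(lrank S)) :
  (content (\sum_(j in sigma) gen j))%:R * ((rgen R (rho : 'I_(nrays tS)) : 'rV_(lrank S)) *m m) 0 0 =
  \sum_(j in sigma) (rgen R j *m m) 0 0.
Proof.
rewrite -summxE -mulmx_suml /rgen -map_mx_sum {2}(content_primv (\sum_(j in sigma) gen j)).
by rewrite map_mxZ -scalemxAl [in RHS]mxE /= unlift_none.
Qed.

(** A linear form equal to 1 on both rays of [sigma] takes the value 2 on the sum, which is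
    therefore not zero. *)
Lemma content_rho : (content (\sum_(j in sigma) gen j))%:R != 0 :> R.
Proof.
rewrite pnatr_eq0; apply/negP => /eqP c0.
have [l [m lE] l1] := lin_interp gS (fun=> 1) sigmaC.
have := rgen_rho m; rewrite c0 mul0r => /esym.
under eq_bigr => j js do rewrite -lE (l1 j js).
by rewrite sumr_const sigma2 => /eqP; rewrite pnatr_eq0.
Qed.

Lemma good_stellar : good_fan R tS.
Proof.
split.
- rewrite in_stellar in_set0; have -> : down set0 = set0 by apply/setP => i; rewrite !inE.
  by rewrite (face0 gS) andbT subset0 -cards_eq0 sigma2.
- move=> A B; rewrite !in_stellar => /andP[sA AC] BA.
  have dBA : down B \subset down A by apply/subsetP => i; rewrite !inE => /(subsetP BA).
  apply/andP; split; first by apply: contra sA => /subset_trans; apply.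
  case: ifP => rB; first by rewrite (subsetP BA _ rB) in AC; apply: (face_sub gS AC (setSU _ dBA)).
  by case: ifP AC => rA AC; apply: (face_sub gS AC) => //; apply: subset_trans dBA (subsetUl _ _).
- by exists 0 => i; rewrite mulmx0 mxE.
- move=> l l' [m lE] [m' lE']; exists (m + m') => i.
  by rewrite mulmxDr mxE lE lE'.
- by move=> z l [m lE]; exists (z *: m) => i; rewrite -scalemxAr mxE lE.
move=> A u; rewrite in_stellar => /andP[sA AC].
pose k : R := (content (\sum_(j in sigma) gen j))%:R.
(* A cone of the subdivision misses some ray [s] of [sigma]. The value at [s] is free, and [v]
   adjusts it so that the form takes the prescribed value at the new ray. *)
have /subsetPn[s ss sA'] := sA.
pose v i := if i == s then k * u rho - \sum_(j in sigma | j != s) u (up j) else u (up i).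
have vs : \sum_(j in sigma) v j = k * u rho.
  rewrite (bigD1 s) //= {1}/v eqxx [X in _ + X](eq_bigr (fun j => u (up j))).
    by rewrite subrK.
  by move=> j /andP[_ /negPf js]; rewrite /v js.
have [B [BC dAB sB]] : exists B, [/\ B \in cones S, down A \subset B &
    rho \in A -> sigma \subset B].
  case: ifP AC => rA AC; [exists (down A :|: sigma)|exists (down A)]; split=> //.
    exact: subsetUl.
  by move=> _; apply: subsetUr.
have [l [m lE] lB] := lin_interp gS v BC.
exists (fun i => ((rgen R (i : 'I_(nrays tS)) : 'rV_(lrank S)) *m m) 0 0); first by exists m.
move=> i iA; have [ir|] := eqVneq i rho.
  rewrite ir in iA *; apply: (mulfI content_rho); rewrite rgen_rho -vs.
  by apply: eq_bigr => j js; rewrite -lE lB // (subsetP (sB iA)).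
rewrite eq_sym => /unlift_some[j ij _]; rewrite ij rgen_up -lE.
have jA : j \in down A by rewrite inE -ij.
rewrite lB ?(subsetP dAB) // /v; case: eqP => // js.
by rewrite -js jA in sA'.
Qed.

Lemma new_ray_cone : new_ray sigma \in cones tS.
Proof.
rewrite in_stellar [in rho \in _]/new_ray set11.
have -> : down (new_ray sigma) = set0.
  by apply/setP => i; rewrite !inE eq_sym (negPf (neq_lift _ _)).
by rewrite set0U sigmaC subset0 -cards_eq0 sigma2.
Qed.

(** * The star of the new ray as a bundle *)

Section Iso.
Variables (a b : 'I_n) (ab : a != b) (sab : sigma = [set a; b]).
Variable c : 'I_n -> R.
Hypotheses (Lc : @lin R S c) (ca : c a = 1) (cb : c b = -1).
Local Notation C := (starc (cones S) sigma).
Local Notation L := (starl (@lin R S) sigma).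

Lemma bundle_base_sigma : bundle_base a b C L.
Proof.
split; first exact: simplicial_star.
- move=> A; rewrite in_starc => /andP[dA _].
  by rewrite !(disjointFl dA) // sab !inE eqxx ?orbT.
- by move=> l [_ l0]; split; apply: l0; rewrite sab !inE eqxx ?orbT.
Qed.

Lemma in_bcones_sigma A : (A \in bcones a b C) = ~~ (sigma \subset A) && (A :|: sigma \in cones S).
Proof.
rewrite inE -sab in_starc [RHS]andbC; congr (_ && ~~ _).
  rewrite (_ : [disjoint A :\: sigma & sigma] = true) /=; last first.
    rewrite -setI_eq0; apply/eqP/setP => i; rewrite !inE.
    by case: (i \in sigma); rewrite ?andbF.
  rewrite (_ : A :\: sigma :|: sigma = A :|: sigma) //; apply/setP => i; rewrite !inE.
  by case: (i \in sigma); rewrite ?orbT ?orbF.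
by rewrite sab subUset !sub1set.
Qed.

Lemma in_star_rho A : (A \in starc (cones tS) (new_ray sigma)) =
  (rho \notin A) && (down A \in bcones a b C).
Proof.
rewrite in_starc disjoint_sym /new_ray disjoints1 setUC in_stellar setU11 down_newU.
by rewrite in_bcones_sigma.
Qed.

Lemma twist_sigma i : twist a b c i = c i.
Proof. by rewrite /twist; case: eqP => [->|_]; rewrite ?ca //; case: eqP => [->|]. Qed.

(** The default [a] is only the value at the new ray, which is not a ray of its own star. *)
Let h (j : 'I_n.+1) : 'I_n := odflt a (unlift rho j).

Let hup i : h (up i) = i. Proof. by rewrite /h liftK. Qed.

Let himset (A : {set 'I_n.+1}) : rho \notin A -> h @: A = down A.
Proof.
move=> rA; rewrite -{1}(up_down rA) -imset_comp; apply/setP => i; apply/imsetP/idP.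
  by move=> [j jA ->]; rewrite /= hup.
by move=> iA; exists i; rewrite //= hup.
Qed.

(** A linear form vanishes at the new ray iff its values at [a] and [b] are opposite, that is, iff
    it is a multiple of [c] plus a form vanishing on [sigma]. The old generators are kept, so all
    factors are 1. *)
Lemma stellar_iso : fan_iso (bcones a b C) (blin a b L c)
  (starc (cones tS) (new_ray sigma)) (starl (@lin R tS) (new_ray sigma))
  up h (fun=> 1) (fun=> 1).
Proof.
have sum_sigma (l : 'I_n -> R) : \sum_(j in sigma) l j = l a + l b.
  by rewrite sab big_setU1 ?big_set1 ?inE.
split=> //.
- move=> j; rewrite in_star_rho => /andP[].
  by rewrite inE => /unlift_some[i -> _] _; rewrite hup.
- by move=> A Ac; rewrite in_star_rho down_up Ac up_notin.
- by move=> A; rewrite in_star_rho => /andP[rA Ac]; rewrite himset.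
- by move=> i _; rewrite mulr1.
- move=> l [z [k [[m kE] k0] lE]]; have [mc cE] := Lc.
  pose m' := z *: mc + m.
  have lm i : l i = (rgen R i *m m') 0 0.
    by rewrite lE twist_sigma cE kE /m' mulmxDr -scalemxAr !mxE.
  exists (fun i => ((rgen R (i : 'I_(nrays tS)) : 'rV_(lrank S)) *m m') 0 0); last first.
    by move=> i _; rewrite rgen_up -lm mul1r.
  split; first by exists m'.
  move=> i; rewrite inE => /eqP->; apply: (mulfI content_rho); rewrite rgen_rho mulr0.
  rewrite (eq_bigr l) => [|j _]; last by rewrite -lm.
  rewrite sum_sigma !lE !twist_sigma ca cb !k0 ?sab ?inE ?eqxx ?orbT //; ring.
move=> l' [[m lE] l0]; pose l (i : 'I_n) := (@rgen R S i *m (m : 'cV_(lrank S))) 0 0.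
have lab : l b = - l a.
  have := rgen_rho m; rewrite -/(l _) (sum_sigma l) -lE l0 ?inE // mulr0 => e.
  by apply/eqP; rewrite -addr_eq0 addrC -e.
exists l => [|j]; last first.
  rewrite in_star_rho => /andP[]; rewrite inE => /unlift_some[i -> _] _.
  by rewrite hup mul1r lE rgen_up.
have Ll : @lin R S l by exists m.
exists (l a), (fun i => l i - l a * c i) => [|i]; last by rewrite twist_sigma addrC subrK.
split; first exact: (linB gS Ll (linZ gS _ Lc)).
move=> i; rewrite sab !inE => /orP[]/eqP->; rewrite ?ca ?cb ?lab; ring.
Qed.

End Iso.
End Stellar.

Unset Implicit Arguments.
Local Close Scope ring_scope.

Theorem theorem5p24 (R : realType) (S : fan) (d : nat)
    (S_fan : simplicial_fan R S) (S_dim : fdim S = d)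
    (sigma : {set 'I_(nrays S)}) (sigma_cone : sigma \in cones S)
    (sigma_dim : #|sigma| = 2) :
  let tDelta := star (new_ray sigma) in
  let Delta := star sigma in
  lefschetz R Delta <-> lefschetz R tDelta.
Proof.
have gS := simplicial_good S_fan; have gtS := good_stellar gS sigma_cone sigma_dim.
have rC := new_ray_cone gS sigma_cone sigma_dim.
have /cards2P[a [b [ab sab]]] : #|sigma| == 2 by apply/eqP.
(* The twist of the bundle: a linear form on the whole space with values 1 and -1 on the rays of
   [sigma]. *)
have [c Lc cE] := lin_interp gS (fun i => if i == a then 1 else -1)%R sigma_cone.
have ca : c a = 1%R by rewrite cE ?eqxx // sab !inE eqxx.
have cb : c b = (-1)%R by rewrite cE ?sab ?inE ?eqxx ?orbT // eq_sym (negPf ab).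
have base := bundle_base_sigma gS sigma_cone sab.
have iso := stellar_iso gS sigma_cone sigma_dim ab sab Lc ca cb.
have sD := simplicial_bundle ab base c; have sT := simplicial_star gtS rC.
rewrite /= (lefschetz_starE gS sigma_cone) (lefschetz_starE gtS rC).
rewrite -(kahler_stars_bundle ab base c); split.
  exact: kahler_stars_iso sD sT iso.
exact: kahler_stars_iso sT sD (fan_iso_sym iso).
Qed.
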